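(* Let $D_1 \subset \mathbb{C}^n$ and $D_2 \subset \mathbb{C}^m$ be bounded domains and let $\mu_1, \mu_2$ be positive continuous weights on $\overline{D_1}, \overline{D_2}$ respectively. Let $f : (D_1, ds^2_{D_1, \mu_1}) \to (D_2, ds^2_{D_2, \mu_2})$ be a holomorphic isometry. Then there exist functions $s_0 \in \mathcal{O}_{\mu_1}(D_1)$ and $r_0 \in \mathcal{O}_{\mu_2}(D_2)$ such that $$s_0(z)\, \overline{s_0(w)}\, K_{D_2, \mu_2}(f(z), f(w)) = r_0(f(z))\, \overline{r_0(f(w))}\, K_{D_1, \mu_1}(z, w)$$ for all $z, w \in D_1$. In particular, if $D_1 = D_2 = \mathbb{D}$ and $\mu_1 \equiv 1$, then $f$ is an automorphism (biholomorphic self-map) of $\mathbb{D}$.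
   Context: $\mathbb{D}\subset\mathbb{C}$ is the open unit disc. For a bounded domain $D \subset \mathbb{C}^n$ and a positive continuous function (weight) $\mu$ on $\overline{D}$, $L^2_\mu(D)$ is the space of functions on $D$ square integrable with respect to $\mu\, dV$ ($dV$ is Lebesgue measure), and $\mathcal{O}_\mu(D) = L^2_\mu(D) \cap \mathcal{O}(D)$ is the closed subspace of holomorphic functions. $K_{D,\mu}(z,w)$ is the reproducing kernel of $\mathcal{O}_\mu(D)$ (the weighted Bergman kernel), and $K_{D,\mu}(z) = K_{D,\mu}(z,z)$. The weighted Bergman metric is $$ds^2_{D,\mu} = \sum_{i,j} \frac{\partial^2}{\partial z_i \partial \overline{z}_j} \log K_{D,\mu}(z)\; dz_i \otimes d\overline{z}_j .$$ A holomorphic isometry $f:(D_1, ds^2_{D_1,\mu_1}) \to (D_2, ds^2_{D_2,\mu_2})$ is a holomorphic map $f: D_1 \to D_2$ with $f^* ds^2_{D_2,\mu_2} = ds^2_{D_1,\mu_1}$. *)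

(* Defs.v *)
From HB Require Import structures.
From mathcomp Require Export all_boot all_order all_algebra.
From mathcomp Require Export all_classical all_reals all_analysis.
From mathcomp Require Export complex.

Set Implicit Arguments.
Unset Strict Implicit.
Unset Printing Implicit Defensive.

Import Order.TTheory GRing.Theory Num.Theory.
Import numFieldNormedType.Exports numFieldTopology.Exports.

Local Open Scope classical_set_scope.
Local Open Scope ring_scope.
Local Open Scope complex_scope.

(* R[i] as a normed space over itself, so that [differentiable] on 'rV[R[i]]_n
   is complex differentiability. *)
HB.instance Definition _ (R : rcfType) := PseudoPointedMetric.copy R[i] R[i]^o.
HB.instance Definition _ (R : rcfType) := GRing.ComAlgebra.copy R[i] R[i]^o.
HB.instance Definition _ (R : rcfType) := Vector.copy R[i] R[i]^o.
HB.instance Definition _ (R : rcfType) := NormedModule.copy R[i] R[i]^o.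

Section power_measure.
Context d (T : measurableType d) (R : realType).

Definition cons_tuple n (p : T * n.-tuple T) : n.+1.-tuple T :=
  [the n.+1.-tuple T of p.1 :: p.2].

Lemma measurable_cons_tuple n : measurable_fun [set: _] (@cons_tuple n).
Proof. exact: measurable_cons. Qed.

Section cons.
Variables (m1 : {sigma_finite_measure set T -> \bar R}) (n : nat).
Variable m2 : {sigma_finite_measure set (n.-tuple T) -> \bar R}.

Definition cons_measure : set (n.+1.-tuple T) -> \bar R :=
  pushforward (m1 \x m2)%E (@cons_tuple n).

Lemma cons_measure0 : cons_measure set0 = 0%E.
Proof. by rewrite /cons_measure /pushforward preimage_set0 measure0. Qed.

Lemma cons_measure_ge0 A : (0 <= cons_measure A)%E.
Proof. by rewrite /cons_measure /pushforward; exact: measure_ge0. Qed.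

Lemma cons_measure_sigma_additive : semi_sigma_additive cons_measure.
Proof.
move=> F mF tF mUF; rewrite /cons_measure /pushforward preimage_bigcup.
apply: measure_semi_sigma_additive.
- by move=> k; rewrite -[X in measurable X]setTI; exact: measurable_cons_tuple.
- apply/trivIsetP => i j _ _ ij; rewrite -preimage_setI.
  by move/trivIsetP : tF => -> //; rewrite preimage_set0.
- rewrite -preimage_bigcup -[X in measurable X]setTI.
  exact: measurable_cons_tuple.
Qed.

HB.instance Definition _ := isMeasure.Build _ _ _ cons_measure
  cons_measure0 cons_measure_ge0 cons_measure_sigma_additive.

Lemma cons_measure_sigma_finite : sigma_finite setT cons_measure.
Proof.
have /sigma_finiteP [F [FT ndF Foo]] := sigma_finiteT m1.
have /sigma_finiteP [G [GT ndG Goo]] := sigma_finiteT m2.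
exists (fun k => [set t : n.+1.-tuple T | F k (thead t)] `&`
                 [set t : n.+1.-tuple T | G k [tuple of behead t]]).
  apply/seteqP; split => // t _.
  have [i _ Fi] : (\bigcup_k F k) (thead t) by rewrite -FT.
  have [j _ Gj] : (\bigcup_k G k) [tuple of behead t] by rewrite -GT.
  exists (maxn i j) => //; split => /=.
    by move: Fi; exact/subsetPset/ndF/leq_maxl.
  by move: Gj; exact/subsetPset/ndG/leq_maxr.
move=> k; have [mF Fk] := Foo k; have [mG Gk] := Goo k.
split.
  apply: measurableI; rewrite -[X in measurable X]setTI.
    exact: (@measurable_tnth _ T n.+1 ord0 measurableT _ mF).
  exact: (@measurable_behead _ T n measurableT _ mG).
rewrite /cons_measure /pushforward.
rewrite (_ : _ @^-1` _ = F k `*` G k); last first.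
  apply/seteqP; split => -[x t] /=.
    rewrite theadE; rewrite (_ : [tuple of _] = t) //; exact: val_inj.
  by rewrite theadE (_ : [tuple of _] = t) //; exact: val_inj.
by rewrite product_measure1E// lte_mul_pinfty// ge0_fin_numE.
Qed.

HB.instance Definition _ := Measure_isSigmaFinite.Build _ _ _ cons_measure
  cons_measure_sigma_finite.

End cons.

Fixpoint power_measure (m : {sigma_finite_measure set T -> \bar R}) (n : nat) :
    {sigma_finite_measure set (n.-tuple T) -> \bar R} :=
  match n with
  | 0 => dirac [tuple]
  | n'.+1 => cons_measure m (power_measure m n')
  end.

End power_measure.

Section bergman.
Context (R : realType).
Local Notation C := R[i].
Local Notation Re := (@complex.Re R).
Local Notation Im := (@complex.Im R).
Local Notation "''C^' n" := 'rV[C]_n (at level 8, n at level 2).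

(* Named because the sigma-finite instance on [m1 \x m2] is shadowed by the one
   for subprobabilities. *)
Definition lebesgue_plane :
    set (measurableTypeR R * measurableTypeR R) -> \bar R :=
  (@lebesgue_measure R \x @lebesgue_measure R)%E.

HB.instance Definition _ := Measure.on lebesgue_plane.

Lemma lebesgue_plane_sigma_finite : sigma_finite setT lebesgue_plane.
Proof.
have /sigma_finiteP [F [FT ndF Foo]] := sigma_finiteT (@lebesgue_measure R).
exists (fun k => F k `*` F k).
  rewrite -setXTT [in LHS]FT; apply/seteqP; split => -[x y].
    move=> [/= [i _ Fi] [j _ Fj]]; exists (maxn i j) => //; split => /=.
      by move: Fi; exact/subsetPset/ndF/leq_maxl.
    by move: Fj; exact/subsetPset/ndF/leq_maxr.
  by move=> [k _ [/= Fx Fy]]; split; exists k.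
move=> k; have [mF Fk] := Foo k; split; first exact: measurableX.
by rewrite /lebesgue_plane product_measure1E// lte_mul_pinfty// ge0_fin_numE.
Qed.

HB.instance Definition _ := Measure_isSigmaFinite.Build _ _ _ lebesgue_plane
  lebesgue_plane_sigma_finite.

(* C^n is coordinatized by (R^2)^n, on which Lebesgue measure lives. *)
Definition toC n (t : n.-tuple (measurableTypeR R * measurableTypeR R)%type) : 'C^n :=
  \row_j ((tnth t j).1 +i* (tnth t j).2).

Definition dV n := power_measure lebesgue_plane n.

Definition integralC n (D : set 'C^n) (h : 'C^n -> C) : C :=
  (\int[dV n]_(t in @toC n @^-1` D) (Re (h (toC t)))) +i*
  (\int[dV n]_(t in @toC n @^-1` D) (Im (h (toC t)))).

Definition bounded_domain n (D : set 'C^n) :=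
  [/\ D !=set0, open D, connected D & bounded_set D].

Definition weight n (D : set 'C^n) (mu : 'C^n -> R) :=
  {within closure D, continuous mu} /\ forall z, closure D z -> 0 < mu z.

Definition holomorphic n m (D : set 'C^n) (h : 'C^n -> 'C^m) :=
  forall z, D z -> differentiable h z.

Definition holomorphic_fun n (D : set 'C^n) (h : 'C^n -> C) :=
  forall z, D z -> differentiable h z.

Definition weighted_L2 n (D : set 'C^n) (mu : 'C^n -> R) (h : 'C^n -> C) :=
  [/\ measurable_fun (@toC n @^-1` D) (fun t => Re (h (toC t))),
      measurable_fun (@toC n @^-1` D) (fun t => Im (h (toC t))) &
      (\int[dV n]_(t in @toC n @^-1` D)
         (((Re (h (toC t))) ^+ 2 + (Im (h (toC t))) ^+ 2) * mu (toC t))%:E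
       < +oo)%E].

Definition bergman_space n (D : set 'C^n) (mu : 'C^n -> R) (h : 'C^n -> C) :=
  weighted_L2 D mu h /\ holomorphic_fun D h.

Definition is_reproducing_kernel n (D : set 'C^n) (mu : 'C^n -> R)
    (K : 'C^n -> 'C^n -> C) :=
  forall w, D w -> bergman_space D mu (K ^~ w) /\
    forall h, bergman_space D mu h ->
      h w = integralC D (fun z => h z * (K z w)^* * (mu z)%:C).

(* The reproducing kernel is unique on D x D; it is irrelevant outside. *)
Definition bergman_kernel n (D : set 'C^n) (mu : 'C^n -> R) :
    'C^n -> 'C^n -> C :=
  xget (fun _ _ => 0) [set K | is_reproducing_kernel D mu K].

Definition real_derive n (h : 'C^n -> C) (v z : 'C^n) : C :=
  derive1 (fun t : R => Re (h (z + t%:C *: v))) 0 +i*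
  derive1 (fun t : R => Im (h (z + t%:C *: v))) 0.

(* d/dz_i = (d/dx_i - i d/dy_i) / 2 and d/d\bar z_i = (d/dx_i + i d/dy_i) / 2 *)
Definition d_z n (i : 'I_n) (h : 'C^n -> C) (z : 'C^n) : C :=
  2^-1 * (real_derive h (delta_mx 0 i) z
          - 'i * real_derive h ('i *: delta_mx 0 i) z).

Definition d_zbar n (i : 'I_n) (h : 'C^n -> C) (z : 'C^n) : C :=
  2^-1 * (real_derive h (delta_mx 0 i) z
          + 'i * real_derive h ('i *: delta_mx 0 i) z).

(* K(z,z) is real, so log K(z,z) is the real logarithm of its real part. *)
Definition log_bergman_kernel n (D : set 'C^n) (mu : 'C^n -> R) (z : 'C^n) : C :=
  (ln (Re (bergman_kernel D mu z z)))%:C.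

(* the value of ds^2 at z on the pair of tangent vectors (u, v), where
   dz_i (x) d\bar z_j sends (u, v) to u_i \bar v_j *)
Definition bergman_metric n (D : set 'C^n) (mu : 'C^n -> R)
    (z u v : 'C^n) : C :=
  \sum_(i < n) \sum_(j < n)
    d_z i (d_zbar j (log_bergman_kernel D mu)) z * (u 0 i * (v 0 j)^*).

Definition holomorphic_isometry n m (D1 : set 'C^n) (mu1 : 'C^n -> R)
    (D2 : set 'C^m) (mu2 : 'C^m -> R) (f : 'C^n -> 'C^m) :=
  [/\ holomorphic D1 f,
      forall z, D1 z -> D2 (f z) &
      forall z, D1 z -> forall u v,
        bergman_metric D2 mu2 (f z) ('d f z u) ('d f z v) =
        bergman_metric D1 mu1 z u v].

Definition unit_disc : set 'C^1 := [set z : 'C^1 | `|z 0 0| < 1].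

Definition automorphism n (D : set 'C^n) (f : 'C^n -> 'C^n) :=
  [/\ holomorphic D f, forall z, D z -> D (f z) &
      exists g : 'C^n -> 'C^n,
        [/\ holomorphic D g, forall z, D z -> D (g z),
            forall z, D z -> g (f z) = z & forall z, D z -> f (g z) = z]].

End bergman.
Arguments unit_disc {R}.

(* Main.v *)
From HB Require Import structures.
Require Import Defs.
From mathcomp Require Import ring lra.
From mathcomp Require Import measurable_realfun.

Set Implicit Arguments.
Unset Strict Implicit.
Unset Printing Implicit Defensive.

Import Order.TTheory GRing.Theory Num.Theory.
Import numFieldNormedType.Exports numFieldTopology.Exports.

Local Open Scope classical_set_scope.
Local Open Scope ring_scope.
Local Open Scope complex_scope.

(* Polarizing K_j(z, z) to a function holomorphic in (z, \bar w), equality of the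
   metrics means that log K_2(f z, f w) - log K_1(z, w) has vanishing mixed
   derivative, so it splits into a function of z plus a function of w; with a base
   point a this gives s_0 = c K_1(., a) and r_0 = c' K_2(., f a).  This needs the
   kernels to exist, that is, bounded point evaluations, which follow from the mean
   value property over discs and induction on the dimension, using Tonelli.

   For the disc with weight 1, K_1(z, w) = A^-1 (1 - z \bar w)^-2 with A the area.
   Comparing |K(z,a)|^2 / (K(z,z) K(a,a)) for both kernels, and bounding the Gram
   determinant of K_2 by a multiple of |f z - f a|^2, gives
   |z - a| <= c |f z - f a| whenever f z is close to f a: f is injective with
   nowhere vanishing derivative and continuous inverse.  Its image is open by the
   Cauchy estimate; it is closed in the disc because, at a boundary point zeta of
   the image, K_1(z, z) -> oo would force K_2(zeta, .) = 0 on the image. *)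

(** * Holomorphic functions: Goursat, Cauchy, limits, identity theorem *)

(** The polarized kernel may have zeros, where it has no logarithm. So only its logarithmic
    derivative [lam] is used, near a point of the diagonal, where K(z, z) > 0. The relation found
    there is cross-multiplied into a polynomial identity between kernel values; this form makes
    sense at zeros too and spreads over the domain by the identity theorem, one variable at a time.

    The complex analysis rests on Goursat's theorem for triangles, and all its estimates depend on a
    function only through a bound, so they pass to limits. Integrals over discs are treated in
    Cartesian coordinates: if a function vanishes on the circle, its partial derivatives have
    integral zero by slicing, so neither polar coordinates nor the value of the area enter.

    The kernel function at w comes from minimizing the energy among functions with value 1 at w.
    Bounded point evaluations make a minimizing sequence pointwise Cauchy, and Fatou's lemma
    controls the energy of the limit, which replaces completeness of L^2. *)

Section real_norm.
Context (R : realType).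
Local Notation C := R[i].
Local Notation Re := (@complex.Re R).
Local Notation Im := (@complex.Im R).

(* [`|x|] is a nonnegative element of R[i]; [nrm x] is its value in R. *)
Definition nrm (V : normedModType C) (x : V) : R := Re `|x|.

Section normed.
Context (V : normedModType C).
Implicit Types x y : V.

Lemma nrmE x : `|x| = (nrm x)%:C.
Proof. by rewrite /nrm RRe_real// ger0_real. Qed.

Lemma nrm_ge0 x : 0 <= nrm x.
Proof. by have := normr_ge0 x; rewrite nrmE lecR. Qed.

Lemma nrmD x y : nrm (x + y) <= nrm x + nrm y.
Proof. by have := ler_normD x y; rewrite !nrmE -rmorphD/= lecR. Qed.

Lemma nrmN x : nrm (- x) = nrm x.
Proof. by rewrite /nrm normrN. Qed.

Lemma nrmBC x y : nrm (x - y) = nrm (y - x).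
Proof. by rewrite -nrmN opprB. Qed.

Lemma nrmB x y : nrm (x - y) <= nrm x + nrm y.
Proof. by rewrite -(nrmN y) nrmD. Qed.

Lemma nrm_tri x y z : nrm (x - y) <= nrm (x - z) + nrm (z - y).
Proof. by rewrite (le_trans _ (nrmD _ _))// addrA subrK. Qed.

Lemma nrm0 : nrm (0 : V) = 0.
Proof. by rewrite /nrm normr0. Qed.

Lemma nrm_eq0 x : (nrm x == 0) = (x == 0).
Proof. by rewrite -[x == 0]normr_eq0 nrmE -(inj_eq (@complexI R)). Qed.

Lemma nrm_gt0 x : (0 < nrm x) = (x != 0).
Proof. by rewrite lt0r nrm_eq0 nrm_ge0 andbT. Qed.

Lemma nrm_le0 x : (nrm x <= 0) = (x == 0).
Proof. by rewrite le_eqVlt nrm_eq0 ltNge nrm_ge0 orbF. Qed.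

Lemma nrm_sub_ge x y : nrm x - nrm y <= nrm (x - y).
Proof. by rewrite lerBlDr (le_trans _ (nrmD _ _))// subrK. Qed.

(** Radii of balls live in R[i], but [0 < e] there forces the imaginary part to vanish, so real
    radii suffice. *)
Lemma nbhs_nrm x (P : set V) :
  nbhs x P <-> exists2 e : R, 0 < e & forall y, nrm (y - x) < e -> P y.
Proof.
split.
  move=> /nbhs_ballP[e /= e0]; rewrite -ball_normE => eP.
  exists (Re e); first by move: e0; rewrite ltcE => /andP[].
  move=> y yx; apply: eP => /=; rewrite -normrN opprB nrmE.
  by move: e0 yx; rewrite !ltcE /= => /andP[/eqP -> _]; rewrite eqxx.
move=> [e e0 eP]; apply/nbhs_ballP; exists e%:C; first by rewrite /= ltcR.
move=> y; rewrite -ball_normE/= -normrN opprB nrmE ltcR; exact: eP.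
Qed.

Lemma open_nrm (D : set V) x : open D -> D x ->
  exists2 e : R, 0 < e & forall y, nrm (y - x) < e -> D y.
Proof. by move=> oD Dx; apply/nbhs_nrm; exact: open_nbhs_nbhs. Qed.

Lemma open_ball_nrm x (e : R) : open [set y : V | nrm (y - x) < e].
Proof.
rewrite openE => y /= yx; apply/nbhs_nrm; exists (e - nrm (y - x)).
  by rewrite subr_gt0.
move=> z zy /=; rewrite (le_lt_trans (nrm_tri _ _ y))//.
by rewrite -ltrBrDr.
Qed.

End normed.

Lemma nrmZ (V : normedModType C) (a : C) (x : V) : nrm (a *: x) = nrm a * nrm x.
Proof.
by apply/complexI; rewrite rmorphM/= -!nrmE normrZ.
Qed.

Lemma nrmM (a b : C) : nrm (a * b) = nrm a * nrm b.
Proof. by apply/complexI; rewrite rmorphM/= -!nrmE normrM. Qed.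

Lemma nrm1 : nrm (1 : C) = 1.
Proof. by rewrite /nrm normr1. Qed.

Lemma nrmV (a : C) : nrm a^-1 = (nrm a)^-1.
Proof.
by apply/complexI; rewrite -nrmE normfV nrmE -fmorphV.
Qed.

Lemma nrmX (a : C) n : nrm (a ^+ n) = nrm a ^+ n.
Proof. by elim: n => [|n IH]; rewrite ?expr0 ?nrm1// !exprS nrmM IH. Qed.

Lemma nrm_real (x : R) : nrm (x%:C) = `|x|.
Proof. by rewrite /nrm normc_def/= expr0n addr0 sqrtr_sqr. Qed.

Lemma nrm_nat n : nrm (n%:R : C) = n%:R.
Proof. by rewrite -(rmorph_nat (real_complex R)) nrm_real normr_nat. Qed.

Lemma nrm_def (a : C) : nrm a = Num.sqrt (Re a ^+ 2 + Im a ^+ 2).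
Proof. by rewrite /nrm normc_def. Qed.

Lemma nrm_sqr (a : C) : nrm a ^+ 2 = Re a ^+ 2 + Im a ^+ 2.
Proof. by rewrite nrm_def sqr_sqrtr// addr_ge0// sqr_ge0. Qed.

Lemma nrm_conj (a : C) : nrm (conjc a) = nrm a.
Proof. by rewrite !nrm_def; case: a => a b/=; rewrite sqrrN. Qed.

Lemma Re_le_nrm (a : C) : `|Re a| <= nrm a.
Proof. by rewrite nrm_def -sqrtr_sqr ler_wsqrtr// lerDl sqr_ge0. Qed.

Lemma Im_le_nrm (a : C) : `|Im a| <= nrm a.
Proof. by rewrite nrm_def -sqrtr_sqr ler_wsqrtr// lerDr sqr_ge0. Qed.

Lemma nrm_i : nrm ('i : C) = 1.
Proof. by rewrite nrm_def/= expr0n/= add0r expr1n sqrtr1. Qed.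

Lemma nrm_le_ReIm (a : C) : nrm a <= `|Re a| + `|Im a|.
Proof.
rewrite {1}[a]complexE (le_trans (nrmD _ _))// nrmM nrm_i mul1r.
by rewrite !nrm_real.
Qed.

Lemma nrm_pair (V W : normedModType C) (x : V) (y : W) :
  nrm ((x, y) : V * W) = Num.max (nrm x) (nrm y).
Proof.
apply/complexI; rewrite -nrmE prod_normE/= !nrmE.
rewrite ![Num.max _ _]/Order.max ltcR; by case: (nrm x < nrm y).
Qed.

Lemma nrm_pair_lt (V W : normedModType C) (x : V) (y : W) (e : R) :
  (nrm ((x, y) : V * W) < e) = (nrm x < e) && (nrm y < e).
Proof. by rewrite nrm_pair gt_max. Qed.

Section Dif.
Context (V W : normedModType C).

(** Fréchet differentiability in epsilon-delta form with real constants; the bound on [L] stands for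
    its continuity. *)
Definition Dif (f : V -> W) (x : V) (L : V -> W) :=
  [/\ linear L, (exists2 c : R, 0 <= c & forall u, nrm (L u) <= c * nrm u) &
    forall e : R, 0 < e -> exists2 d : R, 0 < d &
      forall u, nrm u < d -> nrm (f (x + u) - f x - L u) <= e * nrm u].

Lemma Dif_diff f x L : Dif f x L -> differentiable f x /\ 'd f x = L :> (V -> W).
Proof.
move=> [linL [c c0 cL] eL].
pose lL : {linear V -> W} := HB.pack L (GRing.isLinear.Build _ _ _ _ L linL).
have Lcont : continuous lL.
  move=> y; apply/cvgrPdist_le => e e0; apply/nbhs_nrm.
  move: e0; rewrite ltcE /= => /andP[/eqP ime e0].
  exists (Re e / (c + 1)); first by rewrite divr_gt0// ltr_wpDl.
  move=> z zy /=; rewrite -[L y - L z]/(lL y - lL z) -linearB nrmE lecE/= ime eqxx/=.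
  rewrite (le_trans (cL _))// nrmBC.
  move: zy; rewrite ltr_pdivlMr ?ltr_wpDl// => /ltW; apply: le_trans.
  by rewrite mulrC ler_wpM2l ?nrm_ge0// lerDl.
have fL : f \o shift x = cst (f x) + lL +o_ 0 id.
  apply/eqaddoP => e; rewrite ltcE /= => /andP[/eqP ime e0]; apply/nbhs_nrm.
  have [d d0 dL] := eL _ e0; exists d => // u; rewrite subr0 => ud.
  rewrite /= !nrmE.
  have -> : e = (Re e)%:C by apply/eqP; rewrite eq_complex/= ime !eqxx.
  rewrite -rmorphM lecR.
  rewrite (_ : (_ : V -> W) u = f (x + u) - f x - L u); first exact: dL.
  by rewrite -[LHS]/(f (u + x) - (f x + L u)) opprD addrA [u + x]addrC.
have := @diff_unique _ V W f lL x Lcont fL => dE; split => //.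
by apply/diff_locallyP; rewrite dE.
Qed.

Lemma diff_Dif f x : differentiable f x -> Dif f x ('d f x).
Proof.
move=> df; have dc := diff_continuous df.
split; first exact: linearP.
- have := dc 0; rewrite /continuous_at linear0 => /cvgrPdist_lt /(_ 1 ltr01) /nbhs_nrm[e e0 eP].
  (* Continuity at 0 gives |L v| < 1 for |v| < e; rescaling [u] to norm e / 2 yields this
     constant. *)
  exists (2 / e); first by rewrite divr_ge0// ltW.
  move=> u; have [->|u0] := eqVneq u 0; first by rewrite linear0 !nrm0 mulr0.
  have nu : 0 < nrm u by rewrite nrm_gt0.
  have := eP ((e / (2 * nrm u))%:C *: u).
  rewrite subr0 nrmZ nrm_real ger0_norm ?divr_ge0 ?mulr_ge0 ?nrm_ge0 ?(ltW e0)//.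
  have -> : e / (2 * nrm u) * nrm u = e / 2 by field; rewrite gt_eqF.
  move=> /(_ _)/wrap[]; first lra.
  rewrite /= sub0r normrN nrmE (_ : 1 = 1%:C)// ltcR linearZ/= nrmZ.
  rewrite nrm_real ger0_norm ?divr_ge0 ?mulr_ge0 ?nrm_ge0 ?(ltW e0)// => H.
  have : e * nrm ('d f x u) < 2 * nrm u.
    by rewrite -[ltRHS]mul1r -ltr_pdivrMr ?mulr_gt0// mulrAC.
  by rewrite mulrAC ler_pdivlMr// mulrC => /ltW.
- move=> e e0; have /eqaddoP := diff_locally df.
  move=> /(_ e%:C); rewrite ltcR => /(_ e0) /nbhs_nrm[d d0 dP].
  exists d => // u ud; have := dP u; rewrite subr0 => /(_ ud).
  rewrite !nrmE -rmorphM lecR.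
  rewrite (_ : (_ : V -> W) u = f (x + u) - f x - 'd f x u)//.
  by rewrite -[LHS]/(f (u + x) - (f x + 'd f x u)) opprD addrA [u + x]addrC.
Qed.

Lemma Dif_continuous f x L : Dif f x L -> forall e : R, 0 < e ->
  exists2 d : R, 0 < d & forall y, nrm (y - x) < d -> nrm (f y - f x) < e.
Proof.
move=> /Dif_diff[/differentiable_continuous + _].
move=> /cvgrPdist_lt fc e e0; have := fc e%:C; rewrite ltcR => /(_ e0)/nbhs_nrm[d d0 dP].
by exists d => // y /dP; rewrite /= nrmE ltcR nrmBC.
Qed.

End Dif.
End real_norm.

(** * Continuity and differentiation along real parameters *)

Section path.
Context (R : realType).
Local Notation C := R[i].
Local Notation Re := (@complex.Re R).
Local Notation Im := (@complex.Im R).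

Lemma nbhs_realP (x : R) (P : set R) :
  nbhs x P <-> exists2 e : R, 0 < e & forall y, `|y - x| < e -> P y.
Proof.
split.
  move=> /nbhs_ballP[e /= e0]; rewrite -ball_normE => eP; exists e => //.
  by move=> y yx; apply: eP => /=; rewrite distrC.
move=> [e e0 eP]; apply/nbhs_ballP; exists e => //.
by move=> y; rewrite -ball_normE/= distrC => /eP.
Qed.

Lemma cont_nrmP (T : topologicalType) (V : normedModType C) (f : T -> V) (x : T) :
  {for x, continuous f} <->
  forall e : R, 0 < e -> \forall y \near x, nrm (f y - f x) < e.
Proof.
split=> [/cvgrPdist_lt fc e e0|fc].
  by have := fc e%:C; rewrite ltcR => /(_ e0); apply: filterS => y;
    rewrite nrmE ltcR nrmBC.
apply/cvgrPdist_lt => e; rewrite ltcE /= => /andP[/eqP ime e0].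
have := fc _ e0; apply: filterS => y.
by rewrite nrmE ltcE/= ime eqxx/= nrmBC.
Qed.

Lemma cont_rnrmP (T : topologicalType) (f : T -> R) (x : T) :
  {for x, continuous f} <->
  forall e : R, 0 < e -> \forall y \near x, `|f y - f x| < e.
Proof.
split=> [/cvgrPdist_lt fc e e0|fc].
  by apply: filterS (fc e e0) => y; rewrite distrC.
by apply/cvgrPdist_lt => e e0; apply: filterS (fc e e0) => y; rewrite distrC.
Qed.

Lemma cont_Re (T : topologicalType) (f : T -> C) x :
  {for x, continuous f} -> {for x, continuous (Re \o f)}.
Proof.
move=> /cont_nrmP fc; apply/cont_rnrmP => e e0; apply: filterS (fc e e0) => y.
by apply: le_lt_trans; rewrite /= -raddfB Re_le_nrm.
Qed.

Lemma cont_Im (T : topologicalType) (f : T -> C) x :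
  {for x, continuous f} -> {for x, continuous (Im \o f)}.
Proof.
move=> /cont_nrmP fc; apply/cont_rnrmP => e e0; apply: filterS (fc e e0) => y.
by apply: le_lt_trans; rewrite /= -raddfB Im_le_nrm.
Qed.

Lemma cont_ReIm (T : topologicalType) (f g : T -> R) x :
  {for x, continuous f} -> {for x, continuous g} ->
  {for x, continuous (fun y => f y +i* g y)}.
Proof.
move=> /cont_rnrmP fc /cont_rnrmP gc; apply/cont_nrmP => e e0.
have e2 : 0 < e / 2 by rewrite divr_gt0.
near=> y; rewrite (le_lt_trans (nrm_le_ReIm _))//= [ltRHS]splitr.
by rewrite ltrD//; near: y; [exact: fc|exact: gc].
Unshelve. all: by end_near. Qed.

Lemma cont_nrm (T : topologicalType) (V : normedModType C) (h : T -> V) (x : T) :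
  {for x, continuous h} -> {for x, continuous (fun y => nrm (h y))}.
Proof.
move=> hc; apply/cont_rnrmP => e e0; have := (cont_nrmP _ _).1 hc e e0; apply: filterS => y.
by apply: le_lt_trans; rewrite ler_norml nrm_sub_ge andbT lerNl opprB nrmBC nrm_sub_ge.
Qed.

Lemma contM (T : topologicalType) (f g : T -> C) x :
  {for x, continuous f} -> {for x, continuous g} ->
  {for x, continuous (fun y => f y * g y)}.
Proof. by move=> fc gc; exact: (@cvgM _ _ _ _ f g _ _ fc gc). Qed.

Lemma cont_cst (T U : topologicalType) (c : U) (x : T) :
  {for x, continuous (fun=> c)}.
Proof. exact: cvg_cst. Qed.

Lemma contD (T : topologicalType) (f g : T -> C) x :
  {for x, continuous f} -> {for x, continuous g} ->
  {for x, continuous (fun y => f y + g y)}.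
Proof. by move=> fc gc; exact: (@cvgD _ _ _ _ _ f g _ _ fc gc). Qed.

Lemma contB (T : topologicalType) (f g : T -> C) x :
  {for x, continuous f} -> {for x, continuous g} ->
  {for x, continuous (fun y => f y - g y)}.
Proof. by move=> fc gc; exact: (@cvgB _ _ _ _ _ f g _ _ fc gc). Qed.

Lemma contV (T : topologicalType) (f : T -> C) x : f x != 0 ->
  {for x, continuous f} -> {for x, continuous (fun y => (f y)^-1)}.
Proof. by move=> fx0 fc; exact: (@cvgV _ _ _ _ f _ fx0 fc). Qed.

(** The parameter is real while [V] is normed over R[i], so the derivative of a path is spelled out
    with the scalar embedded in R[i]. *)
Definition pder (V : normedModType C) (F : R -> V) (t : R) (d : V) :=
  forall e : R, 0 < e -> exists2 r : R, 0 < r &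
    forall s, `|s| < r -> nrm (F (t + s) - F t - s%:C *: d) <= e * `|s|.

Lemma is_deriveP (f : R -> R) (t d : R) :
  is_derive t 1 f d <->
  (forall e : R, 0 < e -> exists2 r : R, 0 < r &
    forall s, `|s| < r -> `|f (t + s) - f t - s * d| <= e * `|s|).
Proof.
split=> [[df <-] e e0|fd].
  move: df => /derivable1_diffP dt.
  have /eqaddoP/(_ _ e0) := diff_locally dt.
  move=> /nbhs_realP[r r0 rP]; exists r => // s sr.
  have := rP s; rewrite subr0 => /(_ sr).
  have -> : (f \o shift t - (cst (f t) + 'd f t)) s = f (t + s) - f t - 'd f t s.
    by rewrite -[LHS]/(f (s + t) - (f t + 'd f t s)) opprD addrA [s + t]addrC.
  suff -> : 'd f t s = s * 'D_1 f t by [].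
  by rewrite deriveE// -[s in LHS]mulr1 -[s * 1]/(s *: 1) linearZ.
have H : h^-1 *: (f (h *: 1 + t) - f t) @[h --> 0^'] --> d.
  apply/cvgrPdist_le => e e0.
  have [r r0 rP] := fd e e0; apply/nbhs_realP; exists r => // s; rewrite subr0 => sr s0.
  have := rP s sr.
  have -> : f (t + s) - f t - s * d = - s * (d - s^-1 *: (f (s *: 1 + t) - f t)).
    rewrite /GRing.scale/= mulr1 [s + t]addrC mulrBr mulNr mulNr opprK mulrA divff// mul1r.
    by rewrite [RHS]addrC.
  by rewrite normrM normrN mulrC ler_pM2r// normr_gt0.
split; first by apply/cvg_ex; exists d.
exact/cvg_lim.
Qed.

Lemma pder_Re (F : R -> C) t d : pder F t d -> is_derive t 1 (Re \o F) (Re d).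
Proof.
move=> Fd; apply/is_deriveP => e e0; have [r r0 rP] := Fd e e0.
exists r => // s /rP; apply: le_trans => /=.
have -> : s * Re d = Re (s%:C *: d) by case: d {Fd rP} => a b /=; rewrite mul0r subr0.
by rewrite -!raddfB Re_le_nrm.
Qed.

Lemma pder_Im (F : R -> C) t d : pder F t d -> is_derive t 1 (Im \o F) (Im d).
Proof.
move=> Fd; apply/is_deriveP => e e0; have [r r0 rP] := Fd e e0.
exists r => // s /rP; apply: le_trans => /=.
have -> : s * Im d = Im (s%:C *: d) by case: d {Fd rP} => a b /=; rewrite mul0r addr0.
by rewrite -!raddfB Im_le_nrm.
Qed.

Lemma pder_ReIm (f g : R -> R) (t a b : R) : is_derive t 1 f a -> is_derive t 1 g b ->
  pder (fun s => f s +i* g s) t (a +i* b).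
Proof.
move=> /is_deriveP fa /is_deriveP gb e e0.
have e2 : 0 < e / 2 by rewrite divr_gt0.
have [r1 r10 r1P] := fa _ e2; have [r2 r20 r2P] := gb _ e2.
exists (Num.min r1 r2); first by rewrite lt_min r10.
move=> s; rewrite lt_min => /andP[/r1P H1 /r2P H2].
rewrite (le_trans (nrm_le_ReIm _))//= mul0r mul0r subr0 addr0.
by rewrite [e]splitr mulrDl lerD.
Qed.

Lemma pder_diff (V W : normedModType C) (F : V -> W) (g : R -> V) t d :
  differentiable F (g t) -> pder g t d -> pder (F \o g) t ('d F (g t) d).
Proof.
move=> /diff_Dif[lin [c c0 cP] FP] gd e e0.
set L := 'd F (g t) in lin cP FP *.
(* The error of [F] is at most e2 (|d| + 1) |s| and that of [g] contributes c e2 |s|; this choice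
   brings the sum below e |s| / 2. The minimum with 1 bounds |u| by (|d| + 1) |s|. *)
pose e2 := Num.min 1 (e / (2 * (c + nrm d + 1))).
have K0 : 0 < 2 * (c + nrm d + 1).
  by rewrite mulr_gt0// ltr_wpDl// addr_ge0// nrm_ge0.
have e20 : 0 < e2 by rewrite lt_min ltr01 divr_gt0.
have [r1 r10 r1P] := FP _ e20; have [r2 r20 r2P] := gd _ e20.
have N0 : 0 < nrm d + 1 by rewrite ltr_wpDl ?nrm_ge0.
exists (Num.min r2 (r1 / (nrm d + 1))).
  by rewrite lt_min r20 divr_gt0.
move=> s; rewrite lt_min => /andP[/r2P H2].
rewrite ltr_pdivlMr// => sr1.
set u := g (t + s) - g t.
have ud : nrm u <= `|s| * (nrm d + 1).
  have := nrm_sub_ge u (s%:C *: d); rewrite lerBlDr => /le_trans; apply.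
  rewrite nrmZ nrm_real addrC mulrDr lerD2l (le_trans H2)// mulrC ler_wpM2l//.
  by rewrite ge_min lexx.
have := r1P u (le_lt_trans ud sr1).
rewrite /u [g t + _]addrC subrK -/u => H1.
have -> : (F \o g) (t + s) - (F \o g) t - s%:C *: L d =
  (F (g (t + s)) - F (g t) - L u) + L (u - s%:C *: d).
  have -> : L (u - s%:C *: d) = L u - s%:C *: L d by rewrite linearB linearZ.
  by rewrite addrA subrK.
rewrite (le_trans (nrmD _ _))//.
have B1 : nrm (L (u - s%:C *: d)) <= c * (e2 * `|s|).
  by rewrite (le_trans (cP _))// ler_wpM2l.
have B2 : e2 * nrm u <= e2 * (`|s| * (nrm d + 1)) by rewrite ler_wpM2l// ltW.
have B3 : e2 * (2 * (c + nrm d + 1)) <= e.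
  by rewrite -ler_pdivlMr// ge_min lexx orbT.
have B4 : 0 <= e2 * (c + nrm d + 1).
  by rewrite mulr_ge0 ?(ltW e20)//; nra.
rewrite (le_trans (lerD H1 B1))// (le_trans (lerD B2 (lexx _)))//.
have -> : e2 * (`|s| * (nrm d + 1)) + c * (e2 * `|s|) = (e2 * (c + nrm d + 1)) * `|s|.
  by ring.
rewrite ler_wpM2r//; lra.
Qed.

Lemma pder_affine (V : normedModType C) (a u : V) t :
  pder (fun s : R => a + s%:C *: u) t u.
Proof.
move=> e e0; exists 1 => // s _.
rewrite rmorphD/= scalerDl addrA [_ + s%:C *: u]addrC addrK.
by rewrite subrr nrm0 mulr_ge0// ltW.
Qed.

Lemma pder_cont (V : normedModType C) (F : R -> V) t d :
  pder F t d -> {for t, continuous F}.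
Proof.
move=> Fd; apply/cont_nrmP => e e0; have [r r0 rP] := Fd 1 ltr01.
have N0 : 0 < nrm d + 1 by rewrite ltr_wpDl ?nrm_ge0.
apply/nbhs_realP; exists (Num.min r (e / (nrm d + 1))).
  by rewrite lt_min r0 divr_gt0.
move=> y; rewrite lt_min => /andP[/rP H]; rewrite ltr_pdivlMr//.
apply: le_lt_trans; move: H; rewrite [t + _]addrC subrK mul1r => H.
have := nrm_sub_ge (F y - F t) ((y - t)%:C *: d); rewrite lerBlDr => /le_trans; apply.
by rewrite nrmZ nrm_real addrC mulrDr lerD2l mulr1.
Qed.

Lemma pderD (V : normedModType C) (F G : R -> V) t a b :
  pder F t a -> pder G t b -> pder (fun s => F s + G s) t (a + b).
Proof.
move=> Fa Gb e e0; have e2 : 0 < e / 2 by rewrite divr_gt0.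
have [r1 r10 r1P] := Fa _ e2; have [r2 r20 r2P] := Gb _ e2.
exists (Num.min r1 r2); first by rewrite lt_min r10.
move=> s; rewrite lt_min => /andP[/r1P H1 /r2P H2].
have -> : F (t + s) + G (t + s) - (F t + G t) - s%:C *: (a + b) =
  (F (t + s) - F t - s%:C *: a) + (G (t + s) - G t - s%:C *: b).
  by rewrite scalerDr !opprD (addrACA (F _)) (addrACA (F _ - _)).
by rewrite (le_trans (nrmD _ _))// [e]splitr mulrDl lerD.
Qed.

Lemma pder_reparam (V : normedModType C) (F : R -> V) (c k t : R) d :
  pder F (c + t * k) d -> pder (fun s => F (c + s * k)) t (k%:C *: d).
Proof.
move=> Fd e e0; have K0 : 0 < `|k| + 1 by rewrite ltr_wpDl.
have e2 : 0 < e / (`|k| + 1) by rewrite divr_gt0.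
have [r r0 rP] := Fd _ e2.
exists (r / (`|k| + 1)); first by rewrite divr_gt0.
move=> s; rewrite ltr_pdivlMr// => sr.
have := rP (s * k); rewrite normrM => /(_ _)/wrap[].
  by apply: le_lt_trans sr; rewrite ler_wpM2l// lerDl.
rewrite mulrDl addrA scalerA -rmorphM => /le_trans; apply.
by rewrite mulrAC ler_pdivrMr// mulrA ler_wpM2l ?lerDl// mulr_ge0// ltW.
Qed.

(** The mean value theorem fails for complex values, so it is applied to real and imaginary
    parts. *)
Lemma pder0_cst (F : R -> C) a b : a <= b ->
  (forall t, a <= t <= b -> pder F t 0) -> F b = F a.
Proof.
move=> ab F0.
have H (f : R -> R) : (forall t, a <= t <= b -> is_derive t 1 f 0) -> f b = f a.
  move=> f0; have [||z _] := @MVT_segment R f (fun=> 0) a b ab.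
  - by move=> x; rewrite in_itv/= => /andP[xa xb]; apply: f0; rewrite !ltW.
  - apply: derivable_within_continuous => x; rewrite in_itv/= => /f0 [] //.
  by rewrite mul0r => /subr0_eq.
apply/eqP; rewrite eq_complex; apply/andP; split; apply/eqP.
  by apply: (H (Re \o F)) => t /F0/pder_Re.
by apply: (H (Im \o F)) => t /F0/pder_Im.
Qed.

End path.

(** * Integrals of complex functions over an interval *)

Section Cint.
Context (R : realType).
Local Notation C := R[i].
Local Notation Re := (@complex.Re R).
Local Notation Im := (@complex.Im R).
Local Notation mu := (@lebesgue_measure R).

Definition Cint (a b : R) (f : R -> C) : C :=
  (\int[mu]_(t in `[a, b]) Re (f t)) +i* (\int[mu]_(t in `[a, b]) Im (f t)).

(** Continuity is two-sided at each point of [A], endpoints included; this is stronger than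
    continuity within [A]. *)
Definition cont_on (T U : topologicalType) (A : set T) (f : T -> U) :=
  forall t, A t -> {for t, continuous f}.

Lemma cont_on_within (T U : topologicalType) (A : set T) (f : T -> U) :
  cont_on A f -> {within A, continuous f}.
Proof. by move=> fA; apply: continuous_in_subspaceT => x /set_mem /fA. Qed.

Lemma cont_integrable (a b : R) (f : R -> R) : cont_on `[a, b] f ->
  mu.-integrable `[a, b] (EFin \o f).
Proof.
by move=> fc; apply: continuous_compact_integrable;
  [exact: segment_compact|exact: cont_on_within].
Qed.

Lemma Rint_FTC (a b : R) (f F : R -> R) : a < b -> cont_on `[a, b] f ->
  (forall t, a <= t <= b -> is_derive t 1 F (f t)) ->
  \int[mu]_(t in `[a, b]) f t = F b - F a.
Proof.
move=> ab fc dF.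
have Fc t : a <= t <= b -> F x @[x --> t] --> F t.
  move=> /dF[d _]; exact/differentiable_continuous/derivable1_diffP.
rewrite /Rintegral (@continuous_FTC2 R f F a b)//.
- exact: cont_on_within.
- split.
  + by move=> x; rewrite in_itv/= => /andP[ax xb]; have [] := dF x; rewrite ?ltW.
  + by apply: cvg_at_right_filter; apply: Fc; rewrite lexx ltW.
  + by apply: cvg_at_left_filter; apply: Fc; rewrite lexx ltW.
- move=> x; rewrite in_itv/= => /andP[ax xb].
  have [|_ <-] := dF x; first by rewrite !ltW.
  by rewrite derive1E.
Qed.

Variables (a b : R).
Hypothesis ab : a < b.

Lemma Cint_FTC (f F : R -> C) : cont_on `[a, b] f ->
  (forall t, a <= t <= b -> pder F t (f t)) -> Cint a b f = F b - F a.
Proof.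
move=> fc dF; rewrite /Cint.
have -> : \int[mu]_(t in `[a, b]) Re (f t) = Re (F b) - Re (F a).
  apply: (@Rint_FTC a b (Re \o f) (Re \o F)) => // [t /fc|t /dF/pder_Re//].
  exact: cont_Re.
have -> : \int[mu]_(t in `[a, b]) Im (f t) = Im (F b) - Im (F a).
  apply: (@Rint_FTC a b (Im \o f) (Im \o F)) => // [t /fc|t /dF/pder_Im//].
  exact: cont_Im.
by case: (F b) => ? ?; case: (F a).
Qed.

Lemma CintD (f g : R -> C) : cont_on `[a, b] f -> cont_on `[a, b] g ->
  Cint a b (fun t => f t + g t) = Cint a b f + Cint a b g.
Proof.
move=> fc gc.
have Ifr := cont_integrable (fun t h => cont_Re (fc t h)).
have Ifi := cont_integrable (fun t h => cont_Im (fc t h)).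
have Igr := cont_integrable (fun t h => cont_Re (gc t h)).
have Igi := cont_integrable (fun t h => cont_Im (gc t h)).
apply/eqP; rewrite eq_complex; apply/andP; split; apply/eqP => /=.
- rewrite -RintegralD//=; apply: eq_Rintegral => x _; exact: raddfD.
- rewrite -RintegralD//=; apply: eq_Rintegral => x _; exact: raddfD.
Qed.

Lemma CintZ (c : C) (f : R -> C) : cont_on `[a, b] f ->
  Cint a b (fun t => c * f t) = c * Cint a b f.
Proof.
move=> fc.
have If := cont_integrable (fun t h => cont_Re (fc t h)).
have Ig := cont_integrable (fun t h => cont_Im (fc t h)).
have Ir (r : R) (g : R -> R) : cont_on `[a, b] g ->
    mu.-integrable `[a, b] (EFin \o (fun t => r * g t)).
  by move=> gc; apply: cont_integrable => t /gc; apply: cvgM; exact: cvg_cst.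
apply/eqP; rewrite eq_complex; apply/andP; split; apply/eqP => /=.
- have -> : \int[mu]_(t in `[a, b]) Re (c * f t) =
      \int[mu]_(t in `[a, b]) (Re c * Re (f t) - Im c * Im (f t)).
    by apply: eq_Rintegral => t _; case: c => ? ?; case: (f t).
  rewrite RintegralB//=; last 2 first.
    by apply: Ir => t /fc; exact: cont_Re.
    by apply: Ir => t /fc; exact: cont_Im.
  by rewrite !RintegralZl//; case: c.
- have -> : \int[mu]_(t in `[a, b]) Im (c * f t) =
      \int[mu]_(t in `[a, b]) (Re c * Im (f t) + Im c * Re (f t)).
    by apply: eq_Rintegral => t _; case: c => ? ?; case: (f t).
  rewrite RintegralD//=; last 2 first.
    by apply: Ir => t /fc; exact: cont_Im.
    by apply: Ir => t /fc; exact: cont_Re.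
  by rewrite !RintegralZl//; case: c.
Qed.

Lemma CintB (f g : R -> C) : cont_on `[a, b] f -> cont_on `[a, b] g ->
  Cint a b (fun t => f t - g t) = Cint a b f - Cint a b g.
Proof.
move=> fc gc.
have -> : (fun t => f t - g t) = (fun t => f t + -1 * g t).
  by apply/funext => t; rewrite mulN1r.
have Ngc : cont_on `[a, b] (fun t => -1 * g t).
  by move=> t /gc; apply: contM; exact: cont_cst.
by rewrite (CintD fc Ngc) (CintZ _ gc) mulN1r.
Qed.

Lemma eq_Cint (f g : R -> C) : (forall t, a <= t <= b -> f t = g t) ->
  Cint a b f = Cint a b g.
Proof.
move=> fg; congr (_ +i* _); apply: eq_Rintegral => t; rewrite inE/= in_itv/= => /fg -> //.
Qed.

Lemma Rint_bound (f : R -> R) (M : R) : cont_on `[a, b] f ->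
  (forall t, a <= t <= b -> `|f t| <= M) ->
  `|\int[mu]_(t in `[a, b]) f t| <= (b - a) * M.
Proof.
move=> fc fM.
have If : mu.-integrable `[a, b] (EFin \o f) by exact: cont_integrable.
rewrite (le_trans (le_normr_Rintegral _ If))//.
have -> : (b - a) * M = \int[mu]_(t in `[a, b]) M.
  by rewrite Rintegral_cst//= lebesgue_measure_itv/= lte_fin ab mulrC.
apply: le_Rintegral => //.
- exact: (integrable_abse If).
- by apply: cont_integrable => t _; exact: cvg_cst.
Qed.

(** The factor 2 comes from bounding real and imaginary parts separately; later estimates only need
    some constant. *)
Lemma Cint_bound (f : R -> C) (M : R) : cont_on `[a, b] f ->
  (forall t, a <= t <= b -> nrm (f t) <= M) ->
  nrm (Cint a b f) <= 2 * (b - a) * M.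
Proof.
move=> fc fM; rewrite (le_trans (nrm_le_ReIm _))//= -mulrA mulr_natl mulr2n lerD//.
- apply: Rint_bound; first by move=> t /fc; exact: cont_Re.
  by move=> t /fM; apply: le_trans; exact: Re_le_nrm.
- apply: Rint_bound; first by move=> t /fc; exact: cont_Im.
  by move=> t /fM; apply: le_trans; exact: Im_le_nrm.
Qed.

(* The antiderivative is two-sided at the endpoints because [f] is first
   extended by constants outside [a, b]. *)
Lemma cont_prim (f : R -> C) : cont_on `[a, b] f ->
  exists F, forall t, a <= t <= b -> pder F t (f t).
Proof.
move=> fc; pose cl (t : R) := Num.max a (Num.min t b).
have clE t : a <= t <= b -> cl t = t.
  by move=> /andP[at_ tb]; rewrite /cl min_l// max_r.
have cl_in t : a <= cl t <= b.
  by rewrite /cl le_max lexx/= ge_max ltW//= ge_min lexx orbT.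
have clc : continuous cl.
  move=> t; apply: (@continuous_max R R (fun=> a) (fun s => Num.min s b) t).
    exact: cvg_cst.
  by apply: (@continuous_min R R id (fun=> b) t); [exact: cvg_id|exact: cvg_cst].
have H (g : R -> R) : cont_on `[a, b] g ->
    exists G, forall t, a <= t <= b -> is_derive t 1 G (g t).
  move=> gc; pose h := g \o cl.
  have hc : continuous h.
    move=> t; apply: continuous_comp; first exact: clc.
    by apply: gc; rewrite /= in_itv/=.
  exists (fun x => \int[mu]_(t in `[a - 1, x]) h t) => t tab.
  have [||||d1 d2] := @continuous_FTC1_closed R h (a - 1) t (b + 1).
  - by move/andP : tab => [_ tb]; lra.
  - by apply: cont_integrable => ? _; exact: hc.
  - by move/andP : tab => [ta _]; lra.
  - exact: hc.
  - by split; [|rewrite -derive1E d2 /h/= clE].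
have [F1 F1P] := H _ (fun t h => cont_Re (fc t h)).
have [F2 F2P] := H _ (fun t h => cont_Im (fc t h)).
exists (fun t => F1 t +i* F2 t) => t tab.
have := pder_ReIm (F1P t tab) (F2P t tab).
by rewrite /=; case: (f t).
Qed.

End Cint.

(** * Segment integrals and Goursat's theorem *)

Section goursat.
Context (R : realType).
Local Notation C := R[i].
Local Notation Re := (@complex.Re R).
Local Notation Im := (@complex.Im R).

Definition lin (p q : C) (t : R) : C := p + t%:C * (q - p).

Definition seg (g : C -> C) (p q : C) : C :=
  (q - p) * Cint 0 1 (fun t => g (lin p q t)).

Definition cvx (K : set C) :=
  forall p q t, K p -> K q -> 0 <= t <= 1 -> K (lin p q t).

Lemma lin0 p q : lin p q 0 = p. Proof. by rewrite /lin mul0r addr0. Qed.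
Lemma lin1 p q : lin p q 1 = q. Proof. by rewrite /lin mul1r addrC subrK. Qed.

Lemma pder_lin p q t : pder (lin p q) t (q - p).
Proof. exact: pder_affine. Qed.

Lemma lin_cont p q t : {for t, continuous (lin p q)}.
Proof. exact: pder_cont (pder_lin p q t). Qed.

Lemma cont_lin (g : C -> C) p q :
  (forall t, 0 <= t <= 1 -> {for lin p q t, continuous g}) ->
  cont_on `[(0 : R), 1] (fun t => g (lin p q t)).
Proof.
move=> gc t; rewrite /= in_itv/= => /gc.
by apply: continuous_comp; exact: lin_cont.
Qed.

Lemma seg_FTC (G g : C -> C) p q :
  (forall t, 0 <= t <= 1 -> {for lin p q t, continuous g}) ->
  (forall t, 0 <= t <= 1 -> differentiable G (lin p q t) /\
     'd G (lin p q t) (q - p) = (q - p) * g (lin p q t)) ->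
  seg g p q = G q - G p.
Proof.
move=> gc dG; rewrite /seg -CintZ//; last exact: cont_lin.
rewrite (@Cint_FTC _ _ _ ltr01 _ (G \o lin p q)) ?[LHS]/=.
- by rewrite lin0 lin1.
- move=> t /(cont_lin gc) ; apply: contM; exact: cont_cst.
- move=> t t01; have [d1 <-] := dG t t01.
  by apply: pder_diff => //; exact: pder_lin.
Qed.

(** One antiderivative along the whole segment serves all its subsegments, so splitting and
    reversing a segment become additions. *)
Lemma seg_prim (g : C -> C) p q :
  (forall t, 0 <= t <= 1 -> {for lin p q t, continuous g}) ->
  exists F : R -> C, forall s1 s2, 0 <= s1 <= 1 -> 0 <= s2 <= 1 ->
    seg g (lin p q s1) (lin p q s2) = F s2 - F s1.
Proof.
move=> gc; have c1 : cont_on `[(0 : R), 1] (fun t => g (lin p q t)).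
  exact: cont_lin.
have [F FP] := cont_prim ltr01 c1.
exists (fun t => (q - p) * F t) => s1 s2 /andP[s10 s11] /andP[s20 s21].
have linE t : lin (lin p q s1) (lin p q s2) t = lin p q (s1 + t * (s2 - s1)).
  by rewrite /lin !(rmorphD, rmorphM, rmorphB)/=; ring.
have s_in t : 0 <= t <= 1 -> 0 <= s1 + t * (s2 - s1) <= 1.
  by move=> /andP[t0 t1]; apply/andP; split; nra.
have c2 : cont_on `[(0 : R), 1] (fun t => g (lin (lin p q s1) (lin p q s2) t)).
  by apply: cont_lin => t /s_in; rewrite linE => /gc.
rewrite /seg.
have -> : lin p q s2 - lin p q s1 = (q - p) * (s2 - s1)%:C.
  by rewrite /lin !rmorphB/=; ring.
rewrite -mulrA -CintZ//.
rewrite (@Cint_FTC _ _ _ ltr01 _ (fun t => F (s1 + t * (s2 - s1)))).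
- by rewrite mul0r mul1r addr0 [s1 + _]addrC subrK mulrBr.
- move=> t /c2 ; apply: contM; exact: cont_cst.
- by move=> t t01; rewrite linE; apply: pder_reparam; apply: FP; exact: s_in.
Qed.

Lemma seg_split (g : C -> C) p q s :
  (forall t, 0 <= t <= 1 -> {for lin p q t, continuous g}) -> 0 <= s <= 1 ->
  seg g p q = seg g p (lin p q s) + seg g (lin p q s) q.
Proof.
move=> /seg_prim[F FP] s01.
have i0 : 0 <= (0 : R) <= 1 by rewrite lexx ler01.
have i1 : 0 <= (1 : R) <= 1 by rewrite lexx ler01.
have := FP 0 1 i0 i1; have := FP 0 s i0 s01; have := FP s 1 s01 i1.
by rewrite lin0 lin1 => -> -> ->; ring.
Qed.

Lemma seg_rev (g : C -> C) p q :
  (forall t, 0 <= t <= 1 -> {for lin p q t, continuous g}) ->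
  seg g q p = - seg g p q.
Proof.
move=> /seg_prim[F FP].
have i0 : 0 <= (0 : R) <= 1 by rewrite lexx ler01.
have i1 : 0 <= (1 : R) <= 1 by rewrite lexx ler01.
have := FP 0 1 i0 i1; have := FP 1 0 i1 i0.
by rewrite lin0 lin1 => -> ->; ring.
Qed.

Lemma seg_bound (g : C -> C) p q M :
  (forall t, 0 <= t <= 1 -> {for lin p q t, continuous g}) ->
  (forall t, 0 <= t <= 1 -> nrm (g (lin p q t)) <= M) ->
  nrm (seg g p q) <= 2 * M * nrm (q - p).
Proof.
move=> gc gM; rewrite nrmM mulrC ler_wpM2r ?nrm_ge0//.
have := Cint_bound ltr01 (cont_lin gc) gM.
by rewrite subr0 mulr1.
Qed.

Lemma segB (g h : C -> C) p q :
  (forall t, 0 <= t <= 1 -> {for lin p q t, continuous g}) ->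
  (forall t, 0 <= t <= 1 -> {for lin p q t, continuous h}) ->
  seg (fun z => g z - h z) p q = seg g p q - seg h p q.
Proof. by move=> gc hc; rewrite /seg (CintB (cont_lin gc) (cont_lin hc)) mulrBr. Qed.

Lemma seg_point (g : C -> C) p : seg g p p = 0.
Proof. by rewrite /seg subrr mul0r. Qed.

(** The integral around the triangle with vertices a, a + u, a + v. Two sides are stored as vectors,
    so that subdivision halves [u] and [v]. *)
Definition tri (g : C -> C) (a u v : C) : C :=
  seg g a (a + u) + seg g (a + u) (a + v) + seg g (a + v) a.

Section on_convex.
Variables (K : set C) (g : C -> C).
Hypotheses (Kcvx : cvx K) (gc : forall z, K z -> {for z, continuous g}).

Lemma K_cont p q : K p -> K q ->
  forall t, 0 <= t <= 1 -> {for lin p q t, continuous g}.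
Proof. by move=> Kp Kq t t01; apply: gc; exact: Kcvx. Qed.

Lemma half01 : 0 <= (2^-1 : R) <= 1.
Proof. by apply/andP; split; lra. Qed.

Lemma half_real : (2^-1 : R)%:C = 2^-1 :> C.
Proof. by rewrite fmorphV rmorph_nat. Qed.

(** The middle triangle is a reflected copy of the three corner ones, hence its negative side
    vectors; its edges cancel against theirs. *)
Lemma tri_split a u v : K a -> K (a + u) -> K (a + v) ->
  [/\ K (a + u / 2), K (a + v / 2) & K (a + (u + v) / 2)] /\
  tri g a u v = tri g a (u / 2) (v / 2) + tri g (a + u / 2) (u / 2) (v / 2)
    + tri g (a + v / 2) (u / 2) (v / 2)
    + tri g (a + (u + v) / 2) (- (u / 2)) (- (v / 2)).
Proof.
move=> Ka Ku Kv.
have n2 : (2 : C) != 0 by rewrite pnatr_eq0.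
have mu : lin a (a + u) 2^-1 = a + u / 2 by rewrite /lin half_real; field.
have mv : lin (a + v) a 2^-1 = a + v / 2 by rewrite /lin half_real; field.
have muv : lin (a + u) (a + v) 2^-1 = a + (u + v) / 2 by rewrite /lin half_real; field.
have Kmu : K (a + u / 2) by rewrite -mu; exact: Kcvx half01.
have Kmv : K (a + v / 2) by rewrite -mv; exact: Kcvx half01.
have Kmuv : K (a + (u + v) / 2) by rewrite -muv; exact: Kcvx half01.
split => //.
rewrite /tri (seg_split (K_cont Ka Ku) half01) mu.
rewrite (seg_split (K_cont Ku Kv) half01) muv.
rewrite (seg_split (K_cont Kv Ka) half01) mv.
have -> : a + u / 2 + u / 2 = a + u by field.
have -> : a + u / 2 + v / 2 = a + (u + v) / 2 by field.
have -> : a + v / 2 + u / 2 = a + (u + v) / 2 by field.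
have -> : a + v / 2 + v / 2 = a + v by field.
have -> : a + (u + v) / 2 - u / 2 = a + v / 2 by field.
have -> : a + (u + v) / 2 - v / 2 = a + u / 2 by field.
rewrite (seg_rev (K_cont Kmu Kmv)) (seg_rev (K_cont Kmu Kmuv)).
rewrite (seg_rev (K_cont Kmv Kmuv)).
do !move: (seg g _ _) => ?.
by ring.
Qed.

End on_convex.

(** The increments after step n sum to at most 2 c / 2^n, so the intervals of this radius about x n
    are nested; the limit is the supremum of their left ends. *)
Lemma nested_limit (x : nat -> R) (c : R) :
  (forall n, `|x n.+1 - x n| <= c / 2 ^+ n) ->
  exists l, forall n, `|x n - l| <= 2 * c / 2 ^+ n.
Proof.
move=> xc; pose y n := x n - 2 * c / 2 ^+ n; pose z n := x n + 2 * c / 2 ^+ n.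
have c0 : 0 <= c by have := xc 0%N; rewrite expr0 divr1; apply: le_trans.
have e0 n : 0 < (2 ^+ n)^-1 :> R by rewrite invr_gt0 exprn_gt0.
have eS n : (2 ^+ n.+1)^-1 = (2 ^+ n)^-1 / 2 :> R by rewrite exprS invfM mulrC.
have step n : y n <= y n.+1 /\ z n.+1 <= z n.
  have := xc n; rewrite /y /z eS; have := e0 n; set e := (2 ^+ n)^-1.
  by rewrite ler_norml => ? /andP[? ?]; split; nra.
have ym m n : (m <= n)%N -> y m <= y n.
  by elim: n => [|n IH]; [rewrite leqn0 => /eqP->|rewrite leq_eqVlt => /predU1P[->//|/IH H]; exact: le_trans H (step n).1].
have zm m n : (m <= n)%N -> z n <= z m.
  by elim: n => [|n IH]; [rewrite leqn0 => /eqP->|rewrite leq_eqVlt => /predU1P[->//|/IH H]; exact: le_trans (step n).2 H].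
have yz m n : y m <= z n.
  have ymax : y (maxn m n) <= z (maxn m n).
    by rewrite /y /z; have := e0 (maxn m n); nra.
  by rewrite (le_trans (ym _ _ (leq_maxl m n)))// (le_trans ymax)// zm// leq_maxr.
exists (sup (range y)) => n.
have hs : has_sup (range y).
  by split; [exists (y 0%N), 0%N|exists (z 0%N) => _ [m _ <-]].
have h1 : y n <= sup (range y) by apply: (sup_upper_bound hs); exists n.
have h2 : sup (range y) <= z n by apply: ge_sup; [case: hs|move=> _ [m _ <-]].
by move: h1 h2; rewrite /y /z => h1 h2; rewrite ler_distlC; apply/andP; split; lra.
Qed.

Lemma nested_limitC (x : nat -> C) (c : R) :
  (forall n, nrm (x n.+1 - x n) <= c / 2 ^+ n) ->
  exists l, forall n, nrm (x n - l) <= 4 * c / 2 ^+ n.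
Proof.
move=> xc.
have [l1 P1] : exists l, forall n, `|Re (x n) - l| <= 2 * c / 2 ^+ n.
  apply: nested_limit => n; apply: le_trans (xc n).
  by rewrite -raddfB Re_le_nrm.
have [l2 P2] : exists l, forall n, `|Im (x n) - l| <= 2 * c / 2 ^+ n.
  apply: nested_limit => n; apply: le_trans (xc n).
  by rewrite -raddfB Im_le_nrm.
exists (l1 +i* l2) => n; rewrite (le_trans (nrm_le_ReIm _))// !raddfB/=.
rewrite (le_trans (lerD (P1 n) (P2 n)))//.
by rewrite -!mulrA; set e := c * _; lra.
Qed.

End goursat.

Section goursat.
Context (R : realType).
Local Notation C := R[i].
Local Notation Re := (@complex.Re R).
Local Notation Im := (@complex.Im R).

Lemma small_pow2 (c e : R) : 0 < e -> exists n, c / 2 ^+ n < e.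
Proof.
move=> e0; exists (Num.bound (`|c| / e)).
rewrite ltr_pdivrMr ?exprn_gt0// mulrC -ltr_pdivrMr//.
have := archi_boundP (divr_ge0 (normr_ge0 c) (ltW e0)).
set n := Num.bound _ => H; apply: (@le_lt_trans _ _ (`|c| / e)).
  by rewrite ler_pM2r ?invr_gt0// ler_norm.
by rewrite (lt_trans H)// -natrX ltr_nat ltn_expl.
Qed.

Lemma diff_quad (V W : normedModType C) (f : V -> W) (x : V) (L : V -> W) (c r : R) :
  0 < r -> linear L -> (exists2 b : R, 0 <= b & forall u, nrm (L u) <= b * nrm u) ->
  (forall u, nrm u < r -> nrm (f (x + u) - f x - L u) <= c * nrm u ^+ 2) ->
  differentiable f x /\ 'd f x = L :> (V -> W).
Proof.
move=> r0 linL bL fL; apply: Dif_diff; split => // e e0.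
have c0 : 0 < `|c| + 1 by rewrite ltr_wpDl.
exists (Num.min r (e / (`|c| + 1))); first by rewrite lt_min r0 divr_gt0.
move=> u; rewrite lt_min => /andP[/fL H]; rewrite ltr_pdivlMr// => ue.
rewrite (le_trans H)// expr2 mulrA ler_wpM2r ?nrm_ge0//.
have := nrm_ge0 u; have := ler_norm c => h1 h2; rewrite (le_trans _ (ltW ue))// mulrC.
by rewrite ler_wpM2l//; lra.
Qed.

Lemma linear_mulr (m : C) : linear (fun k : C => k * m).
Proof. by move=> a u v; rewrite mulrDl -mulrA. Qed.

Lemma diff_quadC (f : C -> C) (x m : C) (c r : R) : 0 < r ->
  (forall k, nrm k < r -> nrm (f (x + k) - f x - k * m) <= c * nrm k ^+ 2) ->
  differentiable f x /\ forall k, 'd f x k = k * m.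
Proof.
move=> r0 fm; have [|df dE] := @diff_quad C C f x (fun k => k * m) c r r0 (linear_mulr m) _ fm.
  by exists (nrm m); [exact: nrm_ge0|move=> u; rewrite nrmM mulrC].
by split=> // k; rewrite dE.
Qed.

Lemma diff1E (f : C -> C) (x k : C) : 'd f x k = k * 'd f x 1.
Proof. by rewrite -[k in LHS]mulr1 -[k * 1]/(k *: 1) linearZ. Qed.

(** An affine function has an explicit primitive, so it integrates to 0 around a triangle; this
    removes the first-order part in Goursat's argument. *)
Lemma seg_affine (m d l p q : C) :
  seg (fun z => m + (z - l) * d) p q =
  (m * q + d / 2 * (q - l) ^+ 2) - (m * p + d / 2 * (p - l) ^+ 2).
Proof.
have n2 : (2 : C) != 0 by rewrite pnatr_eq0.
apply: (@seg_FTC R (fun z => m * z + d / 2 * (z - l) ^+ 2)).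
  move=> t _; apply: contD; first exact: cont_cst.
  apply: contM; last exact: cont_cst.
  by apply: contB; [exact: cvg_id|exact: cont_cst].
move=> t _; set z := lin p q t.
have [|d1 d2] := @diff_quadC (fun z => m * z + d / 2 * (z - l) ^+ 2) z
   (m + (z - l) * d) (nrm (d / 2)) 1 ltr01.
  move=> k _; rewrite -nrmX -nrmM.
  by rewrite le_eqVlt; apply/orP; left; apply/eqP; congr nrm; field.
by split => //; rewrite d2.
Qed.

(** One of the four half-size triangles carries at least a quarter of the integral; iterating, the
    triangles shrink to a point [l] where [g] is nearly affine. The second hypothesis is closedness
    of [K], which puts [l] in [K]. *)
Lemma goursat (K : set C) (g : C -> C) (a u v : C) : cvx K ->
  (forall z, (forall e : R, 0 < e -> exists2 y, K y & nrm (y - z) < e) -> K z) ->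
  (forall z, K z -> differentiable g z) ->
  K a -> K (a + u) -> K (a + v) -> tri g a u v = 0.
Proof.
move=> Kcvx Kcl gd Ka Ku Kv; apply/eqP/negPn/negP => tri0.
have gc z : K z -> {for z, continuous g}.
  by move=> /gd; exact: differentiable_continuous.
pose good (s : C * C * C) := [/\ K s.1.1, K (s.1.1 + s.1.2) & K (s.1.1 + s.2)].
pose T (s : C * C * C) := nrm (tri g s.1.1 s.1.2 s.2).
pose next (s s' : C * C * C) := [/\ good s', T s / 4 <= T s',
  nrm s'.1.2 <= nrm s.1.2 / 2, nrm s'.2 <= nrm s.2 / 2 &
  nrm (s'.1.1 - s.1.1) <= (nrm s.1.2 + nrm s.2) / 2].
have /choice[F FP] : forall s, exists s', good s -> next s s'.
  move=> s; have [gs|] := pselect (good s); last by exists s.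
  case: s gs => -[{Ka}a {Ku}u] {Kv tri0}v [/= Ka Ku Kv].
  have [[K1 K2 K3] triE] := tri_split Kcvx gc Ka Ku Kv.
  have n12 w : nrm (w / 2 : C) = nrm w / 2.
    by rewrite nrmM nrmV nrm_nat.
  have n2 : (2 : C) != 0 by rewrite pnatr_eq0.
  suff [s' H] : exists s', next ((a, u), v) s' by exists s'.
  pose t1 := ((a, u / 2), v / 2). pose t2 := ((a + u / 2, u / 2), v / 2).
  pose t3 := ((a + v / 2, u / 2), v / 2).
  pose t4 := ((a + (u + v) / 2, - (u / 2)), - (v / 2)).
  have Tle : T ((a, u), v) <= T t1 + T t2 + T t3 + T t4.
    rewrite {1}/T /= triE (le_trans (nrmD _ _))// lerD2r.
    by rewrite (le_trans (nrmD _ _))// lerD2r nrmD.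
  have N0 := nrm_ge0 u; have N1 := nrm_ge0 v.
  have E0 : 0 <= (nrm u + nrm v) / 2 by rewrite divr_ge0 ?addr_ge0.
  have E1 : nrm u / 2 <= (nrm u + nrm v) / 2 by rewrite ler_pM2r// lerDl.
  have E2 : nrm v / 2 <= (nrm u + nrm v) / 2 by rewrite ler_pM2r// lerDr.
  have E3 : nrm (u + v) / 2 <= (nrm u + nrm v) / 2 by rewrite ler_pM2r// nrmD.
  have H1 : next ((a, u), v) t1 \/ T t1 < T ((a, u), v) / 4.
    case: (ltP (T t1)) => h; [by right|left]; split; rewrite //= ?n12//.
    by rewrite subrr nrm0.
  have H2 : next ((a, u), v) t2 \/ T t2 < T ((a, u), v) / 4.
    case: (ltP (T t2)) => h; [by right|left]; split; rewrite //= ?n12//.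
      split => //=; first by rewrite (_ : a + _ + _ = a + u)//; field.
      by rewrite (_ : a + _ + _ = a + (u + v) / 2)//; field.
    by rewrite addrAC subrr add0r n12.
  have H3 : next ((a, u), v) t3 \/ T t3 < T ((a, u), v) / 4.
    case: (ltP (T t3)) => h; [by right|left]; split; rewrite //= ?n12//.
      split => //=; first by rewrite (_ : a + _ + _ = a + (u + v) / 2)//; field.
      by rewrite (_ : a + _ + _ = a + v)//; field.
    by rewrite addrAC subrr add0r n12.
  have H4 : next ((a, u), v) t4 \/ T t4 < T ((a, u), v) / 4.
    case: (ltP (T t4)) => h; [by right|left]; split; rewrite //= ?nrmN ?n12//.
      split => //=; first by rewrite (_ : a + _ + _ = a + v / 2)//; field.
      by rewrite (_ : a + _ + _ = a + u / 2)//; field.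
    by rewrite addrAC subrr add0r n12.
  case: H1 => [|h1]; first by exists t1.
  case: H2 => [|h2]; first by exists t2.
  case: H3 => [|h3]; first by exists t3.
  case: H4 => [|h4]; first by exists t4.
  exfalso; move: Tle h1 h2 h3 h4; do !move: (T _) => ?; clear; lra.
pose s n := iter n F ((a, u), v).
pose L := nrm u + nrm v; pose tau := nrm (tri g a u v).
have tau0 : 0 < tau by rewrite nrm_gt0.
have L0 : 0 <= L by rewrite addr_ge0 ?nrm_ge0.
have inv n : [/\ good (s n), tau / 4 ^+ n <= T (s n),
    nrm (s n).1.2 <= nrm u / 2 ^+ n & nrm (s n).2 <= nrm v / 2 ^+ n].
  elim: n => [|n [g1 g2 g3 g4]]; first by rewrite !expr0 !divr1; split.
  have [h1 h2 h3 h4 h5] := FP _ g1; split => //.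
  - by rewrite exprS invfM mulrA mulrAC; apply: le_trans h2; rewrite ler_pM2r.
  - by rewrite exprS invfM mulrA mulrAC; apply: (le_trans h3); rewrite ler_pM2r.
  - by rewrite exprS invfM mulrA mulrAC; apply: (le_trans h4); rewrite ler_pM2r.
pose e_ n : R := (2 ^+ n)^-1.
have e0 n : 0 < e_ n by rewrite invr_gt0 exprn_gt0.
have [l lP] : exists l, forall n, nrm ((s n).1.1 - l) <= 4 * L / 2 ^+ n.
  apply: nested_limitC => n; have [g1 _ g3 g4] := inv n.
  have [_ _ _ _ h] := FP _ g1; apply: (le_trans h).
  have := e0 n; rewrite -/(e_ n) in g3 g4 *; rewrite /L mulrDl.
  have := nrm_ge0 u; have := nrm_ge0 v; nra.
have Kl : K l.
  apply: Kcl => e ep; have [n nP] := small_pow2 (4 * L) ep.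
  exists (s n).1.1; first by have [[]] := inv n.
  exact: le_lt_trans nP.
have [_ _ gl] := diff_Dif (gd _ Kl).
(* The n-th triangle lies within 7 L / 2^n of [l] (7 = 1 + 4 + 2) and its sides have length at most
   2 L / 2^n. With the factor 2 of [seg_bound], each side contributes at most 28 eps L^2 / 4^n, and
   84 = 3 * 28. *)
pose eps := tau / (84 * L ^+ 2 + 1).
have D0 : 0 < 84 * L ^+ 2 + 1 by have := sqr_ge0 L; lra.
have eps0 : 0 < eps by rewrite divr_gt0.
have [del del0 delP] := gl _ eps0.
have [n nP] := small_pow2 (7 * L) del0.
have [[k1 k2 k3] tn un vn] := inv n.
set b := (s n).1.1 in k1 k2 k3; set p := (s n).1.2 in k2 un; set q := (s n).2 in k3 vn.
rewrite -/(e_ n) in un vn nP.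
have en0 := e0 n; set e1 := e_ n in en0 un vn nP.
pose d := 'd g l 1.
pose aff z := g l + (z - l) * d.
have affc z : {for z, continuous aff}.
  apply: contD; first exact: cont_cst.
  apply: contM; last exact: cont_cst.
  by apply: contB; [exact: cvg_id|exact: cont_cst].
have bl : nrm (b - l) <= 4 * L * e1 by have := lP n.
have Nu := nrm_ge0 u; have Nv := nrm_ge0 v.
have est x y : K x -> K y -> nrm (x - b) <= L * e1 -> nrm (y - b) <= L * e1 ->
    nrm (seg (fun z => g z - aff z) x y) <= 28 * eps * L ^+ 2 * e1 ^+ 2.
  move=> Kx Ky xb yb.
  have xy : nrm (y - x) <= 2 * L * e1.
    rewrite (le_trans (nrm_tri _ _ b))// (nrmBC b).
    by rewrite -mulrA mulr_natl mulr2n lerD.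
  have H : nrm (seg (fun z => g z - aff z) x y)
      <= 2 * (eps * (7 * L * e1)) * nrm (y - x).
    apply: seg_bound.
  - by move=> t t01; apply: contB; [apply: gc; exact: Kcvx|exact: affc].
  - move=> t /andP[t0 t1]; set z := lin x y t.
    have zl : nrm (z - l) <= 7 * L * e1.
      have -> : z - l = (x - b) + (b - l) + t%:C * (y - x) by rewrite /z /lin; ring.
      rewrite (le_trans (nrmD _ _))//.
      have A2 : nrm (t%:C * (y - x)) <= 2 * L * e1.
        rewrite nrmM nrm_real ger0_norm//; apply: le_trans xy.
        by rewrite -[leRHS]mul1r ler_wpM2r ?nrm_ge0.
      apply: (le_trans (lerD (le_trans (nrmD _ _) (lerD xb bl)) A2)).
      by rewrite le_eqVlt; apply/orP; left; apply/eqP; ring.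
    have := delP (z - l) (le_lt_trans zl nP).
    rewrite [l + _]addrC subrK diff1E -/d.
    rewrite /aff opprD addrA => /le_trans; apply.
    by rewrite ler_wpM2l// ltW.
  - apply: (le_trans H).
    have : 2 * (eps * (7 * L * e1)) * nrm (y - x) <= 2 * (eps * (7 * L * e1)) * (2 * L * e1).
      have eps1 := ltW eps0; have e10 := ltW en0.
      by apply: ler_wpM2l xy; do ![apply: mulr_ge0 => //].
    move/le_trans; apply; rewrite le_eqVlt; apply/orP; left; apply/eqP.
    by clear; ring.
have triE : tri g b p q = seg (fun z => g z - aff z) b (b + p)
    + seg (fun z => g z - aff z) (b + p) (b + q) + seg (fun z => g z - aff z) (b + q) b.
  have H x y : K x -> K y -> seg (fun z => g z - aff z) x y = seg g x y - seg aff x y.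
    by move=> Kx Ky; apply: segB => t t01; [apply: gc; exact: Kcvx|exact: affc].
  rewrite !H// /tri.
  rewrite /aff !seg_affine; do !move: (seg g _ _) => ?; ring.
have bb : nrm (b - b) <= L * e1 by rewrite subrr nrm0 mulr_ge0// ltW.
have bp : nrm (b + p - b) <= L * e1.
  by rewrite addrAC subrr add0r (le_trans un)// /L; nra.
have bq : nrm (b + q - b) <= L * e1.
  by rewrite addrAC subrr add0r (le_trans vn)// /L; nra.
have : T (s n) <= 84 * eps * L ^+ 2 * e1 ^+ 2.
  rewrite /T -/b -/p -/q triE.
  have h1 := est _ _ k1 k2 bb bp; have h2 := est _ _ k2 k3 bp bq.
  have h3 := est _ _ k3 k1 bq bb.
  rewrite (le_trans (nrmD _ _))// (le_trans (lerD (nrmD _ _) (lexx _)))//.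
  by move: h1 h2 h3; lra.
have -> : e1 ^+ 2 = (4 ^+ n)^-1.
  by rewrite /e1 /e_ -exprVn -exprVn -exprM mulnC exprM; congr (_ ^+ n); field.
move=> /(le_trans tn); rewrite ler_pM2r ?invr_gt0 ?exprn_gt0// leNgt => /negP; apply.
rewrite /eps mulrAC mulrA ltr_pdivrMr// [84 * _]mulrC -mulrA.
by rewrite mulrDr mulr1; have := tau0; nra.
Qed.

End goursat.

(** * Primitives of functions holomorphic off one point *)

Section primitive.
Context (R : realType).
Local Notation C := R[i].
Local Notation Re := (@complex.Re R).
Local Notation Im := (@complex.Im R).

Lemma lin_le (x0 p q : C) (t r : R) : nrm (p - x0) <= r -> nrm (q - x0) <= r ->
  0 <= t <= 1 -> nrm (lin p q t - x0) <= r.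
Proof.
move=> pr qr /andP[t0 t1].
have -> : lin p q t - x0 = (1 - t)%:C * (p - x0) + t%:C * (q - x0).
  by rewrite /lin rmorphB rmorph1; ring.
have t1' : 0 <= 1 - t by rewrite subr_ge0.
rewrite (le_trans (nrmD _ _))// !nrmM !nrm_real !ger0_norm//.
rewrite (le_trans (lerD (ler_wpM2l t1' pr) (ler_wpM2l t0 qr)))//.
by rewrite -mulrDl subrK mul1r.
Qed.

Lemma lin_lt (x0 p q : C) (t r : R) : nrm (p - x0) < r -> nrm (q - x0) < r ->
  0 <= t <= 1 -> nrm (lin p q t - x0) < r.
Proof.
move=> pr qr t01.
apply: (@le_lt_trans _ _ (Num.max (nrm (p - x0)) (nrm (q - x0)))).
  by apply: lin_le => //; rewrite le_max lexx ?orbT.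
by rewrite gt_max pr qr.
Qed.

Lemma cvx_comb (a b c t : R) : c <= a -> c <= b -> 0 <= t <= 1 ->
  c <= (1 - t) * a + t * b.
Proof. by move=> ca cb /andP[t0 t1]; nra. Qed.

Lemma le_small_eq0 (x A r : R) : 0 < r -> 0 <= x ->
  (forall s, 0 < s < r -> x <= s * A) -> x = 0.
Proof.
move=> r0 x0 xA; apply/eqP; rewrite eq_le x0 andbT leNgt; apply/negP => xp.
have A0 : 0 < `|A| + 1 by rewrite ltr_wpDl.
pose s := Num.min (r / 2) (x / (`|A| + 1) / 2).
have s0 : 0 < s by rewrite lt_min !divr_gt0.
have sr : s < r by rewrite gt_min; apply/orP; left; lra.
have := xA s; rewrite s0 sr => /(_ isT) H.
have h1 : s * A <= s * (`|A| + 1).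
  by rewrite ler_pM2l// (le_trans (ler_norm _))// lerDl.
have h2 : s * (`|A| + 1) <= x / 2.
  by rewrite -ler_pdivlMr// ge_min [x / 2 / _]mulrAC lexx orbT.
by have := le_trans H (le_trans h1 h2); rewrite leNgt ltr_pdivrMr// ltr_pMr// ltr1n.
Qed.

Variables (x0 : C) (R0 : R) (w : C) (g : C -> C).
Hypotheses (wB : nrm (w - x0) < R0)
  (gc : forall z, nrm (z - x0) < R0 -> {for z, continuous g})
  (gd : forall z, nrm (z - x0) < R0 -> z != w -> differentiable g z).

Let gclin p q : nrm (p - x0) < R0 -> nrm (q - x0) < R0 ->
  forall t, 0 <= t <= 1 -> {for lin p q t, continuous g}.
Proof. by move=> pB qB t t01; apply: gc; exact: lin_lt. Qed.

(** Cutting off the corner at [w] leaves a trapezoid, made of two triangles in the convex set [K]: a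
    closed disc intersected with a half-plane orthogonal to [u] that misses [w]. The condition on z'
    makes the angle at [w] acute, so both far vertices lie in such a half-plane. *)
Lemma tri_trapezoid (z z' : C) (s : R) : nrm (z - x0) < R0 -> nrm (z' - x0) < R0 ->
  nrm (z' - z) < nrm (z - w) -> 0 < s < 1 ->
  tri g w (z - w) (z' - w) = tri g w (s%:C * (z - w)) (s%:C * (z' - w)).
Proof.
move=> zB zB' zz' /andP[s0 s1]; set u := z - w; set v := z' - w.
pose ip (y : C) := Re (y * u^*).
have ipD y y' : ip (y + y') = ip y + ip y' by rewrite /ip mulrDl raddfD.
have ipZ (t : R) y : ip (t%:C * y) = t * ip y.
  by rewrite /ip -mulrA; case: (y * u^*) => a b /=; rewrite mul0r subr0.
have ip_le y : `|ip y| <= nrm y * nrm u.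
  by rewrite /ip (le_trans (Re_le_nrm _))// nrmM nrm_conj.
have ipu : ip u = nrm u ^+ 2.
  by rewrite nrm_sqr /ip; clear; case: u => a b /=; ring.
have u0 : 0 < nrm u by apply: le_lt_trans zz'; exact: nrm_ge0.
have ipv : 0 < ip v.
  have -> : v = u + (z' - z) by rewrite /u /v; ring.
  have := ip_le (z' - z); rewrite (ipD u) ipu ler_norml => /andP[h _].
  have : nrm (z' - z) * nrm u < nrm u ^+ 2 by rewrite expr2 ltr_pM2r.
  by move: h; lra.
pose m := Num.min (nrm u ^+ 2) (ip v).
have m0 : 0 < m by rewrite lt_min ipv exprn_gt0.
have mu : m <= ip u by rewrite ipu ge_min lexx.
have mv : m <= ip v by rewrite ge_min lexx orbT.
pose rho := Num.max (nrm (w - x0)) (Num.max (nrm (z - x0)) (nrm (z' - x0))).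
have rR : rho < R0 by rewrite !gt_max wB zB zB'.
have wr : nrm (w - x0) <= rho by rewrite le_max lexx.
have zr : nrm (z - x0) <= rho by rewrite !le_max lexx orbT.
have zr' : nrm (z' - x0) <= rho by rewrite !le_max lexx !orbT.
pose K : set C := [set y | nrm (y - x0) <= rho /\ s * m <= ip (y - w)].
have Kc : cvx K.
  move=> p q t [p1 p2] [q1 q2] t01; split; first exact: lin_le.
  have -> : lin p q t - w = (1 - t)%:C * (p - w) + t%:C * (q - w).
    by rewrite /lin rmorphB rmorph1; ring.
  rewrite ipD !ipZ.
  by exact: cvx_comb.
have Kcl y : (forall e : R, 0 < e -> exists2 y', K y' & nrm (y' - y) < e) -> K y.
  move=> yK; split; apply/ler_addgt0Pr => e e0.
    have [y' [y1 _] yy] := yK _ e0.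
    by rewrite (le_trans (nrm_tri _ _ y'))// addrC lerD// nrmBC ltW.
  have [|y' [_ y2] yy] := yK (e / nrm u); first by rewrite divr_gt0.
  have -> : y - w = (y' - w) + (y - y') by ring.
  have := ip_le (y - y'); rewrite (ipD (y' - w)) ler_norml => /andP[h _].
  move: yy; rewrite ltr_pdivlMr// nrmBC => yy.
  by move: h yy y2; move: (ip _) (ip _) (nrm _ * _) (s * m) => ? ? ? ?; lra.
have Kg y : K y -> differentiable g y.
  move=> [y1 y2]; apply: gd; first exact: le_lt_trans rR.
  apply/eqP => yw; move: y2; rewrite yw subrr /ip mul0r leNgt /= mulr_gt0//.
set zs := w + s%:C * u; set zs' := w + s%:C * v.
have s01 : 0 <= s <= 1 by rewrite !ltW.
have zsE : zs = lin w z s by rewrite /lin /zs /u.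
have zsE' : zs' = lin w z' s by rewrite /lin /zs' /v.
have sm : s * m <= m by rewrite ler_piMl ?(ltW m0) ?(ltW s1).
have Kz : K z by split=> //; exact: le_trans sm mu.
have Kz' : K z' by split=> //; exact: le_trans sm mv.
have Kzs : K zs.
  split; first by rewrite zsE; exact: lin_le.
  by rewrite /zs addrAC subrr add0r ipZ ler_pM2l.
have Kzs' : K zs'.
  split; first by rewrite zsE'; exact: lin_le.
  by rewrite /zs' addrAC subrr add0r ipZ ler_pM2l.
have subK x y : x + (y - x) = y :> C by rewrite addrC subrK.
have T1 : tri g zs (z - zs) (z' - zs) = 0 by apply: (goursat Kc Kcl Kg); rewrite ?subK.
have T2 : tri g zs (z' - zs) (zs' - zs) = 0 by apply: (goursat Kc Kcl Kg); rewrite ?subK.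
have KB y : K y -> nrm (y - x0) < R0 by move=> [y1 _]; exact: le_lt_trans rR.
have zsB := KB _ Kzs; have zsB' := KB _ Kzs'.
move: T1 T2; rewrite /tri !subK -/zs -/zs'.
have wz : w + u = z by rewrite /u subK.
have wz' : w + v = z' by rewrite /v subK.
rewrite ?wz ?wz'.
rewrite (seg_split (gclin wB zB) s01) -zsE.
rewrite (seg_rev (gclin wB zB')) (seg_split (gclin wB zB') s01) -zsE'.
rewrite (seg_rev (gclin zsB zB')).
rewrite (seg_rev (gclin zsB' zB')) (seg_rev (gclin wB zsB')).
rewrite (seg_rev (gclin zsB zsB')).
move=> T1 T2; have T12 := congr2 +%R T1 T2; rewrite addr0 in T12.
apply/eqP; rewrite -subr_eq0 -[X in _ == X]T12; apply/eqP.
by do !move: (seg g _ _) => ?; ring.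
Qed.

(** The integral equals that over arbitrarily small similar triangles at [w], near which [g] is
    bounded. *)
Lemma tri_star (z z' : C) : nrm (z - x0) < R0 -> nrm (z' - x0) < R0 ->
  nrm (z' - z) < nrm (z - w) -> tri g w (z - w) (z' - w) = 0.
Proof.
move=> zB zB' zz'; set u := z - w; set v := z' - w.
have /cont_nrmP/(_ 1 ltr01)/nbhs_nrm[d d0 dP] := gc wB.
pose L := nrm u + nrm v + 1.
have L0 : 0 < L by rewrite /L ltr_wpDl// addr_ge0// nrm_ge0.
pose M := nrm (g w) + 1.
have M0 : 0 <= M by rewrite addr_ge0// nrm_ge0.
apply/eqP; rewrite -nrm_eq0; apply/eqP.
apply: (@le_small_eq0 _ (6 * (M * (2 * L))) (Num.min 1 (d / L))).
- by rewrite lt_min ltr01 divr_gt0.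
- exact: nrm_ge0.
move=> s /andP[s0]; rewrite lt_min => /andP[s1]; rewrite ltr_pdivlMr// => sL.
rewrite (@tri_trapezoid z z' s)// ?s0 ?s1// -/u -/v.
have s01 : 0 <= s <= 1 by rewrite !ltW.
have nL x : nrm x <= L -> nrm (w + s%:C * x - w) <= s * L.
  by move=> xL; rewrite addrAC subrr add0r nrmM nrm_real gtr0_norm// ler_pM2l.
have NU := nrm_ge0 u; have NV := nrm_ge0 v.
have uL : nrm u <= L by rewrite /L; move: NU NV; lra.
have vL : nrm v <= L by rewrite /L; move: NU NV; lra.
have sL0 : 0 <= s * L by rewrite mulr_ge0// ltW.
have B x y : nrm (x - w) <= s * L -> nrm (y - w) <= s * L ->
    nrm (x - x0) < R0 -> nrm (y - x0) < R0 ->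
    nrm (seg g x y) <= 2 * M * (2 * (s * L)).
  move=> xw yw xB yB.
  have H : nrm (seg g x y) <= 2 * M * nrm (y - x).
    apply: seg_bound; first exact: gclin.
    move=> t t01; have : nrm (lin x y t - w) <= s * L by exact: lin_le.
    move=> /le_lt_trans/(_ sL)/dP gl.
    have := nrm_sub_ge (g (lin x y t)) (g w); rewrite lerBlDr => /le_trans; apply.
    by rewrite addrC lerD2l ltW.
  apply: (le_trans H); rewrite ler_wpM2l ?mulr_ge0//.
  by rewrite (le_trans (nrm_tri _ _ w))// mulr_natl mulr2n lerD// nrmBC.
have ww : nrm (w - w) <= s * L by rewrite subrr nrm0.
have pB x y : nrm (y - x0) < R0 -> x = y - w -> nrm (w + s%:C * x - x0) < R0.
  by move=> yB ->; apply: lin_lt.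
have h1 := B _ _ ww (nL _ uL) wB (pB _ _ zB erefl).
have h2 := B _ _ (nL _ uL) (nL _ vL) (pB _ _ zB erefl) (pB _ _ zB' erefl).
have h3 := B _ _ (nL _ vL) ww (pB _ _ zB' erefl) wB.
rewrite /tri (le_trans (nrmD _ _))// (le_trans (lerD (nrmD _ _) (lexx _)))//.
rewrite (le_trans (lerD (lerD h1 h2) h3))// le_eqVlt; apply/orP; left; apply/eqP.
by ring.
Qed.

(** The primitive integrates from the exceptional point [w] rather than from the centre, so that [w]
    is always a vertex of the triangles involved. *)
Lemma prim_ball : exists Q : C -> C, forall z, nrm (z - x0) < R0 ->
  differentiable Q z /\ forall k, 'd Q z k = k * g z.
Proof.
exists (seg g w) => z zB.
have key k : nrm (z + k - x0) < R0 -> z = w \/ nrm k < nrm (z - w) ->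
    seg g w (z + k) - seg g w z = seg g z (z + k).
  move=> kB [->|kz]; first by rewrite seg_point subr0.
  have := @tri_star z (z + k) zB kB; rewrite [z + k - z]addrAC subrr add0r => /(_ kz).
  rewrite /tri ![w + (_ - w)]addrC !subrK.
  rewrite (seg_rev (gclin wB kB)) => /eqP; rewrite addr_eq0 opprK => /eqP <-.
  by rewrite addrAC subrr add0r.
have [|d1 d2] := @Dif_diff R C C (seg g w) z (fun k => k * g z); last first.
  by split => // k; rewrite d2.
split; first exact: linear_mulr.
- by exists (nrm (g z)) => [|k]; [exact: nrm_ge0|rewrite nrmM mulrC].
move=> e e0; have e2 : 0 < e / 2 by rewrite divr_gt0.
have /cont_nrmP/(_ _ e2)/nbhs_nrm[d d0 dP] := gc zB.
(* Away from [w], [tri_star] asks for |k| < |z - w|; at z = w the increment is itself a segment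
   integral and any radius will do. *)
pose r := if z == w then 1 else nrm (z - w).
have r0 : 0 < r by rewrite /r; case: eqVneq => // ?; rewrite nrm_gt0 subr_eq0.
exists (Num.min d (Num.min r (R0 - nrm (z - x0)))).
  by rewrite !lt_min d0 r0 subr_gt0.
move=> k; rewrite !lt_min => /andP[kd /andP[kr kR]].
have kB : nrm (z + k - x0) < R0.
  rewrite [z + k]addrC -addrA (le_lt_trans (nrmD _ _))//.
  by rewrite -ltrBrDr.
rewrite key//; last first.
  by move: kr; rewrite /r; case: eqVneq => [-> _|_ h]; [left|right].
have -> : k * g z = seg (fun=> g z) z (z + k).
  have := seg_affine (g z) 0 0 z (z + k).
  rewrite (_ : (fun _ => _) = (fun=> g z)); last by apply/funext => ?; rewrite mulr0 addr0.
  by move=> ->; rewrite !mul0r !addr0; ring.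
rewrite -segB; last 2 first.
- exact: gclin.
- by move=> t _; exact: cont_cst.
have -> : e * nrm k = 2 * (e / 2) * nrm (z + k - z).
  by rewrite [z + k]addrC addrK; field.
apply: seg_bound.
  by move=> t t01; apply: contB; [exact: gclin|exact: cont_cst].
move=> t /andP[t0 t1]; apply/ltW/dP.
rewrite /lin [z + k]addrC addrK addrAC subrr add0r nrmM nrm_real ger0_norm//.
by apply: le_lt_trans kd; rewrite ler_piMl ?nrm_ge0.
Qed.

End primitive.

(** * Cauchy's integral formula on a circle *)

Section cauchy.
Context (R : realType).
Local Notation C := R[i].
Local Notation Re := (@complex.Re R).
Local Notation Im := (@complex.Im R).

Lemma small_geo (rho c e : R) : 0 <= rho < 1 -> 0 < e -> exists n, c * rho ^+ n < e.
Proof.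
move=> /andP[r0 r1] e0.
have c0 : 0 < `|c| + 1 by rewrite ltr_wpDl.
have := @cvg_expr R rho; rewrite ger0_norm// => /(_ r1)/cvgrPdist_lt.
move=> /(_ (e / (`|c| + 1))); rewrite divr_gt0// => /(_ isT)[n _ /(_ n)].
rewrite /= leqnn => /(_ isT); rewrite sub0r normrN ger0_norm ?exprn_ge0//.
rewrite ltr_pdivlMr// => H; exists n; apply: le_lt_trans H.
rewrite mulrC ler_wpM2l ?exprn_ge0// (le_trans (ler_norm c))// lerDl//.
Qed.

Lemma Dif_ext (V W : normedModType C) (f g : V -> W) x L (r : R) : 0 < r ->
  (forall y, nrm (y - x) < r -> f y = g y) -> Dif f x L -> Dif g x L.
Proof.
move=> r0 fg [h1 h2 h3]; split => // e e0; have [d d0 dP] := h3 _ e0.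
exists (Num.min d r); first by rewrite lt_min d0.
move=> u; rewrite lt_min => /andP[/dP ud ur].
rewrite -!fg//; first by rewrite subrr nrm0.
by rewrite addrAC subrr add0r.
Qed.

Lemma diff_ext (V W : normedModType C) (f g : V -> W) x (r : R) : 0 < r ->
  (forall y, nrm (y - x) < r -> f y = g y) -> differentiable f x ->
  differentiable g x /\ 'd g x = 'd f x :> (V -> W).
Proof. by move=> r0 fg /diff_Dif/(Dif_ext r0 fg)/Dif_diff. Qed.

Definition cis (t : R) : C := cos t +i* sin t.

Lemma nrm_cis t : nrm (cis t) = 1.
Proof. by rewrite nrm_def/= cos2Dsin2 sqrtr1. Qed.

Lemma cis_neq0 t : cis t != 0.
Proof. by rewrite -nrm_eq0 nrm_cis oner_eq0. Qed.

Lemma cisD s t : cis (s + t) = cis s * cis t.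
Proof.
apply/eqP; rewrite eq_complex/= cosD sinD eqxx/=.
by apply/eqP; rewrite addrC; congr (_ + _); rewrite mulrC.
Qed.

Lemma cis0 : cis 0 = 1. Proof. by rewrite /cis cos0 sin0. Qed.

Lemma cis2pi : cis (2 * pi) = 1.
Proof. by rewrite /cis mulr_natl cos2pi sin2pi. Qed.

Lemma cis_nat2pi n : cis (2 * pi * n%:R) = 1.
Proof.
elim: n => [|n IH]; first by rewrite mulr0 cis0.
by rewrite -[n.+1%:R]natr1 mulrDr mulr1 cisD IH cis2pi mulr1.
Qed.

Lemma cisX n t : cis (t * n%:R) = cis t ^+ n.
Proof.
elim: n => [|n IH]; first by rewrite mulr0 cis0 expr0.
by rewrite -[n.+1%:R]natr1 mulrDr mulr1 cisD IH exprSr.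
Qed.

Lemma cisN t : cis (- t) = (cis t)^-1.
Proof.
apply: (mulfI (cis_neq0 t)); rewrite -cisD subrr cis0 divff//; exact: cis_neq0.
Qed.

Lemma pder_cis t : pder cis t ('i * cis t).
Proof.
have := pder_ReIm (is_derive_cos t) (is_derive_sin t).
by congr pder; apply/eqP; rewrite eq_complex/= !mul0r !mul1r !add0r ?sub0r ?addr0 !eqxx.
Qed.

Lemma cont_cis t : {for t, continuous cis}.
Proof. exact: pder_cont (pder_cis t). Qed.

Definition circ (c : C) (r : R) (t : R) : C := c + r%:C * cis t.

Lemma pder_circ c r t : pder (circ c r) t ('i * (r%:C * cis t)).
Proof.
have H : differentiable (fun z : C => c + r%:C * z) (cis t) /\
    forall k, 'd (fun z : C => c + r%:C * z) (cis t) k = k * r%:C.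
  apply: (@diff_quadC R _ _ _ 0 1 ltr01) => k _.
  by rewrite mul0r (_ : _ - _ = 0) ?nrm0//; ring.
have := pder_diff H.1 (pder_cis t); rewrite H.2.
by congr pder; ring.
Qed.

Lemma circ_sub c r t : circ c r t - c = r%:C * cis t.
Proof. by rewrite /circ addrAC subrr add0r. Qed.

Lemma nrm_circ c r t : 0 <= r -> nrm (circ c r t - c) = r.
Proof. by move=> r0; rewrite circ_sub nrmM nrm_cis mulr1 nrm_real ger0_norm. Qed.

Lemma cont_circ c r t : {for t, continuous (circ c r)}.
Proof. exact: pder_cont (pder_circ c r t). Qed.

Let pi20 : 0 < 2 * pi :> R. Proof. by rewrite mulr_gt0// pi_gt0. Qed.

Lemma Cint_cst (a b : R) (c : C) : a < b -> Cint a b (fun=> c) = (b - a)%:C * c.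
Proof.
move=> ab; rewrite /Cint !Rintegral_cst//= lebesgue_measure_itv/= lte_fin ab.
by case: c => x y /=; apply/eqP; rewrite eq_complex/= !mul0r subr0 addr0 ![_ * (b - a)]mulrC !eqxx.
Qed.

Lemma Cint_cisX_inv (r : R) n : 0 < r ->
  Cint 0 (2 * pi) (fun t => (r%:C * cis t) ^- n.+1) = 0.
Proof.
move=> r0; pose m : R := - n.+1%:R.
have mE : m%:C = - n.+1%:R by rewrite rmorphN rmorph_nat.
pose k : C := r%:C ^- n.+1 * ('i * m%:C)^-1.
have im0 : 'i * m%:C != 0 :> C.
  rewrite mulf_neq0//; first by rewrite -nrm_eq0 nrm_i oner_eq0.
  by rewrite mE oppr_eq0 pnatr_eq0.
have P (t : R) : pder (fun s : R => cis (0 + s * m)) t (m%:C *: ('i * cis (0 + t * m))).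
  exact: pder_reparam (pder_cis (0 + t * m)).
have cX t : (r%:C * cis t) ^- n.+1 = r%:C ^- n.+1 * cis (0 + t * m).
  by rewrite add0r mulrN cisN cisX exprMn invfM.
rewrite (eq_Cint (g := fun t : R => r%:C ^- n.+1 * cis (0 + t * m))); last first.
  by move=> t _; exact: cX.
rewrite (@Cint_FTC _ _ _ pi20 _ (fun t : R => k * cis (0 + t * m))).
- by rewrite !add0r mul0r cis0 mulrN cisN cis_nat2pi invr1 subrr.
- by move=> t _; apply: contM; [exact: cont_cst|exact: pder_cont (P t)].
move=> t _.
have H : differentiable (fun z : C => k * z) (cis (0 + t * m)) /\
    forall j, 'd (fun z : C => k * z) (cis (0 + t * m)) j = j * k.
  apply: (@diff_quadC R _ _ _ 0 1 ltr01) => j _.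
  by rewrite mul0r (_ : _ - _ = 0) ?nrm0//; ring.
have := @pder_diff R C C (fun z => k * z) (fun s => cis (0 + s * m)) t _ H.1 (P t).
rewrite H.2; congr pder; rewrite /k -[m%:C *: _]/(m%:C * ('i * cis (0 + t * m))).
move: (cis (0 + t * m)) (r%:C ^- n.+1) => y z.
have -> : m%:C * ('i * y) = ('i * m%:C) * y by rewrite mulrCA mulrA.
by move: ('i * m%:C) im0 => X X0; field.
Qed.

Section winding.
Variables (a : C) (r : R).
Hypothesis (ar : nrm a < r).

Let r0 : 0 < r. Proof. exact: le_lt_trans (nrm_ge0 a) ar. Qed.

Let rcis_ne t : r%:C * cis t != 0.
Proof. by rewrite -nrm_eq0 nrmM nrm_cis mulr1 nrm_real gtr0_norm// gt_eqF. Qed.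

Let rcisB t : r - nrm a <= nrm (r%:C * cis t - a).
Proof.
apply: le_trans (nrm_sub_ge _ _).
by rewrite nrmM nrm_cis mulr1 nrm_real gtr0_norm.
Qed.

Let rcisB_ne t : r%:C * cis t - a != 0.
Proof. by rewrite -nrm_gt0 (lt_le_trans _ (rcisB t))// subr_gt0. Qed.

Let crc t : {for t, continuous (fun t => r%:C * cis t)}.
Proof. by apply: contM; [exact: cont_cst|exact: cont_cis]. Qed.

Let cX n t : {for t, continuous (fun t => (r%:C * cis t) ^+ n)}.
Proof.
elim: n => [|n IH].
  have -> : (fun t => (r%:C * cis t) ^+ 0) = fun=> 1 by apply/funext => s; rewrite expr0.
  exact: cont_cst.
have -> : (fun t => (r%:C * cis t) ^+ n.+1) =
    fun t => r%:C * cis t * (r%:C * cis t) ^+ n by apply/funext => s; rewrite exprS.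
exact: (contM (@crc t) IH).
Qed.

Let J n := Cint 0 (2 * pi)
  (fun t => r%:C * cis t * (r%:C * cis t - a)^-1 * (r%:C * cis t) ^- n).

Let cJ n t : {for t, continuous
  (fun t => r%:C * cis t * (r%:C * cis t - a)^-1 * (r%:C * cis t) ^- n)}.
Proof.
apply: contM; first apply: contM; first exact: crc.
- by apply: contV; [exact: rcisB_ne|apply: contB; [exact: crc|exact: cont_cst]].
- by apply: contV; [exact: expf_neq0|exact: cX].
Qed.

(** The geometric expansion of 1 / (1 - a / Z) on the circle, with exact remainder a^(n+1) J (n+1):
    negative powers integrate to 0 and the remainder is O((|a| / r)^n). *)
Lemma winding_num : Cint 0 (2 * pi)
  (fun t => r%:C * cis t * (r%:C * cis t - a)^-1) = (2 * pi)%:C.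
Proof.
have J0 : Cint 0 (2 * pi) (fun t => r%:C * cis t * (r%:C * cis t - a)^-1) = J 0.
  by rewrite /J; apply: eq_Cint => t _; rewrite expr0 invr1 mulr1.
have step n : J n = Cint 0 (2 * pi) (fun t => (r%:C * cis t) ^- n) + a * J n.+1.
  rewrite /J -CintZ; last by move=> t _; exact: cJ.
  rewrite -CintD; last 2 first.
  - by move=> t _; apply: contV; [exact: expf_neq0|exact: cX].
  - by move=> t _; apply: contM; [exact: cont_cst|exact: cJ].
  apply: eq_Cint => t _.
  have := rcis_ne t; have := rcisB_ne t; move: (r%:C * cis t) => z za z0.
  by rewrite exprS; field; rewrite z0 za expf_neq0.
have Jn n : J 0 = (2 * pi)%:C + a ^+ n.+1 * J n.+1.
  elim: n => [|n IH].
    rewrite step (eq_Cint (g := fun=> 1)) ?Cint_cst// ?subr0 ?mulr1 ?expr1//.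
    by move=> t _; rewrite expr0 invr1.
  rewrite IH; congr (_ + _); rewrite step Cint_cisX_inv// add0r.
  by rewrite [in RHS]exprS; ring.
have JB n : nrm (J n) <= 2 * (2 * pi) * (r / (r - nrm a)) / r ^+ n.
  rewrite -[leRHS]mulrA -{1}[2 * pi]subr0; apply: Cint_bound.
    exact: pi20.
    by move=> t _; exact: cJ.
  move=> t _; rewrite !nrmM !nrmV nrmX !nrmM nrm_cis mulr1 nrm_real gtr0_norm//.
  rewrite ler_pM2r ?invr_gt0 ?exprn_gt0// ler_pM2l// lef_pV2 ?posrE ?subr_gt0//.
  by rewrite (lt_le_trans _ (rcisB t))// subr_gt0.
rewrite J0; apply/eqP; rewrite -subr_eq0 -nrm_eq0 eq_le nrm_ge0 andbT.
apply/ler_addgt0Pr => e e0; rewrite add0r.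
have ra : 0 <= nrm a / r < 1.
  by rewrite divr_ge0 ?nrm_ge0 ?(ltW r0)//= ltr_pdivrMr// mul1r.
have [n nP] := small_geo (2 * (2 * pi) * (r / (r - nrm a)) * (nrm a / r)) ra e0.
apply: le_trans (ltW nP); rewrite (Jn n) addrAC subrr add0r nrmM nrmX.
rewrite (le_trans (ler_wpM2l _ (JB _)))// ?exprn_ge0 ?nrm_ge0//.
rewrite le_eqVlt; apply/orP; left; apply/eqP.
by rewrite -[RHS]mulrA -exprS expr_div_n mulrCA.
Qed.

End winding.

Section formula.
Variables (h : C -> C) (c x : C) (R0 r : R).
Hypotheses (hd : forall z, nrm (z - c) < R0 -> differentiable h z)
  (r0 : 0 < r) (rR : r < R0) (xr : nrm (x - c) < r).

Let xB : nrm (x - c) < R0. Proof. exact: lt_trans rR. Qed.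

Let circB t : nrm (circ c r t - c) < R0.
Proof. by rewrite nrm_circ// ltW. Qed.

Lemma circ_neq t : circ c r t - x != 0.
Proof.
rewrite -nrm_gt0; apply: lt_le_trans (_ : r - nrm (x - c) <= _).
  by rewrite subr_gt0.
have -> : circ c r t - x = (circ c r t - c) - (x - c) by ring.
by apply: le_trans (nrm_sub_ge _ _); rewrite nrm_circ// ltW.
Qed.

Lemma cont_hcirc t : {for t, continuous (fun t => h (circ c r t))}.
Proof.
by apply: continuous_comp; [exact: cont_circ|exact/differentiable_continuous/hd].
Qed.

Lemma cont_circV t : {for t, continuous (fun t => (circ c r t - x)^-1)}.
Proof.
by apply: contV; [exact: circ_neq|apply: contB; [exact: cont_circ|exact: cont_cst]].
Qed.

Lemma cont_rcis t : {for t, continuous (fun t => r%:C * cis t)}.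
Proof. by apply: contM; [exact: cont_cst|exact: cont_cis]. Qed.

(** The difference quotient of [h] at [x], completed by the derivative: continuous, and holomorphic
    off [x], which is what [prim_ball] takes. *)
Definition dquot (z : C) : C := if z == x then 'd h x 1 else (h z - h x) / (z - x).

Lemma dquot_diff z : nrm (z - c) < R0 -> z != x -> differentiable dquot z.
Proof.
move=> zB zx; have zx0 : 0 < nrm (z - x) by rewrite nrm_gt0 subr_eq0.
pose q1 : C -> C := (h - cst (h x)) * (fun y => (y - x)^-1).
apply: (diff_ext zx0 (f := q1) _ _).1.
  move=> y yz; rewrite /dquot; case: eqVneq => // yx.
  by move: yz; rewrite yx nrmBC ltxx.
apply: differentiableM; first by apply: differentiableB => //; exact: hd.
apply: (@differentiableV _ _ (fun y => y - x) z); last by rewrite subr_eq0.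
by apply: differentiableB.
Qed.

Lemma dquot_cont z : nrm (z - c) < R0 -> {for z, continuous dquot}.
Proof.
move=> zB; have [->|zx] := eqVneq z x; last first.
  exact/differentiable_continuous/dquot_diff.
apply/cont_nrmP => e e0; have [_ _ hx] := diff_Dif (hd xB).
have e2 : 0 < e / 2 by rewrite divr_gt0.
have [d d0 dP] := hx _ e2; apply/nbhs_nrm; exists d => // y yd.
rewrite {2}/dquot eqxx /dquot; case: eqVneq => [_|yx].
  by rewrite subrr nrm0.
have n0 : 0 < nrm (y - x) by rewrite nrm_gt0 subr_eq0.
have := dP _ yd; rewrite [x + _]addrC subrK (diff1E h x (y - x)).
have -> : h y - h x - (y - x) * 'd h x 1 =
   ((h y - h x) / (y - x) - 'd h x 1) * (y - x) by field; rewrite subr_eq0.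
by rewrite nrmM ler_pM2r// => /le_lt_trans; apply; lra.
Qed.

(** The quotient [dquot] has a primitive, so its integral around the circle vanishes; [winding_num]
    evaluates the remaining constant term. *)
Lemma cauchy_formula : h x = (2 * pi)%:C^-1 *
  Cint 0 (2 * pi) (fun t => h (circ c r t) * (r%:C * cis t) * (circ c r t - x)^-1).
Proof.
have [Q QP] := prim_ball xB dquot_cont dquot_diff.
have cq t : {for t, continuous (fun t => dquot (circ c r t))}.
  by apply: continuous_comp; [exact: cont_circ|exact: dquot_cont].
have I0 : Cint 0 (2 * pi) (fun t => dquot (circ c r t) * (r%:C * cis t)) = 0.
  have i0 : 'i != 0 :> C by rewrite -nrm_eq0 nrm_i oner_eq0.
  apply: (mulfI i0); rewrite mulr0 -CintZ; last first.
    by move=> t _; apply: contM; [exact: cq|exact: cont_rcis].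
  rewrite (@Cint_FTC _ _ _ pi20 _ (Q \o circ c r)).
  - by rewrite /= /circ cis2pi cis0 subrr.
  - move=> t _; apply: contM; first exact: cont_cst.
    by apply: contM; [exact: cq|exact: cont_rcis].
  - move=> t _; have [d1 d2] := QP _ (circB t).
    have := pder_diff d1 (pder_circ c r t); rewrite d2.
    by rewrite -mulrA [_ * dquot _]mulrC.
have W := @winding_num (x - c) r xr.
have W' : Cint 0 (2 * pi) (fun t => h x * ((r%:C * cis t) * (circ c r t - x)^-1)) =
    h x * (2 * pi)%:C.
  rewrite CintZ; last first.
    by move=> t _; apply: contM; [exact: cont_rcis|exact: cont_circV].
  congr (_ * _); rewrite -W; apply: eq_Cint => t _; congr (_ * _^-1).
  by rewrite /circ; ring.
have p0 : (2 * pi)%:C != 0 :> C by rewrite -nrm_eq0 nrm_real normr_eq0 gt_eqF.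
apply: (mulfI p0); rewrite mulrA divff// mul1r mulrC -W'.
apply/eqP; rewrite -subr_eq0 -oppr_eq0 opprB -CintB; last 2 first.
- move=> t _; apply: contM; last exact: cont_circV.
  by apply: contM; [exact: cont_hcirc|exact: cont_rcis].
- move=> t _; apply: contM; first exact: cont_cst.
  by apply: contM; [exact: cont_rcis|exact: cont_circV].
rewrite -[X in _ == X]I0; apply/eqP/eq_Cint => t _.
rewrite /dquot -[_ == x]subr_eq0 (negbTE (circ_neq t)).
by field; rewrite circ_neq.
Qed.

Lemma cauchy_bound M :
  (forall t, 0 <= t <= 2 * pi -> nrm (h (circ c r t)) <= M) ->
  nrm (h x) <= 2 * M * (r / (r - nrm (x - c))).
Proof.
move=> hM; rewrite cauchy_formula nrmM nrmV nrm_real gtr0_norm// mulrC ler_pdivrMr//.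
have d0 : 0 < r - nrm (x - c) by rewrite subr_gt0.
have -> : 2 * M * (r / (r - nrm (x - c))) * (2 * pi) =
  2 * (2 * pi - 0) * (M * r * (r - nrm (x - c))^-1) by rewrite subr0; ring.
apply: Cint_bound.
  exact: pi20.
  move=> t _; apply: contM; last exact: cont_circV.
  by apply: contM; [exact: cont_hcirc|exact: cont_rcis].
move=> t t2; rewrite !nrmM nrmV nrm_cis mulr1 nrm_real gtr0_norm//.
have h1 := hM t t2.
have h2 : r - nrm (x - c) <= nrm (circ c r t - x).
  have -> : circ c r t - x = (circ c r t - c) - (x - c) by ring.
  by apply: le_trans (nrm_sub_ge _ _); rewrite nrm_circ// ltW.
rewrite ler_pM ?mulr_ge0 ?invr_ge0 ?nrm_ge0 ?(ltW r0)//.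
  by rewrite ler_pM2r.
by rewrite lef_pV2 ?posrE// (lt_le_trans d0).
Qed.

End formula.

End cauchy.

(** * Taylor estimates, limits and joint holomorphy *)

Section holo.
Context (R : realType).
Local Notation C := R[i].
Local Notation Re := (@complex.Re R).
Local Notation Im := (@complex.Im R).

(** Subtracting the Cauchy integrals for [h c] and the derivative from that for h (c + k) leaves h
    k^2 / (Z (Z - k)) under the integral. Only [M] and [R0] enter the bounds, which makes them
    uniform along sequences. *)
Lemma taylor2 (h : C -> C) (c : C) (R0 M : R) : 0 < R0 ->
  (forall z, nrm (z - c) < R0 -> differentiable h z) ->
  (forall z, nrm (z - c) < R0 -> nrm (h z) <= M) ->
  nrm ('d h c 1) <= 4 * M / R0 /\
  forall k, nrm k < R0 / 2 ->
    nrm (h (c + k) - h c - k * 'd h c 1) <= 16 * M / R0 ^+ 2 * nrm k ^+ 2.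
Proof.
(* Any radius strictly between R0 / 2 and R0 would do; this one keeps the circle at distance R0 / 4
   from every |k| < R0 / 2. *)
move=> R00 hd hM; pose r := 3 / 4 * R0.
have r0 : 0 < r by rewrite /r; lra.
have rR : r < R0 by rewrite /r; lra.
have pi20 : 0 < 2 * pi :> R by rewrite mulr_gt0// pi_gt0.
have M0 : 0 <= M by apply: le_trans (hM c _); rewrite ?nrm_ge0// subrr nrm0.
have Z0 t : r%:C * cis t != 0.
  by rewrite -nrm_eq0 nrmM nrm_cis mulr1 nrm_real gtr0_norm// gt_eqF.
have ZB k t : nrm k < R0 / 2 -> R0 / 4 <= nrm (r%:C * cis t - k).
  move=> kR; apply: le_trans (nrm_sub_ge _ _).
  by rewrite nrmM nrm_cis mulr1 nrm_real gtr0_norm//; move: kR; rewrite /r; lra.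
have Zk0 k t : nrm k < R0 / 2 -> r%:C * cis t - k != 0.
  by move=> kR; rewrite -nrm_gt0; apply: lt_le_trans (ZB k t kR); lra.
have hc t : {for t, continuous (fun t => h (circ c r t))} by exact: (@cont_hcirc R h c R0 r hd r0 rR t).
have Zc t : {for t, continuous (fun t => r%:C * cis t)} by exact: cont_rcis.
have hB t : nrm (h (circ c r t)) <= M by apply: hM; rewrite nrm_circ ?ltW.
pose d := (2 * pi)%:C^-1 * Cint 0 (2 * pi) (fun t => h (circ c r t) * (r%:C * cis t)^-1).
have dc t : {for t, continuous (fun t => h (circ c r t) * (r%:C * cis t)^-1)}.
  by apply: contM; [exact: hc|apply: contV; [exact: Z0|exact: Zc]].
have NZ t : nrm (r%:C * cis t) = r.
  by rewrite nrmM nrm_cis mulr1 nrm_real gtr0_norm.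
have dB : nrm d <= 4 * M / R0.
  rewrite /d nrmM nrmV nrm_real gtr0_norm// mulrC ler_pdivrMr//.
  apply: (@le_trans _ _ (2 * (2 * pi - 0) * (M / r))).
    apply: Cint_bound; [exact: pi20|by move=> t _; exact: dc|].
    by move=> t _; rewrite nrmM nrmV NZ ler_pM2r ?invr_gt0.
  have -> : 2 * (2 * pi - 0) * (M / r) = (8 / 3 * (M / R0)) * (2 * pi).
    by rewrite /r; field; rewrite gt_eqF.
  rewrite ler_pM2r// -[leRHS]mulrA ler_wpM2r ?divr_ge0 ?(ltW R00)//; lra.
have quad k : nrm k < R0 / 2 ->
    nrm (h (c + k) - h c - k * d) <= 16 * M / R0 ^+ 2 * nrm k ^+ 2.
  move=> kR.
  have kr : nrm (c + k - c) < r by rewrite [c + k]addrC addrK /r; lra.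
  have cr : nrm (c - c) < r by rewrite subrr nrm0.
  have k0R : nrm (0 : C) < R0 / 2 by rewrite nrm0; lra.
  pose f1 t := h (circ c r t) * (r%:C * cis t) * (r%:C * cis t - k)^-1.
  pose f2 t := h (circ c r t).
  pose f3 t := h (circ c r t) * (r%:C * cis t)^-1.
  have c1 t : {for t, continuous f1}.
    apply: contM; first by apply: contM; [exact: hc|exact: Zc].
    by apply: contV; [exact: Zk0|apply: contB; [exact: Zc|exact: cont_cst]].
  have E1 : h (c + k) = (2 * pi)%:C^-1 * Cint 0 (2 * pi) f1.
    rewrite (cauchy_formula hd r0 rR kr); congr (_ * _); apply: eq_Cint => t _.
    by rewrite /f1; congr (_ * _^-1); rewrite /circ; ring.
  have E2 : h c = (2 * pi)%:C^-1 * Cint 0 (2 * pi) f2.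
    rewrite (cauchy_formula hd r0 rR cr); congr (_ * _); apply: eq_Cint => t _.
    by rewrite circ_sub -mulrA mulfV ?mulr1.
  have E3 : k * d = (2 * pi)%:C^-1 * Cint 0 (2 * pi) (fun t => k * f3 t).
    by rewrite CintZ; [rewrite /d mulrCA|move=> t _; exact: dc].
  have c3 t : {for t, continuous (fun t => k * f3 t)}.
    by apply: contM; [exact: cont_cst|exact: dc].
  have c12 t : {for t, continuous (fun t => f1 t - f2 t)}.
    by apply: contB; [exact: c1|exact: hc].
  rewrite E1 E2 E3 -!mulrBr -CintB; [|by move=> t _; exact: c1|by move=> t _; exact: hc].
  rewrite -CintB; [|by move=> t _; exact: c12|by move=> t _; exact: c3].
  rewrite nrmM nrmV nrm_real gtr0_norm// mulrC ler_pdivrMr//.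
  apply: (@le_trans _ _ (2 * (2 * pi - 0) * (M * nrm k ^+ 2 / (r * (R0 / 4))))).
    apply: Cint_bound; first exact: pi20.
      by move=> t _; apply: contB; [exact: c12|exact: c3].
    move=> t _; have -> : f1 t - f2 t - k * f3 t =
        h (circ c r t) * k ^+ 2 / (r%:C * cis t * (r%:C * cis t - k)).
      rewrite /f1 /f2 /f3; move: (Z0 t) (Zk0 k t kR).
      by move: (r%:C * cis t) (h _) => z w z0 zk; field; rewrite z0 zk.
    rewrite (nrmM (h _ * _)) nrmV (nrmM (h _)) (nrmM (r%:C * cis t)) nrmX NZ; apply: ler_pM.
    - by rewrite mulr_ge0 ?exprn_ge0 ?nrm_ge0.
    - by rewrite invr_ge0 mulr_ge0 ?nrm_ge0// ltW.
    - by rewrite ler_wpM2r// exprn_ge0 ?nrm_ge0.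
    rewrite lef_pV2 ?posrE; last 2 first.
    - by rewrite mulr_gt0// nrm_gt0 Zk0.
    - by rewrite mulr_gt0// divr_gt0.
    by rewrite ler_pM2l// ZB.
  have -> : 2 * (2 * pi - 0) * (M * nrm k ^+ 2 / (r * (R0 / 4))) =
     (32 / 3 * (M / R0 ^+ 2 * nrm k ^+ 2)) * (2 * pi).
    by rewrite /r; field; rewrite gt_eqF.
  have -> : 16 * M / R0 ^+ 2 * nrm k ^+ 2 = 16 * (M / R0 ^+ 2 * nrm k ^+ 2).
    by rewrite !mulrA.
  rewrite ler_pM2r// ler_wpM2r//; last lra.
  by rewrite mulr_ge0 ?exprn_ge0 ?nrm_ge0// divr_ge0// exprn_ge0// ltW.
have R2 : 0 < R0 / 2 by lra.
have [_ dd] := diff_quadC R2 quad.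
by rewrite dd mul1r; split => // k kR; apply: quad.
Qed.

Section V.
Context (V : normedModType C).

Lemma diff_affine (a u : V) (t : C) : differentiable (fun s : C => a + s *: u) t /\
  'd (fun s : C => a + s *: u) t = (fun k => k *: u) :> (C -> V).
Proof.
apply: (@diff_quad R C V _ t _ 0 1 ltr01).
- by move=> c x y; rewrite scalerDl scalerA.
- by exists (nrm u) => [|k]; [exact: nrm_ge0|rewrite nrmZ mulrC].
- move=> k _; rewrite mul0r scalerDl addrA [_ + k *: u]addrC addrK subrr.
  by rewrite nrm0.
Qed.

Lemma diff_slice (W : normedModType C) (h : V -> W) (a u : V) (t : C) :
  differentiable h (a + t *: u) ->
  differentiable (fun s : C => h (a + s *: u)) t /\
  'd (fun s : C => h (a + s *: u)) t = (fun k => k *: 'd h (a + t *: u) u) :> (C -> W).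
Proof.
move=> hd; have [d1 d2] := diff_affine a u t.
split; first exact: (differentiable_comp d1 hd).
apply/funext => k.
have := @diff_comp _ _ _ _ (fun s : C => a + s *: u) h t d1 hd.
by move=> ->; rewrite /= d2 linearZ.
Qed.

Lemma diffZ_C (h : V -> C) (x : V) (t : C) u : 'd h x (t *: u) = t * 'd h x u.
Proof. by rewrite linearZ. Qed.

(** Restriction to the complex line through [c] in direction [u], on which the ball becomes a disc
    of radius R0 / |u|. *)
Lemma taylor2V (h : V -> C) (c : V) (R0 M : R) : 0 < R0 ->
  (forall z, nrm (z - c) < R0 -> differentiable h z) ->
  (forall z, nrm (z - c) < R0 -> nrm (h z) <= M) ->
  forall u, nrm ('d h c u) <= 4 * M / R0 * nrm u /\
  (nrm u < R0 / 2 ->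
    nrm (h (c + u) - h c - 'd h c u) <= 16 * M / R0 ^+ 2 * nrm u ^+ 2).
Proof.
move=> R00 hd hM u.
have [->|u0] := eqVneq u 0.
  by rewrite linear0 addr0 subrr subr0 !nrm0 expr0n/= !mulr0.
have nu : 0 < nrm u by rewrite nrm_gt0.
pose g (s : C) := h (c + s *: u).
have R1 : 0 < R0 / nrm u by rewrite divr_gt0.
have inB (s : C) : nrm (s - 0) < R0 / nrm u -> nrm (c + s *: u - c) < R0.
  by rewrite subr0 addrAC subrr add0r nrmZ ltr_pdivlMr.
have gd (s : C) : nrm (s - 0) < R0 / nrm u -> differentiable g s.
  by move=> /inB/hd/diff_slice[].
have gM (s : C) : nrm (s - 0) < R0 / nrm u -> nrm (g s) <= M.
  by move=> /inB/hM.
have [T1 T2] := taylor2 R1 gd gM.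
have g0 : 'd g 0 1 = 'd h c u.
  have [|_ ->] := @diff_slice C h c u 0.
    by rewrite scale0r addr0; apply: hd; rewrite subrr nrm0.
  by rewrite scale1r scale0r addr0.
rewrite g0 in T1 T2; split.
  by apply: (le_trans T1); rewrite invf_div mulrA mulrAC.
move=> uR; have := T2 1; rewrite nrm1 => /(_ _)/wrap[].
  by rewrite mulrAC ltr_pdivlMr// mul1r.
rewrite mul1r add0r /g scale0r addr0 scale1r => /le_trans; apply.
by rewrite expr1n mulr1 expr_div_n invf_div mulrA mulrAC.
Qed.

(** 12 = 4 + 8: the differential contributes 4 M / R0, and the quadratic remainder at most 8 M / R0
    because |u| < R0 / 2. *)
Lemma lipschitzV (h : V -> C) (c : V) (R0 M : R) : 0 < R0 ->
  (forall z, nrm (z - c) < R0 -> differentiable h z) ->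
  (forall z, nrm (z - c) < R0 -> nrm (h z) <= M) ->
  forall u, nrm u < R0 / 2 -> nrm (h (c + u) - h c) <= 12 * M / R0 * nrm u.
Proof.
move=> R00 hd hM u uR; have [T1 /(_ uR) T2] := taylor2V R00 hd hM u.
have M0 : 0 <= M by apply: le_trans (hM c _); rewrite ?nrm_ge0// subrr nrm0.
have := nrmD (h (c + u) - h c - 'd h c u) ('d h c u); rewrite subrK => /le_trans; apply.
rewrite (le_trans (lerD T2 T1))//.
have H : 16 * M / R0 ^+ 2 * nrm u ^+ 2 <= 8 * M / R0 * nrm u.
  have -> : 16 * M / R0 ^+ 2 * nrm u ^+ 2 = 16 * M / R0 * nrm u * (nrm u / R0).
    by field; rewrite gt_eqF.
  have -> : 8 * M / R0 * nrm u = 16 * M / R0 * nrm u * 2^-1 by field; rewrite gt_eqF.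
  rewrite ler_wpM2l//; first by rewrite !mulr_ge0 ?nrm_ge0// invr_ge0 ltW.
  by rewrite ler_pdivrMr// mulrC; exact: ltW.
rewrite (le_trans (lerD H (lexx _)))// -mulrDl -mulrDl -mulrDl.
by rewrite le_eqVlt; apply/orP; left; apply/eqP; congr (_ * _ * _ * _); ring.
Qed.

End V.

Definition seqto (x : nat -> C) (l : C) :=
  forall e : R, 0 < e -> exists N, forall n, (N <= n)%N -> nrm (x n - l) < e.

Lemma seqto_le (x y : nat -> C) (l : C) (A : R) : seqto x l ->
  (exists N, forall n, (N <= n)%N -> nrm (x n) <= A) -> nrm l <= A.
Proof.
move=> xl [N0 xA]; apply/ler_addgt0Pr => e e0; have [N NP] := xl e e0.
have := NP _ (leq_maxl N N0); have := xA _ (leq_maxr N N0) => h1 h2.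
have := nrm_sub_ge l (x (maxn N N0)); rewrite nrmBC lerBlDr => /le_trans; apply.
by rewrite addrC lerD// ltW.
Qed.

Lemma seqtoD x y l m : seqto x l -> seqto y m -> seqto (fun n => x n + y n) (l + m).
Proof.
move=> xl ym e e0; have e2 : 0 < e / 2 by rewrite divr_gt0.
have [N1 P1] := xl _ e2; have [N2 P2] := ym _ e2.
exists (maxn N1 N2) => n; rewrite geq_max => /andP[/P1 h1 /P2 h2].
by rewrite opprD addrACA (le_lt_trans (nrmD _ _))// [e]splitr ltrD.
Qed.

Lemma seqtoZ (c : C) x l : seqto x l -> seqto (fun n => c * x n) (c * l).
Proof.
move=> xl e e0; have c0 : 0 < nrm c + 1 by rewrite ltr_wpDl ?nrm_ge0.
have [N P] := xl (e / (nrm c + 1)) (divr_gt0 e0 c0).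
exists N => n /P; rewrite ltr_pdivlMr// => H; rewrite -mulrBr nrmM mulrC.
by rewrite (le_lt_trans _ H)// ler_wpM2l ?nrm_ge0// lerDl.
Qed.

Lemma seqto_cst (c : C) : seqto (fun=> c) c.
Proof. by move=> e e0; exists 0%N => n _; rewrite subrr nrm0. Qed.

Lemma seqto_unique x l m : seqto x l -> seqto x m -> l = m.
Proof.
move=> xl xm; apply/eqP; rewrite -subr_eq0 -nrm_le0.
have := seqtoD xl (seqtoZ (-1) xm); rewrite mulN1r => H.
apply: (seqto_le (fun=> 0) H); exists 0%N => n _.
by rewrite mulN1r subrr nrm0.
Qed.

Lemma cauchyC (x : nat -> C) :
  (forall e : R, 0 < e -> exists N, forall m n, (N <= m)%N -> (N <= n)%N ->
     nrm (x m - x n) < e) -> exists l, seqto x l.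
Proof.
move=> xc.
have H (f : nat -> R) : (forall m n, `|f m - f n| <= nrm (x m - x n)) ->
    exists l, forall e, 0 < e -> exists N, forall n, (N <= n)%N -> `|f n - l| < e.
  move=> fx.
  have /cauchy_cvgP/cvg_ex[l /cvgrPdist_lt fl] : cauchy (f @ \oo).
    apply: cauchy_exP => e e0; have [N NP] := xc e e0.
    exists (f N), N => // n /= Nn; rewrite -ball_normE/=.
    by rewrite (le_lt_trans (fx N n))// NP.
  exists l => e /fl[N _ NP]; exists N => n /NP; by rewrite /= distrC.
have [|l1 P1] := H (Re \o x); first by move=> m n; rewrite /= -raddfB Re_le_nrm.
have [|l2 P2] := H (Im \o x); first by move=> m n; rewrite /= -raddfB Im_le_nrm.
exists (l1 +i* l2) => e e0; have e2 : 0 < e / 2 by rewrite divr_gt0.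
have [N1 h1] := P1 _ e2; have [N2 h2] := P2 _ e2.
exists (maxn N1 N2) => n; rewrite geq_max => /andP[/h1 k1 /h2 k2].
rewrite (le_lt_trans (nrm_le_ReIm _))// !raddfB/= [e]splitr.
by rewrite ltrD.
Qed.

Section limits.
Context (V : normedModType C).

(** Pointwise convergence is enough under a common bound: D n u differs from the difference quotient
    of step t by O(t), uniformly in n, so the differentials form a Cauchy sequence and the Taylor
    estimate passes to the limit. *)
Lemma holo_lim (hn : nat -> V -> C) (h : V -> C) (x : V) (r M : R) : 0 < r ->
  (forall n y, nrm (y - x) < r -> differentiable (hn n) y /\ nrm (hn n y) <= M) ->
  (forall y, nrm (y - x) < r -> seqto (fun n => hn n y) (h y)) ->
  differentiable h x.
Proof.
move=> r0 hnP hnh.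
have T n u := @taylor2V V (hn n) x r M r0 (fun y yx => (hnP n y yx).1)
  (fun y yx => (hnP n y yx).2) u.
have [D DE] : exists D : nat -> V -> C, forall n, 'd (hn n) x = D n :> (V -> C).
  by exists (fun n v => 'd (hn n) x v).
have DZ n t u : D n (t *: u) = t * D n u by rewrite -!DE diffZ_C.
have Dlin n : linear (D n) by rewrite -DE; exact: linearP.
have {}T n u : nrm (D n u) <= 4 * M / r * nrm u /\
  (nrm u < r / 2 ->
    nrm (hn n (x + u) - hn n x - D n u) <= 16 * M / r ^+ 2 * nrm u ^+ 2).
  by rewrite -DE.
have xx : nrm (x - x) < r by rewrite subrr nrm0.
have M0 : 0 <= M by apply: le_trans (hnP 0%N x xx).2; exact: nrm_ge0.
have Lex u : exists l, seqto (fun n => D n u) l.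
  apply: cauchyC => e e0.
  pose A := 16 * M / r ^+ 2 * nrm u ^+ 2.
  have A0 : 0 <= A.
    by rewrite !mulr_ge0 ?exprn_ge0 ?nrm_ge0// invr_ge0 exprn_ge0// ltW.
  have U0 : 0 < nrm u + 1 by rewrite ltr_wpDl ?nrm_ge0.
  (* This step makes each of the two Taylor errors at most t e / 4; the four function values are
     then taken within t e / 8 of their limits. *)
  have [t [t0 tu tA]] : exists t : R,
      [/\ 0 < t, nrm (t%:C *: u) < r / 2 & t * (A + 1) <= e / 4].
    exists (Num.min (r / 2 / (nrm u + 1) / 2) (e / 4 / (A + 1))).
    have t0 : 0 < Num.min (r / 2 / (nrm u + 1) / 2) (e / 4 / (A + 1)).
      by rewrite lt_min !divr_gt0// ltr_wpDl.
    split => //; last by rewrite -ler_pdivlMr ?ltr_wpDl// ge_min lexx orbT.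
    rewrite nrmZ nrm_real gtr0_norm//; move: t0.
    set t := Num.min _ _ => t0.
    apply: (@le_lt_trans _ _ (t * (nrm u + 1))).
      by rewrite ler_pM2l// lerDl.
    rewrite -ltr_pdivlMr// gt_min; apply/orP; left.
    by rewrite ltr_pdivrMr// ltr_pMr ?ltr1n// divr_gt0// divr_gt0.
  have xtu : nrm (x + t%:C *: u - x) < r.
    by rewrite addrAC subrr add0r (lt_trans tu)// ltr_pdivrMr// ltr_pMr// ltr1n.
  have te : 0 < t * e / 8 by rewrite !mulr_gt0.
  have [N1 P1] := hnh _ xtu _ te; have [N2 P2] := hnh _ xx _ te.
  exists (maxn N1 N2) => m n; rewrite !geq_max => /andP[m1 m2] /andP[n1 n2].
  have Am k : nrm (hn k (x + t%:C *: u) - hn k x - D k (t%:C *: u)) <= t * (e / 4).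
    have [_ /(_ tu) H] := T k (t%:C *: u); apply: (le_trans H).
    rewrite nrmZ nrm_real gtr0_norm// exprMn mulrCA -/A expr2 -mulrA ler_pM2l//.
    by apply: le_trans tA; rewrite ler_pM2l// lerDl.
  have : t * nrm (D m u - D n u) < t * e.
    have -> : t * nrm (D m u - D n u) = nrm (D m (t%:C *: u) - D n (t%:C *: u)).
      by rewrite !DZ -mulrBr nrmM nrm_real gtr0_norm.
    have h1 := Am m; have h2 := Am n.
    have h3 := P1 _ m1; have h4 := P1 _ n1; have h5 := P2 _ m2; have h6 := P2 _ n2.
    have -> : D m (t%:C *: u) - D n (t%:C *: u) =
      - (hn m (x + t%:C *: u) - hn m x - D m (t%:C *: u)) +
      (hn n (x + t%:C *: u) - hn n x - D n (t%:C *: u)) +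
      (((hn m (x + t%:C *: u) - h (x + t%:C *: u)) -
       (hn n (x + t%:C *: u) - h (x + t%:C *: u))) +
      ((hn n x - h x) - (hn m x - h x))) by ring.
    apply: (le_lt_trans (nrmD _ _)).
    apply: (le_lt_trans (lerD (nrmD _ _) (nrmD _ _))); rewrite nrmN.
    apply: (le_lt_trans (lerD (lexx _) (lerD (nrmB _ _) (nrmB _ _)))).
    apply: (le_lt_trans (lerD (lerD h1 h2) (lexx _))).
    have -> : t * e = t * (e / 4) + t * (e / 4) + ((t * e / 8 + t * e / 8) + (t * e / 8 + t * e / 8)) by field.
    by rewrite ltrD2l !ltrD.
  by rewrite ltr_pM2l.
have [L LP] := choice Lex.
have L1 : linear L.
  move=> a u v; apply: (seqto_unique (LP _)).
  have := seqtoD (seqtoZ a (LP u)) (LP v).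
  by congr seqto; apply/funext => n; rewrite Dlin.
have bL : exists2 b : R, 0 <= b & forall u, nrm (L u) <= b * nrm u.
  exists (4 * M / r); first by rewrite !mulr_ge0// invr_ge0 ltW.
  move=> u; apply: (seqto_le (fun=> 0) (LP u)); exists 0%N => n _.
  exact: (T n u).1.
have r2 : 0 < r / 2 by rewrite divr_gt0.
have [|d1 d2] := @diff_quad R V C h x L (16 * M / r ^+ 2) (r / 2) r2 L1 bL.
  move=> u ur.
  have xu : nrm (x + u - x) < r.
    by rewrite addrAC subrr add0r (lt_trans ur)// ltr_pdivrMr// ltr_pMr// ltr1n.
  have S := seqtoD (seqtoD (hnh _ xu) (seqtoZ (-1) (hnh _ xx))) (seqtoZ (-1) (LP u)).
  rewrite !mulN1r in S; apply: (seqto_le (fun=> 0) S); exists 0%N => n _.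
  by rewrite !mulN1r; exact: (T n u).2.
exact: d1.
Qed.

(** The directional derivative is the pointwise limit of the difference quotients [fn], which are
    holomorphic and bounded by the Lipschitz estimate. *)
Lemma holo_dir (h : V -> C) (x u : V) (r M : R) : 0 < r ->
  (forall y, nrm (y - x) < r -> differentiable h y) ->
  (forall y, nrm (y - x) < r -> nrm (h y) <= M) ->
  differentiable (fun y => 'd h y u) x.
Proof.
move=> r0 hd hM; have r4 : 0 < r / 4 by rewrite divr_gt0.
have xx : nrm (x - x) < r by rewrite subrr nrm0.
have M0 : 0 <= M by apply: le_trans (hM _ xx); exact: nrm_ge0.
have sub y v : nrm (y - x) < r / 4 -> nrm (v - y) < r / 2 -> nrm (v - x) < r.
  move=> yx vy; rewrite (le_lt_trans (nrm_tri _ _ y))// addrC.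
  by rewrite (lt_trans (ltrD yx vy))//; lra.
(* Shifting the index by [N0] keeps all steps [v n], from the first on, shorter than r / 4. *)
pose N0 := Num.bound (nrm u / (r / 4)).
have N0P : nrm u / (r / 4) < N0%:R.
  by apply: archi_boundP; rewrite divr_ge0 ?nrm_ge0// ltW.
pose s n : R := ((n + N0).+1)%:R.
have s0 n : 0 < s n by rewrite ltr0n.
pose v n := (s n)^-1%:C *: u.
have vE n : nrm (v n) = nrm u / s n.
  by rewrite nrmZ nrm_real gtr0_norm ?invr_gt0// mulrC.
have vr n : nrm (v n) < r / 4.
  rewrite vE ltr_pdivrMr// mulrC -ltr_pdivrMr// (lt_le_trans N0P)// ler_nat.
  by rewrite -addnS -addSnnS leq_addl.
pose fn n y := (s n)%:C * (h (y + v n) - h y).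
have r2 : 0 < r / 2 by rewrite divr_gt0.
have T y (yx : nrm (y - x) < r / 4) := @taylor2V V h y (r / 2) M r2
  (fun z zy => hd z (sub y z yx zy)) (fun z zy => hM z (sub y z yx zy)).
have Lp y (yx : nrm (y - x) < r / 4) := @lipschitzV V h y (r / 2) M r2
  (fun z zy => hd z (sub y z yx zy)) (fun z zy => hM z (sub y z yx zy)).
have vr' n : nrm (v n) < r / 2 / 2 by rewrite (lt_le_trans (vr n))//; lra.
apply: (@holo_lim fn _ x (r / 4) (12 * M / (r / 2) * nrm u) r4 _ _).
- move=> n y yx; split.
    have d1 : differentiable h y by apply: hd; rewrite (lt_trans yx)//; lra.
    have d2 : differentiable h (y + v n).
      apply: hd; apply: (sub y) => //.
      by rewrite addrAC subrr add0r (lt_trans (vr n))//; lra.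
    apply: differentiableM; first exact: differentiable_cst.
    apply: differentiableB => //.
    by apply: (@differentiable_comp _ _ _ _ (fun y => y + v n) h).
  rewrite /fn nrmM nrm_real gtr0_norm// mulrC -ler_pdivlMr//.
  by rewrite (le_trans (Lp y yx _ (vr' n)))// vE !mulrA.
- move=> y yx e e0.
  pose A := 16 * M / (r / 2) ^+ 2 * nrm u ^+ 2.
  exists (Num.bound (`|A| / e)) => n nN.
  have nE : `|A| / e < s n.
    apply: (lt_le_trans (archi_boundP _)); first by rewrite divr_ge0// ltW.
    by rewrite ler_nat (leq_trans nN)// -addnS leq_addr.
  have H := (T y yx (v n)).2 (vr' n).
  have -> : fn n y - 'd h y u = (s n)%:C * (h (y + v n) - h y - 'd h y (v n)).
    rewrite /fn [RHS]mulrBr.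
    have -> : (s n)%:C * 'd h y (v n) = 'd h y u.
      by rewrite diffZ_C mulrA -rmorphM/= divff ?gt_eqF// mul1r.
    by [].
  rewrite nrmM nrm_real gtr0_norm//.
  apply: (@le_lt_trans _ _ (s n * (A * (s n)^-1 ^+ 2))).
    by rewrite ler_pM2l// (le_trans H)// vE [(_ / s n) ^+ 2]exprMn [leLHS]mulrA.
  have -> : s n * (A * (s n)^-1 ^+ 2) = A / s n by field; rewrite gt_eqF.
  rewrite ltr_pdivrMr// (le_lt_trans (ler_norm _))// mulrC -ltr_pdivrMr//.
Qed.

End limits.

(** Osgood's lemma. The increment is the sum of the two partial increments and a mixed second
    difference; two applications of the Lipschitz estimate bound the latter by a multiple of |u|
    |v|. *)
Lemma holo_joint (V W : normedModType C) (F : V -> W -> C) (a : V) (b : W) (r M : R) :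
  0 < r ->
  (forall x y, nrm (x - a) < r -> nrm (y - b) < r ->
     [/\ differentiable (F ^~ y) x, differentiable (F x) y & nrm (F x y) <= M]) ->
  differentiable (fun p : V * W => F p.1 p.2) (a, b).
Proof.
move=> r0 FP.
have aa : nrm (a - a) < r by rewrite subrr nrm0.
have bb : nrm (b - b) < r by rewrite subrr nrm0.
have [da db FM] := FP a b aa bb.
have M0 : 0 <= M by apply: le_trans FM; exact: nrm_ge0.
have [la [ca ca0 caP] _] := diff_Dif da; have [lb [cb cb0 cbP] _] := diff_Dif db.
set L1 := 'd (F ^~ b) a in la caP; set L2 := 'd (F a) b in lb cbP.
have r2 : 0 < r / 2 by rewrite divr_gt0.
have n1 (p : V * W) : nrm p.1 <= nrm p.
  by rewrite [in leRHS](surjective_pairing p) nrm_pair le_max lexx.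
have n2 (p : V * W) : nrm p.2 <= nrm p.
  by rewrite [in leRHS](surjective_pairing p) nrm_pair le_max lexx orbT.
pose K := 16 * M / r ^+ 2 + 16 * M / r ^+ 2 + 12 * (12 * M / r) / r.
suff [] : differentiable (fun p : V * W => F p.1 p.2) (a, b) /\
  'd (fun p : V * W => F p.1 p.2) (a, b) = (fun p => L1 p.1 + L2 p.2) :> (V * W -> C).
  by [].
apply: (@diff_quad R (V * W)%type C (fun p => F p.1 p.2) (a, b)
  (fun p => L1 p.1 + L2 p.2) K (r / 2) r2).
- move=> c u v /=; rewrite la lb -[c *: (_ + _)]/(c * (_ + _)) mulrDr.
  by rewrite addrACA.
- exists (ca + cb); first by rewrite addr_ge0.
  move=> p; rewrite (le_trans (nrmD _ _))// mulrDl lerD//.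
    by rewrite (le_trans (caP _))// ler_wpM2l.
  by rewrite (le_trans (cbP _))// ler_wpM2l.
move=> [u v] uv /=.
have ur : nrm u < r / 2 by rewrite (le_lt_trans _ uv)// (n1 (u, v)).
have vr : nrm v < r / 2 by rewrite (le_lt_trans _ uv)// (n2 (u, v)).
have rr : r / 2 < r by lra.
have au : nrm (a + u - a) < r by rewrite addrAC subrr add0r (lt_trans ur).
have T1 := (@taylor2V V (F ^~ b) a r M r0
  (fun x xa => let: And3 h _ _ := FP x b xa bb in h)
  (fun x xa => let: And3 _ _ h := FP x b xa bb in h) u).2 ur.
have T2 := (@taylor2V W (F a) b r M r0
  (fun y yb => let: And3 _ h _ := FP a y aa yb in h)
  (fun y yb => let: And3 _ _ h := FP a y aa yb in h) v).2 vr.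
have T3 : nrm ((F (a + u) (b + v) - F a (b + v)) - (F (a + u) b - F a b)) <=
    12 * (12 * M / r * nrm u) / r * nrm v.
  apply: (@lipschitzV W (fun y => F (a + u) y - F a y) b r _ r0) => // y yb.
    have [_ d1 _] := FP _ _ au yb; have [_ d2 _] := FP _ _ aa yb.
    exact: differentiableB.
  apply: (@lipschitzV V (F ^~ y) a r M r0) => // x xa.
    by have [] := FP _ _ xa yb.
  by have [] := FP _ _ xa yb.
have -> : F (a + u) (b + v) - F a b - (L1 u + L2 v) =
  (F (a + u) b - F a b - L1 u) + (F a (b + v) - F a b - L2 v) +
  ((F (a + u) (b + v) - F a (b + v)) - (F (a + u) b - F a b)) by ring.
rewrite (le_trans (nrmD _ _))// (le_trans (lerD (nrmD _ _) (lexx _)))//.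
rewrite (le_trans (lerD (lerD T1 T2) T3))// /K [leRHS]mulrDl [X in _ <= X + _]mulrDl.
have X0 : 0 <= 16 * M / r ^+ 2 by rewrite !mulr_ge0// invr_ge0 exprn_ge0// ltW.
have p0 := nrm_ge0 ((u, v) : V * W).
apply: lerD; first apply: lerD.
- by rewrite ler_wpM2l// ler_sqr ?nnegrE ?nrm_ge0//; exact: (n1 (u, v)).
- by rewrite ler_wpM2l// ler_sqr ?nnegrE ?nrm_ge0//; exact: (n2 (u, v)).
have -> : 12 * (12 * M / r * nrm u) / r * nrm v =
  12 * (12 * M / r) / r * (nrm u * nrm v) by ring.
rewrite ler_wpM2l//.
  by rewrite !mulr_ge0// invr_ge0 ltW.
by rewrite expr2 ler_pM ?nrm_ge0//; [exact: (n1 (u, v))|exact: (n2 (u, v))].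
Qed.

End holo.

(** * Identity theorem and polarization *)

Section identity.
Context (R : realType).
Local Notation C := R[i].
Local Notation Re := (@complex.Re R).
Local Notation Im := (@complex.Im R).

Lemma diff_locbound (V : normedModType C) (h : V -> C) (x : V) :
  differentiable h x -> exists2 r : R, 0 < r & forall y, nrm (y - x) < r ->
    nrm (h y) <= nrm (h x) + 1.
Proof.
move=> /diff_Dif/Dif_continuous/(_ 1 ltr01)[d d0 dP]; exists d => // y /dP H.
have := nrm_sub_ge (h y) (h x); rewrite lerBlDr => /le_trans; apply.
by rewrite addrC lerD2l ltW.
Qed.

Lemma holo_dir_open (V : normedModType C) (D : set V) (h : V -> C) (u : V) :
  open D -> (forall x, D x -> differentiable h x) ->
  forall x, D x -> differentiable (fun y => 'd h y u) x.
Proof.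
move=> oD hd x Dx; have [r1 r10 r1P] := open_nrm oD Dx.
have [r2 r20 r2P] := diff_locbound (hd _ Dx).
have r0 : 0 < Num.min r1 r2 by rewrite lt_min r10.
apply: (@holo_dir R V h x u (Num.min r1 r2) (nrm (h x) + 1) r0) => y;
  rewrite lt_min => /andP[y1 y2]; [exact/hd/r1P|exact: r2P].
Qed.

(** Removable singularity: the quotient has a primitive, and the derivative of a holomorphic
    function is holomorphic. *)
Lemma dquot_holo (h : C -> C) (c : C) (R0 : R) : 0 < R0 ->
  (forall z, nrm (z - c) < R0 -> differentiable h z) ->
  forall z, nrm (z - c) < R0 -> differentiable (dquot h c) z.
Proof.
move=> R00 hd z zB.
have cr : nrm (c - c) < R0 by rewrite subrr nrm0.
have [zc|zc] := eqVneq z c; last exact: (@dquot_diff R h c c R0 hd z zB zc).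
have cr2 : nrm (c - c) < R0 / 2 by rewrite subrr nrm0 divr_gt0.
have r2R : R0 / 2 < R0 by rewrite ltr_pdivrMr// ltr_pMr// ltr1n.
have qc y (yB : nrm (y - c) < R0) : {for y, continuous (dquot h c)}.
  exact: (@dquot_cont R h c c R0 (R0 / 2) hd r2R cr2 y yB).
have [Q QP] := prim_ball cr qc (@dquot_diff R h c c R0 hd).
have := @holo_dir_open C [set y | nrm (y - c) < R0] Q 1 (open_ball_nrm c R0)
  (fun x xB => (QP x xB).1) c cr.
rewrite zc => H; apply: (diff_ext R00 _ H).1 => y yB.
by rewrite (QP y yB).2 mul1r.
Qed.

(** Zeros accumulating at [c] allow division by z - c any number of times; the Cauchy bound on the
    circle of radius r then gives |h x| = O((|x - c| / r)^N) for every N. No power series are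
    involved. *)
Lemma identity1 (h : C -> C) (c : C) (R0 : R) : 0 < R0 ->
  (forall z, nrm (z - c) < R0 -> differentiable h z) ->
  (forall e : R, 0 < e -> exists z, [/\ z != c, nrm (z - c) < e & h z = 0]) ->
  forall z, nrm (z - c) < R0 / 2 -> h z = 0.
Proof.
move=> R00 hd h0 x xB.
have cr : nrm (c - c) < R0 by rewrite subrr nrm0.
have fac N : exists q : C -> C, (forall z, nrm (z - c) < R0 -> differentiable q z) /\
    forall z, nrm (z - c) < R0 -> h z = (z - c) ^+ N * q z.
  elim: N => [|N [q [qd hq]]]; first by exists h; split => // z _; rewrite expr0 mul1r.
  have qc : q c = 0.
    apply/eqP/negPn/negP => qc0.
    have qcn : 0 < nrm (q c) by rewrite nrm_gt0.
    have [d d0 dP] := Dif_continuous (diff_Dif (qd c cr)) qcn.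
    have [|z [zc]] := h0 (Num.min d R0); first by rewrite lt_min d0.
    rewrite lt_min => /andP[zd zR] hz0.
    have := dP _ zd; have /eqP := hq _ zR; rewrite hz0 eq_sym mulf_eq0 expf_eq0.
    by rewrite subr_eq0 (negbTE zc) andbF/= => /eqP ->; rewrite sub0r nrmN ltxx.
  exists (dquot q c); split; first exact: dquot_holo.
  move=> z zB; rewrite hq// exprSr -mulrA; congr (_ * _).
  rewrite /dquot; case: eqVneq => [->|zc]; first by rewrite subrr mul0r.
  by rewrite qc subr0 mulrC divfK// subr_eq0.
pose r := 3 / 4 * R0.
have r0 : 0 < r by rewrite /r; lra.
have rR : r < R0 by rewrite /r; lra.
have xr : nrm (x - c) < r by rewrite /r; lra.
have [M hM] : exists M, forall t, 0 <= t <= 2 * pi -> nrm (h (circ c r t)) <= M.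
  have [||t0 _ t0P] := @EVT_max R (fun t => nrm (h (circ c r t))) 0 (2 * pi).
  - by rewrite mulr_ge0// pi_ge0.
  - apply: cont_on_within => t _; apply/cont_rnrmP => e e0.
    have /cont_nrmP/(_ e e0) := @cont_hcirc R h c R0 r hd r0 rR t.
    apply: filterS => s; apply: le_lt_trans.
    rewrite ler_norml nrm_sub_ge andbT -(opprB (nrm (h (circ c r t)))) lerN2.
    by rewrite nrmBC nrm_sub_ge.
  - by exists (nrm (h (circ c r t0))) => t t01; apply: t0P; rewrite in_itv.
apply/eqP; rewrite -nrm_le0; apply/ler_addgt0Pr => e e0; rewrite add0r.
have rho : 0 <= nrm (x - c) / r < 1.
  by rewrite divr_ge0 ?nrm_ge0 ?(ltW r0)//= ltr_pdivrMr// mul1r.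
have [N NP] := small_geo (2 * M * (r / (r - nrm (x - c)))) rho e0.
have [q [qd hq]] := fac N.
have qM t : 0 <= t <= 2 * pi -> nrm (q (circ c r t)) <= M / r ^+ N.
  move=> /hM; have zr : nrm (circ c r t - c) = r by rewrite nrm_circ// ltW.
  rewrite hq ?zr// ler_pdivlMr ?exprn_gt0// nrmM nrmX zr mulrC.
  by [].
have := cauchy_bound qd r0 rR xr qM => qx.
apply: le_trans (ltW NP); rewrite hq; last by rewrite (lt_trans xr).
rewrite nrmM nrmX (le_trans (ler_wpM2l _ qx)) ?exprn_ge0 ?nrm_ge0//.
rewrite expr_div_n le_eqVlt; apply/orP; left; apply/eqP.
by ring.
Qed.

(** The points having a whole ball of zeros form an open set. It is relatively closed in [D]: near a
    limit point, each [x] is joined by a complex line to a point of the set. *)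
Lemma identity_open (V : normedModType C) (D : set V) (h : V -> C) (a : V) (r : R) :
  open D -> connected D -> (forall x, D x -> differentiable h x) ->
  D a -> 0 < r -> (forall x, nrm (x - a) < r -> h x = 0) ->
  forall x, D x -> h x = 0.
Proof.
move=> oD cD hd Da r0 h0.
pose Z := [set x | D x /\ exists2 e : R, 0 < e & forall y, nrm (y - x) < e -> h y = 0].
suff ZD : Z = D by move=> x; rewrite -ZD => -[_ [e e0]]; apply; rewrite subrr nrm0.
have Zopen : open Z.
  rewrite openE => x [Dx [e e0 eP]].
  have [e1 e10 e1P] := open_nrm oD Dx.
  apply/nbhs_nrm; exists (Num.min e1 (e / 2)); first by rewrite lt_min e10 divr_gt0.
  move=> y; rewrite lt_min => /andP[y1 y2]; split; first exact: e1P.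
  exists (e / 2); first by rewrite divr_gt0.
  move=> z zy; apply: eP; rewrite (le_lt_trans (nrm_tri _ _ y))//.
  by rewrite [e]splitr ltrD.
apply: cD.
- by exists a; split => //; exists r.
- by exists Z => //; rewrite setIC; apply/esym/setIidl => x [].
exists (closure Z); first exact: closed_closure.
apply/seteqP; split; first by move=> x Zx; split; [case: Zx|exact: subset_closure].
move=> p [Dp Zp]; split => //.
have [r1 r10 r1P] := open_nrm oD Dp.
pose s := r1; have s0 : 0 < s := r10.
have sd y : nrm (y - p) < s -> differentiable h y by move=> /r1P/hd.
have s8 : 0 < s / 8 by rewrite divr_gt0.
have [|q [[Dq [e e0 eP]] qp]] := Zp [set y | nrm (y - p) < s / 8].
  by apply/nbhs_nrm; exists (s / 8).
exists (s / 8) => // x xp.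
have [xq|xq] := eqVneq x q; first by apply: eP; rewrite xq subrr nrm0.
(* The line stays in the ball about [p] for |t| < 3, so that t = 1 falls in the half-radius disc of
   [identity1]. *)
pose g (t : C) := h (q + t *: (x - q)).
have nxq : 0 < nrm (x - q) by rewrite nrm_gt0 subr_eq0.
have xqs : nrm (x - q) < s / 4.
  rewrite (le_lt_trans (nrm_tri _ _ p))// (nrmBC p) (lt_le_trans (ltrD xp qp))//; lra.
have gB (t : C) : nrm (t - 0) < 3 -> nrm (q + t *: (x - q) - p) < s.
  rewrite subr0 => t3.
  have -> : q + t *: (x - q) - p = (q - p) + t *: (x - q) by rewrite addrAC.
  rewrite (le_lt_trans (nrmD _ _))// nrmZ.
  have : nrm t * nrm (x - q) < 3 * nrm (x - q) by rewrite ltr_pM2r.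
  have qp' : nrm (q - p) < s / 8 := qp.
  by move: xqs qp' s8; lra.
have : g 1 = 0.
  apply: (@identity1 g 0 3) => //.
  - by move=> t /gB/sd/diff_slice[].
  - move=> d d0.
    pose t := Num.min (d / 2) (e / 2 / nrm (x - q)).
    have t0 : 0 < t by rewrite lt_min !divr_gt0.
    exists t%:C; split.
    + by rewrite -nrm_gt0 nrm_real gtr0_norm.
    + rewrite subr0 nrm_real gtr0_norm// gt_min; apply/orP; left.
      by rewrite ltr_pdivrMr// ltr_pMr// ltr1n.
    + apply: eP; rewrite addrAC subrr add0r nrmZ nrm_real gtr0_norm//.
      rewrite -ltr_pdivlMr// gt_min; apply/orP; right.
      by rewrite ltr_pM2r ?invr_gt0// ltr_pdivrMr// ltr_pMr// ltr1n.
  - by rewrite subr0 nrm1; lra.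
by rewrite /g scale1r addrC subrK.
Qed.

Section conj.
Variable n : nat.
Local Notation V := 'rV[C]_n.

Definition cj (v : V) : V := map_mx (@conjc R) v.

Lemma cjK : involutive cj.
Proof. by move=> v; apply/rowP => i; rewrite !mxE conjcK. Qed.

Lemma cjD u v : cj (u + v) = cj u + cj v.
Proof. by apply/rowP => i; rewrite !mxE rmorphD. Qed.

Lemma cjB u v : cj (u - v) = cj u - cj v.
Proof. by apply/rowP => i; rewrite !mxE rmorphB. Qed.

Lemma cjZ (a : C) u : cj (a *: u) = conjc a *: cj u.
Proof. by apply/rowP => i; rewrite !mxE rmorphM. Qed.

Lemma nrm_coord (v : V) (i : 'I_n) : nrm (v 0 i) <= nrm v.
Proof.
apply/ler_addgt0Pr => e e0; apply/ltW.
have : ball (0 : V) (nrm v + e)%:C v.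
  by rewrite -ball_normE/= sub0r normrN nrmE ltcR ltrDl.
by case=> _ /(_ 0 i); rewrite -ball_normE/= mxE sub0r normrN nrmE ltcR.
Qed.

Lemma nrm_lt_coord (v : V) (e : R) : 0 < e -> (forall i, nrm (v 0 i) < e) -> nrm v < e.
Proof.
move=> e0 ve; have : ball (0 : V) e%:C v.
  split; first by rewrite ltcR.
  move=> i j; rewrite -ball_normE/= mxE sub0r normrN nrmE ltcR ord1; exact: ve.
by rewrite -ball_normE/= sub0r normrN nrmE ltcR.
Qed.

Lemma nrm_cj (v : V) : nrm (cj v) = nrm v.
Proof.
have H u : nrm (cj u) <= nrm u.
  apply/ler_addgt0Pr => e e0; apply/ltW/nrm_lt_coord.
    by rewrite (lt_le_trans e0)// lerDr nrm_ge0.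
  by move=> i; rewrite mxE nrm_conj (le_lt_trans (nrm_coord _ _))// ltrDl.
by apply/eqP; rewrite eq_le H -{1}(cjK v) H.
Qed.

Lemma halfD (u w : V) : (2^-1 : C) *: (u + w) + (2^-1 : C) *: (u - w) = u.
Proof.
by rewrite -scalerDr addrACA subrr addr0 -mulr2n -[u *+ 2]scaler_nat scalerA mulVf ?scale1r.
Qed.

Lemma halfB (u w : V) : (2^-1 : C) *: (u + w) - (2^-1 : C) *: (u - w) = w.
Proof. by rewrite -scalerN opprB [u + w]addrC halfD. Qed.

(** The pairs (x, cj x) form a maximal totally real set. Every nearby (x, y) is [P 1 'i] for a map
    [P], complex affine in its two parameters, that sends real parameters into this set; the
    one-variable identity theorem is applied to one parameter after the other. *)
Lemma polarization (F : V * V -> C) (a : V) (r : R) : 0 < r ->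
  (forall p, nrm (p.1 - a) < r -> nrm (p.2 - cj a) < r ->
     differentiable F p) ->
  (forall x, nrm (x - a) < r -> F (x, cj x) = 0) ->
  forall x y, nrm (x - a) < r / 16 -> nrm (y - cj a) < r / 16 -> F (x, y) = 0.
Proof.
move=> r0 FP F0 x y xa ya.
(* Parameters of modulus below 4 keep [P] within r of the base point, and 1 and i lie in the
   half-radius disc. *)
have r16 : 4 * (r / 16) + 4 * (r / 16) < r by lra.
have [p [q [np nq xE yE]]] : exists p q : V, [/\ nrm p < r / 16, nrm q < r / 16,
    x = a + p + 'i *: q & y = cj a + cj p + 'i *: cj q].
  (* Solving x - a = p + i q and y - cj a = cj p + i cj q: [p] and [q] act as real and imaginary
     part of the pair. *)
  pose w := cj (y - cj a).
  exists ((2^-1 : C) *: ((x - a) + w)), ((2 * 'i)^-1 *: ((x - a) - w)).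
  have nw : nrm w < r / 16 by rewrite nrm_cj.
  have n2 : nrm (2^-1 : C) = 2^-1 by rewrite nrmV nrm_nat.
  have n2i : nrm ((2 * 'i)^-1 : C) = 2^-1 by rewrite nrmV nrmM nrm_nat nrm_i mulr1.
  have half2 A B : A < r / 16 -> B < r / 16 -> 2^-1 * (A + B) < r / 16 :> R.
    by clear; lra.
  have i0 : 'i != 0 :> C by rewrite -nrm_eq0 nrm_i oner_eq0.
  have t0 : 2 != 0 :> C by rewrite pnatr_eq0.
  split.
  - rewrite nrmZ n2 (le_lt_trans _ (half2 _ _ xa nw))// ler_pM2l ?invr_gt0//.
    exact: nrmD.
  - rewrite nrmZ n2i (le_lt_trans _ (half2 _ _ xa nw))// ler_pM2l ?invr_gt0//.
    exact: nrmB.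
  - rewrite scalerA (_ : 'i * (2 * 'i)^-1 = 2^-1); last by field; rewrite i0.
    by rewrite -addrA halfD addrC subrK.
  - have wE : cj w = y - cj a by rewrite /w cjK.
    have H1 v : cj ((2^-1 : C) *: v) = (2^-1 : C) *: cj v.
      by rewrite cjZ conjc_inv conjc_nat.
    have H2 v : cj ((2 * 'i)^-1 *: v) = - (2 * 'i)^-1 *: cj v.
      rewrite cjZ conjc_inv -invrN; congr (_^-1 *: _).
      rewrite mulr_natl mulr2n; apply/eqP.
      by rewrite eq_complex/= addr0 oppr0 !eqxx.
    rewrite H1 H2 cjD (_ : cj (x - a - w) = cj (x - a) - cj w) ?cjB// wE -cjB.
    rewrite scalerA (_ : 'i * - (2 * 'i)^-1 = - 2^-1); last by field; rewrite i0.
    by rewrite scaleNr -addrA halfB addrC subrK.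
pose P (al be : C) : V * V := (a + al *: p + be *: q, cj a + al *: cj p + be *: cj q).
have Pin al be : nrm al < 4 -> nrm be < 4 ->
    nrm ((P al be).1 - a) < r /\ nrm ((P al be).2 - cj a) < r.
  move=> al4 be4.
  have H u v : nrm u < r / 16 -> nrm v < r / 16 -> nrm (al *: u + be *: v : V) < r.
    move=> ur vr; rewrite (le_lt_trans (nrmD _ _))// !nrmZ.
    have h1 : nrm al * nrm u <= 4 * (r / 16).
      by rewrite ler_pM ?nrm_ge0// ltW.
    have h2 : nrm be * nrm v <= 4 * (r / 16).
      by rewrite ler_pM ?nrm_ge0// ltW.
    exact: le_lt_trans (lerD h1 h2) r16.
  have E (b u v : V) : b + u + v - b = u + v by rewrite -[b + u + v]addrA addrAC subrr add0r.
  by rewrite /P/= !E; split; apply: H; rewrite ?nrm_cj.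
have FD al be : nrm al < 4 -> nrm be < 4 ->
    differentiable F (P al be).
  by move=> h1 h2; have [k1 k2] := Pin _ _ h1 h2; exact: FP.
have PR (s t : R) : nrm (s%:C : C) < 4 -> nrm (t%:C : C) < 4 -> F (P s%:C t%:C) = 0.
  move=> s4 t4; have [k1 _] := Pin _ _ s4 t4.
  have -> : P s%:C t%:C =
      (a + s%:C *: p + t%:C *: q, cj (a + s%:C *: p + t%:C *: q)).
    by rewrite /P !cjD !cjZ !conjc_real.
  exact: F0.
have acc (g : C -> C) : (forall s : R, nrm (s%:C : C) < 4 -> g s%:C = 0) ->
    forall e : R, 0 < e -> exists z, [/\ z != 0, nrm (z - 0) < e & g z = 0].
  move=> g0 e e0; pose s := Num.min (e / 2) 1.
  have s0 : 0 < s by rewrite lt_min ltr01 divr_gt0.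
  exists s%:C; split.
  - by rewrite -nrm_gt0 nrm_real gtr0_norm.
  - rewrite subr0 nrm_real gtr0_norm// gt_min; apply/orP; left.
    by rewrite ltr_pdivrMr// ltr_pMr// ltr1n.
  - by apply: g0; rewrite nrm_real gtr0_norm// gt_min; apply/orP; right; lra.
have four : 0 < 4 :> R by [].
have S1 (t : R) : nrm (t%:C : C) < 4 -> F (P 1 t%:C) = 0.
  move=> t4; apply: (@identity1 (fun al => F (P al t%:C)) 0 4 four).
  - move=> al; rewrite subr0 => al4.
    have := FD _ _ al4 t4.
    have PE b : P b t%:C = (a + t%:C *: q, cj a + t%:C *: cj q) + b *: ((p, cj p) : V * V).
      by rewrite /P -[X in (X, _)]addrAC -[X in (_, X)]addrAC.
    have -> : (fun al => F (P al t%:C)) =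
        (fun b => F ((a + t%:C *: q, cj a + t%:C *: cj q) + b *: ((p, cj p) : V * V))).
      by apply/funext => b; rewrite PE.
    by rewrite PE => /diff_slice[].
  - by apply: acc => s s4; exact: PR.
  - by rewrite subr0 nrm1; lra.
have n14 : nrm (1 : C) < 4 by rewrite nrm1; lra.
have S2 : F (P 1 'i) = 0.
  apply: (@identity1 (fun be => F (P 1 be)) 0 4 four).
  - move=> be; rewrite subr0 => be4.
    have := FD _ _ n14 be4.
    have PE b : P 1 b = (a + p, cj a + cj p) + b *: ((q, cj q) : V * V).
      by congr (_, _); rewrite /= scale1r.
    have -> : (fun be => F (P 1 be)) =
        (fun b => F ((a + p, cj a + cj p) + b *: ((q, cj q) : V * V))).
      by apply/funext => b; rewrite PE.
    by rewrite PE => /diff_slice[].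
  - by apply: acc => s s4; exact: S1.
  - by rewrite subr0 nrm_i; lra.
have -> : (x, y) = P 1 'i by rewrite /P !scale1r -xE -yE.
exact: S2.
Qed.

End conj.

End identity.

(** * The Bergman metric and the polarized kernel *)

Section metric.
Context (R : realType).
Local Notation C := R[i].
Local Notation Re := (@complex.Re R).
Local Notation Im := (@complex.Im R).

Lemma conjC_D (a b : C) : conjc (a + b) = conjc a + conjc b. Proof. exact: rmorphD. Qed.
Lemma conjC_B (a b : C) : conjc (a - b) = conjc a - conjc b. Proof. exact: rmorphB. Qed.
Lemma conjC_M (a b : C) : conjc (a * b) = conjc a * conjc b. Proof. exact: rmorphM. Qed.

(** Conjugating both argument and value makes the derivative complex linear again. *)
Lemma diff_conj n (g : 'rV[C]_n -> C) (y : 'rV[C]_n) : differentiable g (cj y) ->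
  differentiable (fun x => conjc (g (cj x))) y /\
  'd (fun x => conjc (g (cj x))) y = (fun v => conjc ('d g (cj y) (cj v))) :> (_ -> _).
Proof.
move=> /diff_Dif[lin [c c0 cP] gP]; apply: Dif_diff; split.
- by move=> a u v; rewrite cjD cjZ lin conjC_D -[_ *: 'd _ _ _]/(_ * _) conjC_M conjcK.
- by exists c => // u; rewrite nrm_conj -(nrm_cj u).
move=> e e0; have [d d0 dP] := gP e e0; exists d => // u ud.
by rewrite cjD -!conjC_B nrm_conj -(nrm_cj u) dP// nrm_cj.
Qed.

Lemma diff_conjV n m (g : 'rV[C]_n -> 'rV[C]_m) (y : 'rV[C]_n) :
  differentiable g (cj y) ->
  differentiable (fun x => cj (g (cj x))) y /\
  'd (fun x => cj (g (cj x))) y = (fun v => cj ('d g (cj y) (cj v))) :> (_ -> _).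
Proof.
move=> /diff_Dif[lin [c c0 cP] gP]; apply: Dif_diff; split.
- by move=> a u v; rewrite cjD cjZ lin cjD cjZ conjcK.
- by exists c => // u; rewrite nrm_cj -(nrm_cj u).
move=> e e0; have [d d0 dP] := gP e e0; exists d => // u ud.
by rewrite cjD -!cjB nrm_cj -(nrm_cj u) dP// nrm_cj.
Qed.

Lemma diff_sumC (V : normedModType C) (I : Type) (s : seq I) (F : I -> V -> C) (x : V) :
  (forall i, differentiable (F i) x) ->
  differentiable (fun y => \sum_(i <- s) F i y) x /\
  'd (fun y => \sum_(i <- s) F i y) x = (fun v => \sum_(i <- s) 'd (F i) x v) :> (V -> C).
Proof.
move=> Fd; elim: s => [|i s [IH1 IH2]].
  have E : (fun y : V => \sum_(i <- [::]) F i y) = cst 0.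
    by apply/funext => y; rewrite big_nil.
  rewrite E; split; first exact: differentiable_cst.
  apply/funext => v; rewrite big_nil.
  exact: (congr1 (fun g : V -> C => g v) (@diff_cst _ V C 0 x)).
have E : (fun y : V => \sum_(j <- i :: s) F j y) = F i + (fun y => \sum_(j <- s) F j y).
  by apply/funext => y; rewrite big_cons.
rewrite E; split; first exact: differentiableD.
apply/funext => v; rewrite big_cons.
apply: (etrans (congr1 (fun g : V -> C => g v) (diffD (Fd i) IH1))).
apply: (congr1 (fun w : C => 'd (F i) x v + w)).
exact: (congr1 (fun g : V -> C => g v) IH2).
Qed.

Lemma diff_scaleC (V : normedModType C) (F : V -> C) (c : C) (x : V) : differentiable F x ->
  differentiable (fun y => c * F y) x /\
  'd (fun y => c * F y) x = (fun v => c * 'd F x v) :> (V -> C).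
Proof.
by move=> Fd; split; [exact: (@differentiableZ _ _ _ F c x Fd)|exact: (@diffZ _ _ _ F c x Fd)].
Qed.

Lemma derive1_is (f : R -> R) (t d : R) : is_derive t 1 f d -> derive1 f t = d.
Proof. by move=> [_ <-]; rewrite derive1E. Qed.

Lemma derive1_near (f g : R -> R) (t : R) : (\forall s \near t, f s = g s) ->
  derive1 f t = derive1 g t.
Proof. by move=> fg; rewrite !derive1E; apply: near_eq_derive => //; exact: oner_neq0. Qed.

Section one_kernel.
Variable n : nat.
Local Notation V := 'rV[C]_n.

Lemma pder_diag (Q : V * V -> C) (z v : V) : differentiable Q (z, cj z) ->
  pder (fun t : R => Q (z + t%:C *: v, cj (z + t%:C *: v))) 0 ('d Q (z, cj z) (v, cj v)).
Proof.
move=> Qd.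
have E t : (z + t%:C *: v, cj (z + t%:C *: v)) =
    (z, cj z) + t%:C *: ((v, cj v) : V * V).
  by rewrite cjD cjZ conjc_real.
have -> : (fun t : R => Q (z + t%:C *: v, cj (z + t%:C *: v))) =
    Q \o (fun t : R => (z, cj z) + t%:C *: ((v, cj v) : V * V)).
  by apply/funext => t; rewrite E.
have Z : (z, cj z) + (0 : R)%:C *: ((v, cj v) : V * V) = (z, cj z).
  by rewrite scale0r addr0.
have := @pder_diff R _ _ Q (fun t : R => (z, cj z) + t%:C *: ((v, cj v) : V * V)) 0 (v, cj v).
by rewrite Z; apply => //; exact: pder_affine.
Qed.

Lemma real_derive_diag (Q : V * V -> C) (q : V -> C) (D : set V) (z v : V) :
  open D -> D z -> (forall x, D x -> q x = Q (x, cj x)) ->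
  differentiable Q (z, cj z) ->
  real_derive q v z = 'd Q (z, cj z) (v, cj v).
Proof.
move=> oD Dz qQ Qd; have P := pder_diag v Qd.
have near_q : \forall s \near (0 : R), q (z + s%:C *: v) = Q (z + s%:C *: v, cj (z + s%:C *: v)).
  have [e e0 eP] := open_nrm oD Dz.
  have v0 : 0 < nrm v + 1 by rewrite ltr_wpDl ?nrm_ge0.
  apply/nbhs_realP; exists (e / (nrm v + 1)); first by rewrite divr_gt0.
  move=> s; rewrite subr0 ltr_pdivlMr// => sv; apply/qQ/eP.
  rewrite addrAC subrr add0r nrmZ nrm_real (le_lt_trans _ sv)// ler_wpM2l//.
  by rewrite lerDl.
rewrite /real_derive.
have -> : derive1 (fun t : R => Re (q (z + t%:C *: v))) 0 = Re ('d Q (z, cj z) (v, cj v)).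
  rewrite -(derive1_is (pder_Re P)); apply: derive1_near.
  by apply: filterS near_q => s ->.
have -> : derive1 (fun t : R => Im (q (z + t%:C *: v))) 0 = Im ('d Q (z, cj z) (v, cj v)).
  rewrite -(derive1_is (pder_Im P)); apply: derive1_near.
  by apply: filterS near_q => s ->.
by case: ('d Q (z, cj z) (v, cj v)).
Qed.

Local Notation e_ i := (delta_mx 0 i : V).

Lemma cj_delta i : cj (e_ i) = e_ i.
Proof. by apply/rowP => j; rewrite !mxE conjc_nat. Qed.

Lemma conj_i : conjc 'i = - 'i :> C.
Proof. by apply/eqP; rewrite eq_complex/= oppr0 !eqxx. Qed.

(** Combining the real derivatives along u and i u separates the two slots of [L]. In this way [d_z]
    and [d_zbar] of a function on the diagonal become partial derivatives of its holomorphic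
    extension to pairs. *)
Lemma half_sum (L : V * V -> C) (u : V) : linear L ->
  2^-1 * (L (u, u) + 'i * L ('i *: u, - 'i *: u)) = L (0, u) /\
  2^-1 * (L (u, u) - 'i * L ('i *: u, - 'i *: u)) = L (u, 0).
Proof.
move=> linL.
have LD p q : L (p + q) = L p + L q by have := linL 1 p q; rewrite !scale1r.
have LZ a p : L (a *: p) = a * L p.
  have L0 : L 0 = 0 by have := linL (-1) 0 0; rewrite scaler0 addr0 scaleN1r addNr.
  by have := linL a p 0; rewrite !addr0 L0 addr0.
have E1 : L (u, u) = L (u, 0) + L (0, u).
  by rewrite -LD; congr L; congr (_, _); rewrite ?addr0 ?add0r.
have E2 : L ('i *: u, - 'i *: u) = 'i * L (u, 0) - 'i * L (0, u).
  have -> : ('i *: u, - 'i *: u) = 'i *: ((u, 0) : V * V) + (- 'i) *: ((0, u) : V * V).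
    by congr (_, _); rewrite /= scaler0 ?addr0 ?add0r.
  by rewrite LD !LZ mulNr.
have i2 : 'i * 'i = -1 :> C by rewrite -expr2 sqr_i.
have t0 : (2 : C) != 0 by rewrite pnatr_eq0.
rewrite E1 E2 mulrBr !mulrA i2; move: (L (u, 0)) (L (0, u)) => x y.
by split; field.
Qed.

Lemma d_z_diag (Q : V * V -> C) (q : V -> C) (z : V) i :
  (forall v, real_derive q v z = 'd Q (z, cj z) (v, cj v)) ->
  d_z i q z = 'd Q (z, cj z) (e_ i, 0).
Proof.
move=> H; rewrite /d_z !H cjZ cj_delta conj_i.
by have [_ ->] := @half_sum ('d Q (z, cj z)) (e_ i) (@linearP _ _ _ _ _).
Qed.

(** The properties of a Bergman kernel on which polarization rests. They are inherited by pull-backs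
    under holomorphic maps, so that both kernels can be compared over one domain. The local bound
    serves joint holomorphy. *)
Definition kernel_on (D : set V) (K : V -> V -> C) :=
  [/\ forall z w, D z -> D w -> differentiable (K ^~ w) z,
      forall z w, D z -> D w -> K z w = conjc (K w z),
      forall z, D z -> 0 < Re (K z z) &
      forall a b, D a -> D b -> exists r M : R, 0 < r /\
        forall x y, nrm (x - a) < r -> nrm (y - b) < r -> nrm (K x y) <= M].

(* The kernel is antiholomorphic in its second variable; [kap K] is holomorphic in
   both, and restricts to [K z z] on the totally real set [(z, cj z)]. *)
Definition kap (K : V -> V -> C) (p : V * V) : C := K p.1 (cj p.2).

Definition dom2 (D : set V) : set (V * V) := [set p | D p.1 /\ D (cj p.2)].

Lemma pair_lt (p q : V * V) (r : R) :
  nrm (p - q) < r -> nrm (p.1 - q.1) < r /\ nrm (p.2 - q.2) < r.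
Proof.
by rewrite [p - q]surjective_pairing nrm_pair_lt => /andP[].
Qed.

Lemma open_dom2 (D : set V) : open D -> open (dom2 D).
Proof.
move=> oD; rewrite openE => p [D1 D2].
have [r1 r10 r1P] := open_nrm oD D1; have [r2 r20 r2P] := open_nrm oD D2.
apply/nbhs_nrm; exists (Num.min r1 r2); first by rewrite lt_min r10.
move=> q; rewrite lt_min => /andP[/pair_lt[q1 _] /pair_lt[_ q2]].
by split; [exact: r1P|apply: r2P; rewrite -cjB nrm_cj].
Qed.

Section kernel.
Variables (D : set V) (K : V -> V -> C).
Hypotheses (oD : open D) (KP : kernel_on D K).

(** Holomorphy in the second variable comes from Hermitian symmetry, joint holomorphy from
    [holo_joint]. *)
Lemma kap_diff p : dom2 D p -> differentiable (kap K) p.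
Proof.
case: p => a b [/= Da Db]; have [k1 k2 k3 k4] := KP.
have [r [M [r0 rM]]] := k4 _ _ Da Db.
have [r1 r10 r1P] := open_nrm oD Da; have [r2 r20 r2P] := open_nrm oD Db.
pose s := Num.min r (Num.min r1 r2).
have s0 : 0 < s by rewrite !lt_min r0 r10.
apply: (@holo_joint R V V (fun x y => K x (cj y)) a b s M s0) => x y.
rewrite /s !lt_min => /and3P[x1 x2 _] /and3P[y1 _ y2].
have Dx : D x by exact: r1P.
have cyb : nrm (cj y - cj b) = nrm (y - b) by rewrite -cjB nrm_cj.
have Dy : D (cj y) by apply: r2P; rewrite cyb.
split; first exact: k1.
- have Hd := (diff_conj (k1 _ _ Dy Dx)).1.
  have [r3 r30 r3P] := open_nrm oD Dy.
  apply: (diff_ext r30 _ Hd).1 => w wy; rewrite -k2//; apply: r3P.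
  by rewrite -cjB nrm_cj.
- by apply: rM => //; rewrite cyb.
Qed.

Lemma kap_diag z : D z -> kap K (z, cj z) = (Re (K z z))%:C.
Proof.
move=> Dz; rewrite /kap cjK /=; have [_ k2 _ _] := KP.
have := congr1 Im (k2 z z Dz Dz); case: (K z z) => a b /= bb.
by congr (_ +i* _); apply/eqP; rewrite -[_ == _](mulrn_eq0 b 2) mulr2n {1}bb addNr.
Qed.

Lemma kap_diag_neq0 z : D z -> kap K (z, cj z) != 0.
Proof.
move=> Dz; rewrite kap_diag//; have [_ _ k3 _] := KP.
by rewrite -nrm_eq0 nrm_real normr_eq0 gt_eqF// k3.
Qed.

(** Where logarithmic derivatives of [kap K] make sense; it contains the diagonal over [D]. *)
Definition dom3 : set (V * V) := [set p | dom2 D p /\ kap K p != 0].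

Lemma open_dom3 : open dom3.
Proof.
rewrite openE => p [Dp Kp].
have [r1 r10 r1P] := open_nrm (open_dom2 oD) Dp.
have Kp0 : 0 < nrm (kap K p) by rewrite nrm_gt0.
have [d d0 dP] := Dif_continuous (diff_Dif (kap_diff Dp)) Kp0.
apply/nbhs_nrm; exists (Num.min r1 d); first by rewrite lt_min r10.
move=> q; rewrite lt_min => /andP[q1 q2]; split; first exact: r1P.
apply/eqP => q0; have := dP _ q2.
by rewrite q0 sub0r nrmN ltxx.
Qed.

(** The derivative of log kap in the second variable along [v], without choosing a branch of the
    logarithm. *)
Definition lam (v : V) (p : V * V) : C := 'd (kap K) p (0, v) / kap K p.

Lemma lam_diff v p : dom3 p -> differentiable (lam v) p.
Proof.
move=> [Dp Kp].
have d1 := @holo_dir_open R (V * V)%type (dom2 D) (kap K) (0, v) (open_dom2 oD) kap_diff p Dp.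
have d2 := @differentiableV _ _ (kap K) p (kap_diff Dp) Kp.
exact: (differentiableM d1 d2).
Qed.

Lemma real_derive_log z v : D z ->
  real_derive (fun x => (ln (Re (K x x)))%:C) v z =
  'd (kap K) (z, cj z) (v, cj v) / kap K (z, cj z).
Proof.
move=> Dz; have [_ _ k3 _] := KP.
have Dz2 : dom2 D (z, cj z) by split; rewrite //= cjK.
have P := pder_diag v (kap_diff Dz2).
set d := 'd (kap K) (z, cj z) (v, cj v) in P *.
set F := (fun t : R => _) in P.
have near_D : \forall s \near (0 : R), D (z + s%:C *: v).
  have [e e0 eP] := open_nrm oD Dz.
  have v0 : 0 < nrm v + 1 by rewrite ltr_wpDl ?nrm_ge0.
  apply/nbhs_realP; exists (e / (nrm v + 1)); first by rewrite divr_gt0.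
  move=> s; rewrite subr0 ltr_pdivlMr// => sv; apply/eP.
  rewrite addrAC subrr add0r nrmZ nrm_real (le_lt_trans _ sv)// ler_wpM2l//.
  by rewrite lerDl.
(* On the diagonal [kap K] is real, and the path stays on it, so the derivative is real. *)
have Imd : Im d = 0.
  rewrite -(derive1_is (pder_Im P)).
  rewrite (@derive1_near _ (cst 0)) ?derive1_cst//.
  by apply: filterS near_D => s Ds; rewrite /= /F kap_diag.
have F0 : Re (F 0) = Re (K z z).
  by rewrite /F scale0r addr0 kap_diag.
have H : is_derive (0 : R) 1 (@ln R \o (Re \o F)) ((Re (K z z))^-1 * Re d).
  apply: is_derive1_comp; last exact: (pder_Re P).
  rewrite /= F0; apply: is_derive1_ln; exact: k3.
rewrite /real_derive.
have -> : derive1 (fun t : R => Re (ln (Re (K (z + t%:C *: v) (z + t%:C *: v))))%:C) 0 =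
    (Re (K z z))^-1 * Re d.
  rewrite -(derive1_is H); apply: derive1_near.
  by apply: filterS near_D => s Ds; rewrite /= /F kap_diag.
have -> : derive1 (fun t : R => Im (ln (Re (K (z + t%:C *: v) (z + t%:C *: v))))%:C) 0 = 0.
  by rewrite -[RHS](derive1_cst 0 (0 : R)).
rewrite kap_diag// -fmorphV/=.
have realE (c : C) : Im c = 0 -> c = (Re c)%:C by case: c => a b /= ->.
rewrite (realE d Imd).
by rewrite -rmorphM/= mulrC.
Qed.

(** The double sum over coordinates is the expansion of a single mixed derivative of log kap; in
    this coordinate-free form the metric is easily pulled back. *)
Lemma metricE (mu : V -> R) z u v : bergman_kernel D mu = K -> D z ->
  bergman_metric D mu z u v = 'd (lam (cj v)) (z, cj z) (u, 0).
Proof.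
move=> KE Dz.
have logE : log_bergman_kernel D mu = (fun x => (ln (Re (K x x)))%:C).
  by rewrite /log_bergman_kernel KE.
have D3 x : D x -> dom3 (x, cj x).
  by move=> Dx; split; [split; rewrite //= cjK|exact: kap_diag_neq0].
have E1 j x : D x -> d_zbar j (log_bergman_kernel D mu) x = lam (e_ j) (x, cj x).
  move=> Dx; rewrite logE /d_zbar !real_derive_log// cjZ cj_delta conj_i.
  set L := 'd (kap K) (x, cj x).
  rewrite /lam -/L; have [<- _] := @half_sum L (e_ j) (@linearP _ _ _ _ _).
  set k := kap _ _; move: (L (e_ j, e_ j)) (L ('i *: e_ j, - 'i *: e_ j)) => p q.
  by rewrite [_ * (q / k)]mulrA -mulrDl mulrA.
have E2 i j : d_z i (d_zbar j (log_bergman_kernel D mu)) z = 'd (lam (e_ j)) (z, cj z) (e_ i, 0).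
  apply: d_z_diag.
  move=> w; apply: (@real_derive_diag (lam (e_ j)) _ D) => //.
  - by move=> x /E1 ->.
  - exact/lam_diff/D3.
have lin0 p : linear (fun w : V => 'd (kap K) p (0, w)).
  by move=> a x y; rewrite -linearP; congr ('d _ _ _); congr (_, _); rewrite /= ?scaler0 ?addr0.
have lamE p : lam (cj v) p = \sum_(j < n) (v 0 j)^* * lam (e_ j) p.
  pose L : {linear V -> C} := HB.pack (fun w : V => 'd (kap K) p (0, w))
    (GRing.isLinear.Build _ _ _ _ _ (lin0 p)).
  have LZ a w : L (a *: w) = a * L w by rewrite linearZ.
  rewrite /lam -[X in X / _]/(L (cj v)) (row_sum_delta (cj v)) linear_sum mulr_suml.
  by apply: eq_bigr => j _; rewrite LZ mxE -mulrA.
have S := @diff_sumC (V * V)%type 'I_n (index_enum _) (fun j p => (v 0 j)^* * lam (e_ j) p) (z, cj z)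
  (fun j => (@diff_scaleC _ (lam (e_ j)) ((v 0 j)^*) (z, cj z) (lam_diff (e_ j) (D3 z Dz))).1).
have -> : lam (cj v) = (fun p => \sum_(j < n) (v 0 j)^* * lam (e_ j) p).
  by apply/funext => p; rewrite lamE.
rewrite S.2 /bergman_metric exchange_big/=; apply: eq_bigr => j _.
have [_ ->] := @diff_scaleC _ (lam (e_ j)) ((v 0 j)^*) (z, cj z) (lam_diff (e_ j) (D3 z Dz)).
set L' := 'd (lam (e_ j)) (z, cj z).
have lin1 : linear (fun w : V => L' (w, 0)).
  by move=> a x y; rewrite -linearP; congr (L' _); congr (_, _); rewrite /= ?scaler0 ?addr0.
pose L : {linear V -> C} := HB.pack (fun w : V => L' (w, 0))
    (GRing.isLinear.Build _ _ _ _ _ lin1).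
have LZ a w : L (a *: w) = a * L w by rewrite linearZ.
rewrite -[L' (u, 0)]/(L u) [in RHS](row_sum_delta u) linear_sum mulr_sumr.
apply: eq_bigr => i _; rewrite E2 LZ -[L (e_ i)]/(L' (e_ i, 0)).
by rewrite -/L'; ring.
Qed.

End kernel.
End one_kernel.
End metric.

(** * The polarized identity for kernels with equal metrics, and pull-backs *)

Section isometry.
Context (R : realType).
Local Notation C := R[i].
Local Notation Re := (@complex.Re R).
Local Notation Im := (@complex.Im R).

Section pairs.
Context (V W : normedModType C).

Lemma diff_inl (x : V) (y : W) :
  differentiable (fun x' : V => ((x', y) : V * W)) x /\
  'd (fun x' : V => ((x', y) : V * W)) x = (fun u => (u, 0)) :> (V -> V * W).
Proof.
apply: (@diff_quad R V (V * W)%type _ x _ 0 1 ltr01).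
- by move=> c u v; congr (_, _); rewrite /= scaler0 addr0.
- by exists 1 => // u; rewrite mul1r nrm_pair nrm0 ge_max lexx nrm_ge0.
- move=> u _; rewrite mul0r (_ : _ - _ = 0) ?nrm0//.
  by congr (_, _); rewrite /= ?subrr ?subr0// [x + u]addrC addrK subrr.
Qed.

Lemma diff_inr (x : V) (y : W) :
  differentiable (fun y' : W => ((x, y') : V * W)) y /\
  'd (fun y' : W => ((x, y') : V * W)) y = (fun u => (0, u)) :> (W -> V * W).
Proof.
apply: (@diff_quad R W (V * W)%type _ y _ 0 1 ltr01).
- by move=> c u v; congr (_, _); rewrite /= scaler0 addr0.
- by exists 1 => // u; rewrite mul1r nrm_pair nrm0 ge_max lexx nrm_ge0.
- move=> u _; rewrite mul0r (_ : _ - _ = 0) ?nrm0//.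
  by congr (_, _); rewrite /= ?subrr ?subr0// [y + u]addrC addrK subrr.
Qed.

Lemma diff_compE (U X Y : normedModType C) (f : U -> X) (g : X -> Y) (x v : U) :
  differentiable f x -> differentiable g (f x) ->
  'd (fun z => g (f z)) x v = 'd g (f x) ('d f x v).
Proof.
move=> df dg.
exact: (congr1 (fun h : U -> Y => h v) (@diff_comp _ _ _ _ f g x df dg)).
Qed.

Lemma d_fst (Q : V * W -> C) x y u : differentiable Q (x, y) ->
  differentiable (fun x' => Q (x', y)) x /\
  'd Q (x, y) (u, 0) = 'd (fun x' => Q (x', y)) x u.
Proof.
move=> Qd; have [d1 d2] := diff_inl x y; split.
  exact: (@differentiable_comp _ _ _ _ (fun x' : V => ((x', y) : V * W)) Q x d1 Qd).
have := @diff_compE _ _ _ (fun x' : V => ((x', y) : V * W)) Q x u d1 Qd.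
by move=> ->; apply: (congr1 ('d Q (x, y))); rewrite d2.
Qed.

Lemma d_snd (Q : V * W -> C) x y v : differentiable Q (x, y) ->
  differentiable (fun y' => Q (x, y')) y /\
  'd Q (x, y) (0, v) = 'd (fun y' => Q (x, y')) y v.
Proof.
move=> Qd; have [d1 d2] := diff_inr x y; split.
  exact: (@differentiable_comp _ _ _ _ (fun y' : W => ((x, y') : V * W)) Q y d1 Qd).
have := @diff_compE _ _ _ (fun y' : W => ((x, y') : V * W)) Q y v d1 Qd.
by move=> ->; apply: (congr1 ('d Q (x, y))); rewrite d2.
Qed.

End pairs.

Lemma pderN (V : normedModType C) (F : R -> V) t a :
  pder F t a -> pder (fun s => - F s) t (- a).
Proof.
move=> Fa e e0; have [r r0 rP] := Fa _ e0; exists r => // s /rP.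
by rewrite -nrmN scalerN; congr (nrm _ <= _); rewrite !opprD.
Qed.

Section two_kernels.
Variable n : nat.
Local Notation V := 'rV[C]_n.
Variables (D : set V) (F G : V -> V -> C).
Hypotheses (oD : open D) (cD : connected D).
Hypotheses (FP : kernel_on D F) (GP : kernel_on D G).
Hypothesis FG : forall z u v, D z ->
  'd (lam F (cj v)) (z, cj z) (u, 0) = 'd (lam G (cj v)) (z, cj z) (u, 0).

(** The cross-multiplied form of the statement that a quotient of kernel values is 1: being
    polynomial, it holds across zeros of the kernels and extends by the identity theorem. *)
Let ident (a z w : V) :=
  F z w * G a w * G z a * F a a = G z w * F a w * F z a * G a a.

(** By [FG] and polarization the derivative of lam F v - lam G v in the first variable vanishes near
    (a, cj a); the last clause follows along the segment from a to x with y fixed. *)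
Lemma lam_eq (a : V) : D a -> exists r : R, [/\ 0 < r,
  forall x y, nrm (x - a) < r -> nrm (y - cj a) < r -> dom3 D F (x, y) /\ dom3 D G (x, y) &
  forall x y v, nrm (x - a) < r -> nrm (y - cj a) < r ->
    lam F v (x, y) - lam G v (x, y) = lam F v (a, y) - lam G v (a, y)].
Proof.
move=> Da.
have oF := open_dom3 oD FP; have oG := open_dom3 oD GP.
have D3F : dom3 D F (a, cj a).
  by split; [split; rewrite //= cjK|exact: (kap_diag_neq0 FP)].
have D3G : dom3 D G (a, cj a).
  by split; [split; rewrite //= cjK|exact: (kap_diag_neq0 GP)].
have [r1 r10 r1P] := open_nrm oF D3F; have [r2 r20 r2P] := open_nrm oG D3G.
pose r := Num.min r1 r2; have r0 : 0 < r by rewrite lt_min r10.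
have inr x y : nrm (x - a) < r -> nrm (y - cj a) < r ->
    dom3 D F (x, y) /\ dom3 D G (x, y).
  rewrite !lt_min => /andP[x1 x2] /andP[y1 y2]; split.
    by apply: r1P; rewrite -[_ - _]/(x - a, y - cj a) nrm_pair_lt x1.
  by apply: r2P; rewrite -[_ - _]/(x - a, y - cj a) nrm_pair_lt x2.
pose A u v (p : V * V) : C := 'd (lam F v) p (u, 0) - 'd (lam G v) p (u, 0).
have Ad u v p : dom3 D F p -> dom3 D G p -> differentiable (A u v) p.
  move=> p1 p2.
  have d1 := @holo_dir_open R (V * V)%type _ (lam F v) (u, 0) oF (lam_diff oD FP v) p p1.
  have d2 := @holo_dir_open R (V * V)%type _ (lam G v) (u, 0) oG (lam_diff oD GP v) p p2.
  exact: (differentiableB d1 d2).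
have A0 u v x y : nrm (x - a) < r / 16 -> nrm (y - cj a) < r / 16 -> A u v (x, y) = 0.
  apply: (@polarization R n (A u v) a r r0) => [p p1 p2|x' xa].
    by have [] := inr p.1 p.2 p1 p2; rewrite -surjective_pairing; exact: Ad.
  have Dx : D x'.
    have [|[[Dx _] _] _] := inr x' (cj x') xa; last exact: Dx.
    by rewrite -cjB nrm_cj.
  have := @FG x' u (cj v) Dx; rewrite cjK => E.
  by apply/eqP; rewrite subr_eq0; apply/eqP; exact: E.
have r16 : r / 16 < r by rewrite ltr_pdivrMr// ltr_pMr// ltr1n.
exists (r / 16); split; first by rewrite divr_gt0.
  by move=> x y x1 y1; apply: inr; exact: lt_trans r16.
move=> x y v xa ya.
pose u := x - a.
have pth (t : R) : 0 <= t <= 1 -> nrm (a + t%:C *: u - a) < r / 16.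
  move=> /andP[t0 t1]; rewrite addrAC subrr add0r nrmZ nrm_real ger0_norm//.
  by apply: le_lt_trans xa; rewrite ler_piMl ?nrm_ge0.
have P (Q : V * V -> C) (t : R) : differentiable Q (a + t%:C *: u, y) ->
    pder (fun t : R => Q (a + t%:C *: u, y)) t ('d Q (a + t%:C *: u, y) (u, 0)).
  have E (s : R) : (a + s%:C *: u, y) = (a, y) + s%:C *: ((u, 0) : V * V).
    by congr (_, _); rewrite /= scaler0 addr0.
  move=> Qd.
  have -> : (fun t : R => Q (a + t%:C *: u, y)) =
      Q \o (fun t : R => (a, y) + t%:C *: ((u, 0) : V * V)).
    by apply/funext => s; rewrite E.
  rewrite E in Qd *.
  exact: (@pder_diff R _ _ Q (fun t : R => (a, y) + t%:C *: ((u, 0) : V * V)) t (u, 0) Qd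
    (@pder_affine _ _ _ _ t)).
have H : (fun t : R => lam F v (a + t%:C *: u, y) - lam G v (a + t%:C *: u, y)) 1 =
         (fun t : R => lam F v (a + t%:C *: u, y) - lam G v (a + t%:C *: u, y)) 0.
  apply: (@pder0_cst R (fun t : R => lam F v (a + t%:C *: u, y) -
    lam G v (a + t%:C *: u, y)) 0 1 ler01) => t t01.
  have [i1 i2] := inr _ y (lt_trans (pth t t01) r16) (lt_trans ya r16).
  have := pderD (P (lam F v) t (lam_diff oD FP v i1)) (pderN (P (lam G v) t (lam_diff oD GP v i2))).
  by rewrite -[_ - _]/(A u v (a + t%:C *: u, y)) A0// pth.
move: H => /=; rewrite scale0r addr0 scale1r.
by rewrite (_ : a + u = x)// /u addrC subrK.
Qed.

(** The scalars are logarithmic derivatives along [v]; that of the quotient is l1 + l2 - m1 - m2 =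
    0. *)
Lemma ratio_derive (N1 N2 M1 M2 : V -> C) (y v : V) (l1 l2 m1 m2 : C) :
  differentiable N1 y -> differentiable N2 y -> differentiable M1 y -> differentiable M2 y ->
  'd N1 y v = l1 * N1 y -> 'd N2 y v = l2 * N2 y ->
  'd M1 y v = m1 * M1 y -> 'd M2 y v = m2 * M2 y ->
  M1 y != 0 -> M2 y != 0 -> l1 + l2 = m1 + m2 ->
  differentiable (fun y => N1 y * N2 y * (M1 y * M2 y)^-1) y /\
  'd (fun y => N1 y * N2 y * (M1 y * M2 y)^-1) y v = 0.
Proof.
move=> n1 n2 d1 d2 E1 E2 E3 E4 M10 M20 lm.
have n12 : differentiable (N1 * N2) y by exact: differentiableM.
have d12 : differentiable (M1 * M2) y by exact: differentiableM.
have M12 : (M1 * M2) y != 0 by rewrite mulf_neq0.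
have di : differentiable (fun z => ((M1 * M2) z)^-1) y by exact: differentiableV.
have dq : differentiable (N1 * N2 * (fun z => ((M1 * M2) z)^-1)) y.
  exact: differentiableM.
split; first exact: dq.
have isd (h : V -> C) : differentiable h y -> is_derive y v h ('d h y v).
  by move=> hd; rewrite -deriveE//; exact/derivableP/diff_derivable.
have I1 : is_derive y v N1 (l1 * N1 y) by rewrite -E1; exact: isd.
have I2 : is_derive y v N2 (l2 * N2 y) by rewrite -E2; exact: isd.
have I3 : is_derive y v M1 (m1 * M1 y) by rewrite -E3; exact: isd.
have I4 : is_derive y v M2 (m2 * M2 y) by rewrite -E4; exact: isd.
have J1 := is_deriveM I1 I2; have J2 := is_deriveM I3 I4.
have J3 : is_derive y v (fun z => ((M1 * M2) z)^-1)
    (- ((M1 * M2) y) ^- 2 *: (M1 y *: (m2 * M2 y) + M2 y *: (m1 * M1 y))).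
  split; first by apply: derivableV => //; case: J2.
  by rewrite deriveV//; case: J2 => _ ->.
have [_ J4] := is_deriveM J1 J3.
apply: (etrans (esym (deriveE v dq))); apply: (etrans J4).
rewrite -[(M1 * M2) y]/(M1 y * M2 y) -[(N1 * N2) y]/(N1 y * N2 y).
have -> : l1 = m1 + m2 - l2 by rewrite -lm addrK.
rewrite /GRing.scale/=.
move: (M1 y) (M2 y) (N1 y) (N2 y) M10 M20 => p q a b p0 q0.
by field; rewrite p0 q0.
Qed.

(** By [lam_eq] the quotient [q] has zero derivative along the segment from cj a to cj w; equating
    its end values and clearing denominators gives the identity. *)
Lemma ident_near (a : V) : D a -> exists2 r : R, 0 < r &
  forall z w, nrm (z - a) < r -> nrm (w - a) < r -> ident a z w.
Proof.
move=> Da; have [r [r0 rD rE]] := lam_eq Da.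
exists r => // x w xa wa.
have aa : nrm (a - a) < r by rewrite subrr nrm0.
pose y := cj w; pose v := y - cj a.
have ya : nrm (y - cj a) < r by rewrite -cjB nrm_cj.
have pth (t : R) : 0 <= t <= 1 -> nrm (cj a + t%:C *: v - cj a) < r.
  move=> /andP[t0 t1]; rewrite addrAC subrr add0r nrmZ nrm_real ger0_norm//.
  by apply: le_lt_trans ya; rewrite ler_piMl ?nrm_ge0.
pose q (y : V) := kap F (x, y) * kap G (a, y) * (kap G (x, y) * kap F (a, y))^-1.
have H : (fun t : R => q (cj a + t%:C *: v)) 1 = (fun t : R => q (cj a + t%:C *: v)) 0.
  apply: (@pder0_cst R (fun t : R => q (cj a + t%:C *: v)) 0 1 ler01) => t t01; set yt := cj a + t%:C *: v.
  have yta := pth t t01.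
  have [[x1 x2] [x3 x4]] := rD _ _ xa yta; have [[a1 a2] [a3 a4]] := rD _ _ aa yta.
  have L (K : V -> V -> C) (KP : kernel_on D K) z : dom3 D K (z, yt) ->
      differentiable (fun y => kap K (z, y)) yt /\
      'd (fun y => kap K (z, y)) yt v = lam K v (z, yt) * kap K (z, yt).
    move=> [z1 z2]; have [e1 e2] := d_snd v (kap_diff oD KP z1).
    by split => //; rewrite /lam divfK.
  have [f1 f2] := L _ FP x (conj x1 x2); have [g1 g2] := L _ GP x (conj x3 x4).
  have [f3 f4] := L _ FP a (conj a1 a2); have [g3 g4] := L _ GP a (conj a3 a4).
  have lE : lam F v (x, yt) + lam G v (a, yt) = lam G v (x, yt) + lam F v (a, yt).
    have := rE x yt v xa yta => /eqP; rewrite subr_eq => /eqP ->.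
    by rewrite addrAC subrK addrC.
  have [dq dq0] := ratio_derive f1 g3 g1 f3 f2 g4 g2 f4 x4 a2 lE.
  have := @pder_diff R _ _ q (fun t : R => cj a + t%:C *: v) t v dq (@pder_affine _ _ _ _ t).
  by rewrite dq0.
move: H => /=; rewrite scale0r addr0 scale1r (_ : cj a + v = y); last by rewrite /v addrC subrK.
rewrite /q /kap/= /y !cjK => H.
have aca : nrm (cj a - cj a) < r by rewrite subrr nrm0.
have [[_ x2] [_ x4]] := rD _ _ xa ya; have [[_ a2] [_ a4]] := rD _ _ aa ya.
have [[_ b2] [_ b4]] := rD _ _ xa aca; have [[_ c2] [_ c4]] := rD _ _ aa aca.
move: x2 x4 a2 a4 b2 b4 c2 c4; rewrite /kap/= /y !cjK => x2 x4 a2 a4 b2 b4 c2 c4.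
rewrite /ident; move/eqP: H; rewrite eqr_div ?mulf_neq0// => /eqP H.
transitivity (F x w * G a w * (G x a * F a a)); first by ring.
by rewrite H; ring.
Qed.

Lemma ident_ext (a w : V) (r : R) : D a -> D w -> 0 < r ->
  (forall z, nrm (z - a) < r -> ident a z w) -> forall z, D z -> ident a z w.
Proof.
move=> Da Dw r0 near z Dz.
have [F1 _ _ _] := FP; have [G1 _ _ _] := GP.
pose H : V -> C := (F ^~ w) * cst (G a w) * (G ^~ a) * cst (F a a)
  - (G ^~ w) * cst (F a w) * (F ^~ a) * cst (G a a).
suff : H z = 0 by move=> /subr0_eq.
apply: (@identity_open R V D H a r oD cD _ Da r0 _ z Dz) => x.
  move=> Dx; have := F1 x w Dx Dw; have := F1 x a Dx Da; have := G1 x w Dx Dw; have := G1 x a Dx Da.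
  move=> h1 h2 h3 h4; apply: differentiableB.
    apply: differentiableM; last exact: differentiable_cst.
    apply: differentiableM; last exact: h1.
    by apply: differentiableM; [exact: h4|exact: differentiable_cst].
  apply: differentiableM; last exact: differentiable_cst.
  apply: differentiableM; last exact: h3.
  by apply: differentiableM; [exact: h2|exact: differentiable_cst].
by move=> /near H0; apply/eqP; rewrite subr_eq0; apply/eqP.
Qed.

(** Conjugation exchanges [z] and [w], so that an extension in the first variable can be followed by
    one in the second. *)
Lemma ident_sym (a z w : V) : D a -> D z -> D w -> ident a z w -> ident a w z.
Proof.
move=> Da Dz Dw; have [_ F2 _ _] := FP; have [_ G2 _ _] := GP.
rewrite /ident => H.
rewrite (F2 w z)// (G2 a z)// (G2 w a)// (F2 a a)// (G2 w z)// (F2 a z)// (F2 w a)// (G2 a a)//.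
rewrite -!conjC_M; congr conjc.
transitivity (F z w * G a w * G z a * F a a); first by ring.
by rewrite H; ring.
Qed.

(* Equality of the metrics, once polarized, says that the logarithmic derivatives
   [lam F] and [lam G] differ by a function of the second variable alone; hence
   [F (z, w) G (a, w) / (G (z, w) F (a, w))] does not depend on [w]. *)
Lemma kernel_identity (a z w : V) : D a -> D z -> D w ->
  F z w * G a w * G z a * F a a = G z w * F a w * F z a * G a a.
Proof.
move=> Da Dz Dw; have [r1 r10 r1P] := open_nrm oD Da.
have [r2 r20 r2P] := ident_near Da.
pose r := Num.min r1 r2; have r0 : 0 < r by rewrite lt_min r10.
have rD x : nrm (x - a) < r -> D x by rewrite lt_min => /andP[/r1P].
have S1 x y : D x -> nrm (y - a) < r -> ident a x y.
  move=> Dx ya; apply: (ident_ext Da (rD _ ya) r0) => // x'.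
  by move: ya; rewrite !lt_min => /andP[_ ya] /andP[_ xa]; exact: r2P.
apply: (ident_ext Da Dw r0) => // x xa.
by apply: ident_sym => //; [exact: rD|apply: S1].
Qed.

End two_kernels.

Section pullback.
Variables (n m : nat) (D1 : set 'rV[C]_n) (D2 : set 'rV[C]_m).
Variables (K : 'rV[C]_m -> 'rV[C]_m -> C) (f : 'rV[C]_n -> 'rV[C]_m).
Hypotheses (oD1 : open D1) (oD2 : open D2) (KP : kernel_on D2 K).
Hypotheses (fd : forall z, D1 z -> differentiable f z) (fD : forall z, D1 z -> D2 (f z)).

Definition pull (z w : 'rV[C]_n) : C := K (f z) (f w).

Lemma pull_kernel : kernel_on D1 pull.
Proof.
have [k1 k2 k3 k4] := KP; split.
- move=> z w Dz Dw.
  exact: (@differentiable_comp _ _ _ _ f (K ^~ (f w)) z (fd Dz) (k1 _ _ (fD Dz) (fD Dw))).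
- by move=> z w Dz Dw; apply: k2; exact: fD.
- by move=> z Dz; apply: k3; exact: fD.
move=> a b Da Db; have [r [M [r0 rM]]] := k4 _ _ (fD Da) (fD Db).
have [d1 d10 d1P] := Dif_continuous (diff_Dif (fd Da)) r0.
have [d2 d20 d2P] := Dif_continuous (diff_Dif (fd Db)) r0.
exists (Num.min d1 d2), M; split; first by rewrite lt_min d10.
by move=> x y; rewrite !lt_min => /andP[/d1P x1 _] /andP[_ /d2P y2]; exact: rM.
Qed.

(** On pairs the map becomes (x, y) to (f x, cj (f (cj y))), holomorphic in each variable; the chain
    rule is applied in the second variable, then in the first. *)
Lemma pull_lam z u v : D1 z ->
  'd (lam pull (cj v)) (z, cj z) (u, 0) =
  'd (lam K (cj ('d f z v))) (f z, cj (f z)) ('d f z u, 0).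
Proof.
move=> Dz; pose fs y := cj (f (cj y)).
have Dz' : D1 (cj (cj z)) by rewrite cjK.
have fszd : differentiable fs (cj z) := (diff_conjV (fd Dz')).1.
have fsz : fs (cj z) = cj (f z) by rewrite /fs cjK.
have dfs : 'd fs (cj z) (cj v) = cj ('d f z v).
  apply: (etrans (congr1 (fun g : _ -> 'rV[C]_m => g (cj v)) (diff_conjV (fd Dz')).2)).
  by rewrite !cjK.
have D3z (k : nat) (A : set 'rV[C]_k) L (LP : kernel_on A L) x : A x -> dom3 A L (x, cj x).
  by move=> Ax; split; [split; rewrite //= cjK|exact: (kap_diag_neq0 LP)].
have lE x : D1 x -> lam pull (cj v) (x, cj z) = lam K (cj ('d f z v)) (f x, cj (f z)).
  move=> Dx; rewrite /lam.
  have P2 : dom2 D1 (x, cj z) by split.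
  have Q2 : dom2 D2 (f x, fs (cj z)) by split; rewrite /= ?fsz ?cjK; exact: fD.
  have [_ ->] := d_snd (cj v) (kap_diff oD1 pull_kernel P2).
  have Kd := kap_diff oD2 KP Q2.
  have [e1 e2] := d_snd ('d fs (cj z) (cj v)) Kd.
  have kE y : kap pull (x, y) = kap K (f x, fs y) by rewrite /kap/= /fs cjK.
  have -> : (fun y => kap pull (x, y)) = (fun y => kap K (f x, fs y)).
    by apply/funext => y; exact: kE.
  have H : 'd (fun y => kap K (f x, fs y)) (cj z) (cj v) =
      'd (kap K) (f x, cj (f z)) (0, cj ('d f z v)).
    apply: (etrans (@diff_compE _ _ _ fs (fun y => kap K (f x, y)) (cj z) (cj v) fszd e1)).
    apply: (etrans (esym e2)).
    exact: (congr2 (fun a b => 'd (kap K) (f x, a) (0, b)) fsz dfs).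
  have H2 : kap pull (x, cj z) = kap K (f x, cj (f z)) by rewrite kE fsz.
  exact: (congr2 (fun a b : C => a / b) H H2).
have [l1 ->] := d_fst u (lam_diff oD1 pull_kernel (cj v) (D3z _ _ _ pull_kernel _ Dz)).
have Lz := lam_diff oD2 KP (cj ('d f z v)) (D3z _ _ _ KP _ (fD Dz)).
have [l2 ->] := d_fst ('d f z u) Lz.
rewrite -(@diff_compE _ _ _ f (fun x => lam K (cj ('d f z v)) (x, cj (f z))) z u (fd Dz) l2).
have [r r0 rP] := open_nrm oD1 Dz.
have [_ E] := diff_ext r0 (fun y yz => lE y (rP y yz)) l1.
exact: (esym (congr1 (fun g : 'rV[C]_n -> C => g u) E)).
Qed.

End pullback.

End isometry.

(** * Integration over discs and polydiscs *)

Section measure.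
Context (R : realType).
Local Notation C := R[i].
Local Notation Re := (@complex.Re R).
Local Notation Im := (@complex.Im R).
Local Notation T2 := (measurableTypeR R * measurableTypeR R)%type.

(** Boxes with rational centres and half-width 1 / (m + 1) form a countable base, so that open sets
    are countable unions of measurable boxes. *)
Definition box n (q : n.-tuple (rat * rat)) (m : nat) : set (n.-tuple T2) :=
  \bigcap_(j in [set: 'I_n]) (fun t : n.-tuple T2 => tnth t j) @^-1`
    ([set` `](ratr (tnth q j).1 - m.+1%:R^-1), (ratr (tnth q j).1 + m.+1%:R^-1)[ ] `*`
     [set` `](ratr (tnth q j).2 - m.+1%:R^-1), (ratr (tnth q j).2 + m.+1%:R^-1)[ ]).

Lemma measurable_box n (q : n.-tuple (rat * rat)) m : measurable (box q m).
Proof.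
apply: fin_bigcap_measurable => [|j _]; first exact: finite_finset.
rewrite -[X in measurable X]setTI.
by apply: (@measurable_tnth _ T2 n j measurableT); apply: measurableX; exact: measurable_itv.
Qed.

Lemma box_dist n (q : n.-tuple (rat * rat)) m (t s : n.-tuple T2) : box q m t -> box q m s ->
  nrm (toC s - toC t) < 4 * m.+1%:R^-1.
Proof.
move=> qt qs; have m0 : 0 < m.+1%:R^-1 :> R by rewrite invr_gt0.
apply: nrm_lt_coord => [|j]; first by rewrite mulr_gt0.
have := qt j I; have := qs j I; rewrite /= !mxE.
move: (tnth t j) (tnth s j) => [x y] [x' y'] /=; rewrite !in_itv/=.
move: (ratr _) (ratr _) (m.+1%:R^-1) m0 => a b e e0.
move=> [/andP[h1 h2] /andP[h3 h4]] [/andP[h5 h6] /andP[h7 h8]].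
apply: (le_lt_trans (nrm_le_ReIm _)) => /=.
have -> : 4 * e = 2 * e + 2 * e by ring.
by apply: ltrD; rewrite ltr_norml; apply/andP; split; lra.
Qed.

Lemma box_exists n (t : n.-tuple T2) m : exists q, box q m t.
Proof.
have m0 : 0 < m.+1%:R^-1 :> R by rewrite invr_gt0.
have ex (x : R) : exists q : rat, x \in `](ratr q - m.+1%:R^-1), (ratr q + m.+1%:R^-1)[.
  have [|q] := @rat_in_itvoo R (x - m.+1%:R^-1) (x + m.+1%:R^-1).
    by rewrite ltrD2l gtrN.
  rewrite in_itv/= => /andP[h1 h2]; exists q; rewrite in_itv/=.
  by rewrite ltrBlDr h2/= -ltrBlDr h1.
have /choice[F FP] : forall x : T2, exists q : rat * rat,
    (x.1 \in `](ratr q.1 - m.+1%:R^-1), (ratr q.1 + m.+1%:R^-1)[) /\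
    (x.2 \in `](ratr q.2 - m.+1%:R^-1), (ratr q.2 + m.+1%:R^-1)[).
  by move=> [x y]; have [p pP] := ex x; have [q qP] := ex y; exists (p, q).
by exists [tuple F (tnth t j) | j < n] => j _; rewrite /= tnth_mktuple; exact: FP.
Qed.

Lemma measurable_open n (U : set 'rV[C]_n) : open U -> measurable (@toC R n @^-1` U).
Proof.
move=> oU.
(* An enumeration of all boxes in which those not contained in [U] are replaced by the empty set. *)
pose F k : set (n.-tuple T2) :=
  if @unpickle (n.-tuple (rat * rat) * nat)%type k is Some qm then
    if pselect (box qm.1 qm.2 `<=` @toC R n @^-1` U) then box qm.1 qm.2 else set0
  else set0.
have -> : @toC R n @^-1` U = \bigcup_k F k.
  apply/seteqP; split=> [t /= Ut|t [k _]]; last first.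
    rewrite /F; case: unpickle => [[q m]|]//; case: pselect => // H; exact: H.
  have [e e0 eP] := open_nrm oU Ut.
  have e4 : 0 < e / 4 by rewrite divr_gt0.
  have [m _ mP] := near_infty_natSinv_lt (PosNum e4).
  have {}mP : m.+1%:R^-1 < e / 4 := mP m (leqnn m).
  have [q qt] := box_exists t m.
  exists (pickle (q, m)) => //; rewrite /F pickleK; case: pselect => // -[] s qs /=.
  apply: eP; apply: lt_trans (box_dist qt qs) _.
  by rewrite mulrC -ltr_pdivlMr.
apply: bigcupT_measurable => k; rewrite /F; case: unpickle => [[q m]|]; last exact: measurable0.
by case: (pselect _) => H /=; [exact: measurable_box|exact: measurable0].
Qed.

Lemma measurable_cont n (D : set 'rV[C]_n) (g : 'rV[C]_n -> R) : open D ->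
  (forall z, D z -> {for z, continuous g}) ->
  measurable_fun (@toC R n @^-1` D) (g \o @toC R n).
Proof.
move=> oD gc; apply: (measurability _ (measurable_realfun.RGenOpens.measurableE R)).
move=> _ [_ [a [b ->] <-]].
have -> : @toC R n @^-1` D `&` (g \o @toC R n) @^-1` `]a, b[%classic =
    @toC R n @^-1` (D `&` g @^-1` `]a, b[%classic) by [].
apply: measurable_open; rewrite openE => z [Dz gz].
have oI : open `]a, b[%classic by exact: interval_open.
apply: filterI; first exact: open_nbhs_nbhs.
by apply: (gc z Dz); exact: open_nbhs_nbhs.
Qed.

Lemma measurable_holo n (D : set 'rV[C]_n) (h : 'rV[C]_n -> C) : open D ->
  (forall z, D z -> differentiable h z) ->
  measurable_fun (@toC R n @^-1` D) (fun t => Re (h (toC t))) /\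
  measurable_fun (@toC R n @^-1` D) (fun t => Im (h (toC t))).
Proof.
move=> oD hd; split.
- apply: (@measurable_cont n D (Re \o h)) => // z /hd /differentiable_continuous; exact: cont_Re.
- apply: (@measurable_cont n D (Im \o h)) => // z /hd /differentiable_continuous; exact: cont_Im.
Qed.

Definition pt (p : T2) : C := p.1 +i* p.2.

Let sing (p : T2) : 1.-tuple T2 := [tuple of [:: p]].

Let measurable_sing : measurable_fun [set: T2] sing.
Proof. by apply: measurable_cons; [exact: measurable_id|exact: measurable_cst]. Qed.

Let toC_sing p : (toC (sing p)) 0 0 = pt p.
Proof. by rewrite !mxE. Qed.

Lemma cont_coord n (j : 'I_n) : continuous (fun v : 'rV[C]_n => v 0 j).
Proof.
move=> v; apply/cont_nrmP => e e0; apply/nbhs_nrm; exists e => // y yv.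
by apply: le_lt_trans yv; have := nrm_coord (y - v) j; rewrite !mxE.
Qed.

Lemma measurable_openC (U : set C) : open U -> measurable (pt @^-1` U).
Proof.
move=> oU.
have oV : open [set v : 'rV[C]_1 | U (v 0 0)].
  by apply: open_comp => // v _; exact: cont_coord.
have := measurable_sing measurableT (measurable_open oV); rewrite setTI.
by congr measurable; apply/seteqP; split => p /=; rewrite toC_sing.
Qed.

Lemma measurable_closedC (U : set C) : closed U -> measurable (pt @^-1` U).
Proof.
move=> cU; rewrite -[X in measurable X]setCK; apply: measurableC.
by apply: (@measurable_openC (~` U)); exact: closed_openC.
Qed.

Lemma measurable_contC (D : set C) (g : C -> R) : open D ->
  (forall z, D z -> {for z, continuous g}) ->
  measurable_fun (pt @^-1` D) (g \o pt).
Proof.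
move=> oD gc; apply: (measurability _ (measurable_realfun.RGenOpens.measurableE R)).
move=> _ [_ [a [b ->] <-]].
have -> : pt @^-1` D `&` (g \o pt) @^-1` `]a, b[%classic =
    pt @^-1` (D `&` g @^-1` `]a, b[%classic) by [].
apply: measurable_openC; rewrite openE => z [Dz gz].
have oI : open `]a, b[%classic by exact: interval_open.
apply: filterI; first exact: open_nbhs_nbhs.
by apply: (gc z Dz); exact: open_nbhs_nbhs.
Qed.

Definition poly n (Q : 'I_n -> set T2) : set (n.-tuple T2) :=
  \bigcap_(j in [set: 'I_n]) (fun t : n.-tuple T2 => tnth t j) @^-1` Q j.

Lemma measurable_poly n (Q : 'I_n -> set T2) : (forall j, measurable (Q j)) ->
  measurable (poly Q).
Proof.
move=> mQ; apply: fin_bigcap_measurable => [|j _]; first exact: finite_finset.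
rewrite -[X in measurable X]setTI.
by apply: (@measurable_tnth _ T2 n j measurableT).
Qed.

Lemma poly_cons n (Q : 'I_n.+1 -> set T2) :
  @cons_tuple _ T2 n @^-1` poly Q = Q ord0 `*` poly (fun j => Q (lift ord0 j)).
Proof.
apply/seteqP; split => -[p t].
  move=> H; split; first by have := H ord0 I; rewrite /= tnth0.
  by move=> j _; have := H (lift ord0 j) I; rewrite /= tnthS.
move=> [/= H1 H2] j _ /=; case: (unliftP ord0 j) => [i ->|->]; last by rewrite tnth0.
by rewrite tnthS; exact: H2.
Qed.

Lemma dV_poly n (Q : 'I_n -> set T2) : (forall j, measurable (Q j)) ->
  (forall j, (@lebesgue_plane R (Q j) < +oo)%E) -> (dV R n (poly Q) < +oo)%E.
Proof.
elim: n Q => [|n IH] Q mQ Qoo.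
  rewrite /dV/= diracE; case: (_ \in _); exact: ltry.
rewrite /dV/= /cons_measure /pushforward poly_cons product_measure1E//; last first.
  by apply: measurable_poly => j.
apply: lte_mul_pinfty; [exact: measure_ge0| |exact: IH].
by rewrite ge0_fin_numE ?Qoo//; exact: measure_ge0.
Qed.

Lemma plane_box (a b c d : R) :
  (@lebesgue_plane R (`[a, b]%classic `*` `[c, d]%classic) < +oo)%E.
Proof.
rewrite /lebesgue_plane product_measure1E//.
rewrite lte_mul_pinfty//; last first.
  by have := lebesgue_measure_itv `[c, d]; rewrite /= => ->; case: ifP => _; rewrite -?EFinB ltry.
by have := lebesgue_measure_itv `[a, b]; rewrite /= => ->; case: ifP => _; rewrite -?EFinB.
Qed.

Lemma bounded_nrm (V : normedModType C) (D : set V) : bounded_set D ->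
  exists2 M : R, 0 < M & forall x, D x -> nrm x <= M.
Proof.
move=> [M0 [M0r MP]]; pose M := nrm M0 + 1.
have lt : M0 < M%:C.
  have /le_lt_trans -> // : M0 <= (nrm M0)%:C by rewrite -nrmE; exact: real_ler_norm.
  by rewrite ltcR /M ltrDl.
exists M; first by rewrite ltr_wpDl ?nrm_ge0.
by move=> x Dx; have := MP _ lt x Dx; rewrite /= nrmE lecR.
Qed.

Lemma dV_bounded n (D : set 'rV[C]_n) : open D -> bounded_set D ->
  (dV R n (@toC R n @^-1` D) < +oo)%E.
Proof.
move=> oD /bounded_nrm[M M0 MP].
pose Q (j : 'I_n) : set T2 := `[(- M), M]%classic `*` `[(- M), M]%classic.
have mQ j : measurable (Q j) by apply: measurableX; exact: measurable_itv.
apply: le_lt_trans (@dV_poly n Q mQ (fun _ => plane_box _ _ _ _)).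
apply: le_measure; rewrite ?inE; [exact: measurable_open|exact: measurable_poly|].
move=> t /MP tM j _ /=; have := le_trans (nrm_coord (toC t) j) tM.
move: (Re_le_nrm (toC t 0 j)) (Im_le_nrm (toC t 0 j)); rewrite !mxE/=.
move: (nrm _) => N h1 h2 NM; rewrite /Q/= !in_itv/= -!ler_norml.
by split; exact: le_trans NM.
Qed.

(** Heine-Borel is applied to real row vectors, so C^n is read as R^(2n). *)
Definition ofR2 n (v : 'rV[R]_(n + n)) : 'rV[C]_n :=
  \row_j (v 0 (lshift n j) +i* v 0 (rshift n j)).

Lemma mx_coord_le n (v : 'rV[R]_n) (i : 'I_n) : `|v 0 i| <= `|v|.
Proof.
apply/ler_addgt0Pr => e e0; apply/ltW.
have : ball (0 : 'rV[R]_n) (`|v| + e) v by rewrite -ball_normE/= sub0r normrN ltrDl.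
by case=> _ /(_ 0 i); rewrite -ball_normE/= mxE sub0r normrN.
Qed.

Lemma mx_le_coord n (v : 'rV[R]_n) (M : R) : 0 < M -> (forall i, `|v 0 i| < M) -> `|v| < M.
Proof.
move=> M0 vM; have : ball (0 : 'rV[R]_n) M v.
  by split=> // i j; rewrite -ball_normE/= mxE sub0r normrN ord1; exact: vM.
by rewrite -ball_normE/= sub0r normrN.
Qed.

Lemma ofR2_cont n : continuous (@ofR2 n).
Proof.
move=> v; apply/cont_nrmP => e e0; have e2 : 0 < e / 2 by rewrite divr_gt0.
apply/nbhs_ballP; exists (e / 2) => //= u; rewrite -ball_normE/= => vu.
apply: nrm_lt_coord => // j.
have H (k : 'I_(n + n)) : `|u 0 k - v 0 k| < e / 2.
  apply: le_lt_trans vu; rewrite distrC.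
  by have := mx_coord_le (v - u) k; rewrite !mxE.
rewrite !mxE; apply: (le_lt_trans (nrm_le_ReIm _)) => /=.
by rewrite [ltRHS](splitr e) ltrD.
Qed.

Lemma cont_bounded n (K : set 'rV[C]_n) (g : 'rV[C]_n -> R) (N : R) :
  (forall x, K x -> nrm x <= N) -> closed K -> {within K, continuous g} ->
  exists2 M : R, 0 < M & forall x, K x -> `|g x| <= M.
Proof.
move=> KN clK gc; pose K' := @ofR2 n @^-1` K.
have cK : compact K'.
  apply: bounded_closed_compact; last first.
    by apply: closed_comp => // x _; exact: ofR2_cont.
  exists (`|N| + 1); split => [|M NM v /KN vN /=]; first exact: num_real.
  have M0 : 0 < M by apply: lt_trans NM; rewrite ltr_wpDl.
  have {}NM : N < M by apply: lt_trans NM; rewrite (le_lt_trans (ler_norm N))// ltrDl.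
  apply/ltW/mx_le_coord => // k.
  have [[j ->]|[j ->]] : (exists j, k = lshift n j) \/ (exists j, k = rshift n j).
  - by rewrite -(splitK k); case: (fintype.split k) => j; [left|right]; exists j.
  - have := nrm_coord (ofR2 v) j; rewrite mxE => h; apply: le_lt_trans NM.
    by apply: le_trans vN; apply: le_trans h; exact: (Re_le_nrm (_ +i* _)).
  - have := nrm_coord (ofR2 v) j; rewrite mxE => h; apply: le_lt_trans NM.
    by apply: le_trans vN; apply: le_trans h; exact: (Im_le_nrm (_ +i* _)).
have cg : {within K', continuous (g \o @ofR2 n)}.
  apply/subspace_continuousP => v Kv; move/subspace_continuousP : gc => /(_ _ Kv) gc.
  by move=> A /gc; exact: ofR2_cont.
have /compact_bounded[M [_ MP]] := continuous_compact cg cK.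
exists (`|M| + 1); first by rewrite ltr_wpDl.
move=> x Dx; pose v : 'rV[R]_(n + n) := row_mx (\row_j Re (x 0 j)) (\row_j Im (x 0 j)).
have vx : ofR2 v = x by apply/rowP => j; rewrite mxE /v row_mxEl row_mxEr !mxE; case: (x 0 j).
apply: (MP (`|M| + 1)).
  by rewrite (le_lt_trans (ler_norm M))// ltrDl.
by exists v => /=; [rewrite /K'/= vx|rewrite vx].
Qed.

Lemma cont_boundedC (K : set C) (g : C -> R) (N : R) :
  (forall x, K x -> nrm x <= N) -> closed K -> (forall x, K x -> {for x, continuous g}) ->
  exists2 M : R, 0 < M & forall x, K x -> `|g x| <= M.
Proof.
move=> KN clK gc.
have [|||M M0 MP] := @cont_bounded 1 [set v | K (v 0 0)] (fun v => g (v 0 0)) (`|N| + 1).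
- move=> v /= /KN vN; apply/ltW/nrm_lt_coord; first by rewrite ltr_wpDl.
  move=> i; rewrite ord1; apply: le_lt_trans vN _.
  by rewrite (le_lt_trans (ler_norm N))// ltrDl.
- by apply: closed_comp => // v _; exact: cont_coord.
- apply: cont_on_within => v Kv.
  exact: (@continuous_comp _ _ _ (fun v : 'rV[C]_1 => v 0 0) g v (@cont_coord 1 0 v) (gc _ Kv)).
exists M => // x Kx; have := MP (\row__ x); rewrite /= mxE; exact.
Qed.

(** Continuity up to the boundary enters here: the closure of a bounded set is compact. It makes
    constants square integrable. *)
Lemma weight_bounded n (D : set 'rV[C]_n) (mu : 'rV[C]_n -> R) : bounded_set D ->
  weight D mu -> exists2 M : R, 0 < M & forall x, closure D x -> mu x <= M.
Proof.
move=> /bounded_nrm[N N0 NP] [muc mu0].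
have cN x : closure D x -> nrm x <= N + 1.
  move=> Dx; have [y [Dy]] : (D `&` [set y | nrm (y - x) < 1]) !=set0.
    by apply: Dx; apply/nbhs_nrm; exists 1.
  rewrite /= => yx; apply: le_trans (_ : nrm y + 1 <= _); last by rewrite lerD2r NP.
  have := nrm_tri x 0 y; rewrite !subr0 addrC => /le_trans; apply.
  by rewrite lerD2l nrmBC ltW.
have [M M0 MP] := cont_bounded cN (@closed_closure _ D) muc.
by exists M => // x /MP; apply: le_trans; exact: ler_norm.
Qed.

Lemma weight_cont n (D : set 'rV[C]_n) (mu : 'rV[C]_n -> R) : open D -> weight D mu ->
  forall x, D x -> {for x, continuous mu}.
Proof.
move=> oD [muc _] x Dx.
have := continuous_subspaceW (@subset_closure _ D) muc.
by rewrite continuous_open_subspace// => /(_ x); apply; rewrite inE.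
Qed.

End measure.

(** * Complex-valued integrals over a measure space *)

Section intC.
Context d (T : measurableType d) (R : realType) (m : {measure set T -> \bar R}).
Variable A : set T.
Hypothesis mA : measurable A.
Local Notation C := R[i].
Local Notation Re := (@complex.Re R).
Local Notation Im := (@complex.Im R).

Definition intC (F : T -> C) : C := (\int[m]_(t in A) Re (F t)) +i* (\int[m]_(t in A) Im (F t)).

Definition integrC (F : T -> C) :=
  m.-integrable A (EFin \o (Re \o F)) /\ m.-integrable A (EFin \o (Im \o F)).

Definition measC (F : T -> C) := measurable_fun A (Re \o F) /\ measurable_fun A (Im \o F).

Lemma cReD (x y : C) : Re (x + y) = Re x + Re y. Proof. exact: raddfD. Qed.
Lemma cImD (x y : C) : Im (x + y) = Im x + Im y. Proof. exact: raddfD. Qed.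
Lemma cReM (x y : C) : Re (x * y) = Re x * Re y - Im x * Im y.
Proof. by case: x; case: y. Qed.
Lemma cImM (x y : C) : Im (x * y) = Re x * Im y + Im x * Re y.
Proof. by case: x; case: y. Qed.
Lemma eqReIm (x y : C) : Re x = Re y -> Im x = Im y -> x = y.
Proof. by case: x => ? ?; case: y => ? ? /= -> ->. Qed.

Lemma measC_M F G : measC F -> measC G -> measC (fun t => F t * G t).
Proof.
move=> [F1 F2] [G1 G2]; split.
  rewrite (_ : _ \o _ = ((Re \o F) \* (Re \o G)) \- ((Im \o F) \* (Im \o G))).
    by apply: measurable_funB; apply: measurable_funM.
  by apply/funext => t; exact: cReM.
rewrite (_ : _ \o _ = ((Re \o F) \* (Im \o G)) \+ ((Im \o F) \* (Re \o G))).
  by apply: measurable_funD; apply: measurable_funM.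
by apply/funext => t; exact: cImM.
Qed.

Lemma measC_conj F : measC F -> measC (fun t => conjc (F t)).
Proof.
move=> [F1 F2]; split.
  by rewrite (_ : _ \o _ = Re \o F)//; apply/funext => t /=; case: (F t).
rewrite (_ : _ \o _ = \- (Im \o F)); first exact: measurableT_comp.
by apply/funext => t /=; case: (F t).
Qed.

Lemma measC_cst c : measC (cst c).
Proof. by split; exact: measurable_cst. Qed.

Lemma measC_real (f : T -> R) : measurable_fun A f -> measC (fun t => (f t)%:C).
Proof. by move=> mf; split => //; exact: measurable_cst. Qed.

Lemma eq_intC F G : (forall t, A t -> F t = G t) -> intC F = intC G.
Proof. by move=> FG; congr (_ +i* _); apply: eq_Rintegral => t /set_mem /FG ->. Qed.

Lemma intrD (f g : T -> R) : m.-integrable A (EFin \o f) -> m.-integrable A (EFin \o g) ->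
  m.-integrable A (EFin \o (fun t => f t + g t)).
Proof. by move=> fi gi; exact: (integrableD mA fi gi). Qed.

Lemma intrZ (c : R) (f : T -> R) : m.-integrable A (EFin \o f) ->
  m.-integrable A (EFin \o (fun t => c * f t)).
Proof. by move=> fi; exact: (integrableZl mA c fi). Qed.

Lemma integrC_D F G : integrC F -> integrC G -> integrC (fun t => F t + G t).
Proof.
move=> [F1 F2] [G1 G2]; split.
  rewrite (_ : _ \o _ = EFin \o (fun t => Re (F t) + Re (G t))); first exact: intrD.
  by apply/funext => t /=; rewrite cReD.
rewrite (_ : _ \o _ = EFin \o (fun t => Im (F t) + Im (G t))); first exact: intrD.
by apply/funext => t /=; rewrite cImD.
Qed.

Lemma integrC_Z c F : integrC F -> integrC (fun t => c * F t).
Proof.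
move=> [F1 F2]; split.
  rewrite (_ : _ \o _ = EFin \o (fun t => Re c * Re (F t) + - Im c * Im (F t))).
    by apply: intrD; exact: intrZ.
  by apply/funext => t /=; rewrite cReM mulNr.
rewrite (_ : _ \o _ = EFin \o (fun t => Re c * Im (F t) + Im c * Re (F t))).
  by apply: intrD; exact: intrZ.
by apply/funext => t /=; rewrite cImM.
Qed.

Lemma intC_D F G : integrC F -> integrC G -> intC (fun t => F t + G t) = intC F + intC G.
Proof.
move=> [F1 F2] [G1 G2]; apply: eqReIm => /=.
  by rewrite -RintegralD//; apply: eq_Rintegral => t _; exact: cReD.
by rewrite -RintegralD//; apply: eq_Rintegral => t _; exact: cImD.
Qed.

Lemma intC_Z c F : integrC F -> intC (fun t => c * F t) = c * intC F.
Proof.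
move=> [F1 F2]; apply: eqReIm => /=.
  rewrite cReM/= -!RintegralZl// -RintegralB//; [|exact: intrZ|exact: intrZ].
  by apply: eq_Rintegral => t _; exact: cReM.
rewrite cImM/= -!RintegralZl// -RintegralD//; [|exact: intrZ|exact: intrZ].
by apply: eq_Rintegral => t _; exact: cImM.
Qed.

Lemma intC_conj F : integrC F -> intC (fun t => conjc (F t)) = conjc (intC F).
Proof.
move=> [F1 F2]; apply: eqReIm => /=; first by apply: eq_Rintegral => t _; case: (F t).
rewrite -mulN1r -RintegralZl//; apply: eq_Rintegral => t _.
by case: (F t) => a b /=; rewrite mulN1r.
Qed.

Lemma integrC_dom F (g : T -> R) : measC F -> m.-integrable A (EFin \o g) ->
  (forall t, A t -> nrm (F t) <= g t) -> integrC F.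
Proof.
move=> [F1 F2] gi Fg; split.
  apply: (le_integrable mA _ _ gi); first exact/measurable_EFinP.
  move=> t At; rewrite /= lee_fin (le_trans _ (ler_norm _))// (le_trans _ (Fg t At))//.
  exact: Re_le_nrm.
apply: (le_integrable mA _ _ gi); first exact/measurable_EFinP.
move=> t At; rewrite /= lee_fin (le_trans _ (ler_norm _))// (le_trans _ (Fg t At))//.
exact: Im_le_nrm.
Qed.

Lemma integrC_bounded F (M : R) : measC F -> (m A < +oo)%E ->
  (forall t, A t -> nrm (F t) <= M) -> integrC F.
Proof.
move=> mF Aoo FM; apply: (@integrC_dom F (cst M)) => //.
apply: measurable_bounded_integrable => //; exists `|M|; split; first exact: num_real.
by move=> y My t At; exact: ltW.
Qed.

(** The factor 2 accounts for real and imaginary parts; the right side may be infinite, hence the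
    extended reals. *)
Lemma intC_nrm F (g : T -> R) : integrC F -> measurable_fun A g ->
  (forall t, A t -> nrm (F t) <= g t) ->
  ((nrm (intC F))%:E <= 2%:E * \int[m]_(t in A) (g t)%:E)%E.
Proof.
move=> [F1 F2] mg Fg.
have g0 t : A t -> (0 <= (g t)%:E)%E.
  by move=> At; rewrite lee_fin (le_trans _ (Fg t At))// nrm_ge0.
have H (f : T -> R) : m.-integrable A (EFin \o f) ->
    (forall t, A t -> `|f t| <= g t) ->
    (`|\int[m]_(t in A) f t|%:E <= \int[m]_(t in A) (g t)%:E)%E.
  move=> fi fg; apply: (@le_trans _ _ (`|\int[m]_(t in A) (f t)%:E|)%E).
    by rewrite /Rintegral -abse_EFin fineK//; exact: integrable_fin_num.
  apply: le_trans (le_abse_integral _ mA _) _.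
    by move: fi => /integrableP[].
  apply: ge0_le_integral => //.
  - move: fi => /integrableP[mf _]; exact: measurableT_comp.
  - exact/measurable_EFinP.
apply: (@le_trans _ _ (`|\int[m]_(t in A) Re (F t)|%:E + `|\int[m]_(t in A) Im (F t)|%:E)%E).
  by rewrite -EFinD lee_fin; exact: nrm_le_ReIm.
rewrite (_ : 2%:E = (1 + 1)%E); last by rewrite -EFinD.
rewrite ge0_muleDl ?lee_fin// mul1e; apply: leeD; apply: H => // t At.
  by apply: le_trans (Fg t At); exact: Re_le_nrm.
by apply: le_trans (Fg t At); exact: Im_le_nrm.
Qed.

End intC.

(** * Vanishing integrals over discs *)

Section plane.
Context (R : realType).
Local Notation C := R[i].
Local Notation Re := (@complex.Re R).
Local Notation Im := (@complex.Im R).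
Local Notation T2 := (measurableTypeR R * measurableTypeR R)%type.
Local Notation mu := (@lebesgue_measure R).
Local Notation plane := (@lebesgue_plane R).

Definition cdisc (c : C) (r : R) : set C := [set z | nrm (z - c) <= r].

Lemma closed_cdisc c r : closed (cdisc c r).
Proof.
rewrite -[cdisc _ _]setCK; apply: open_closedC; rewrite openE => z /=.
rewrite /cdisc/= => /negP; rewrite -ltNge => rz.
have e0 : 0 < nrm (z - c) - r by rewrite subr_gt0.
apply/nbhs_nrm; exists (nrm (z - c) - r) => // y yz; apply/negP; rewrite -ltNge.
have := nrm_tri z c y; rewrite (nrmBC z y) => h.
move: yz; rewrite ltrBrDr => yz; rewrite -(ltrD2l (nrm (y - z))).
exact: lt_le_trans yz h.
Qed.

Lemma cdisc_plane c r : measurable (@pt R @^-1` cdisc c r).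
Proof. by apply: measurable_closedC; exact: closed_cdisc. Qed.

Lemma cdisc_fin c r : (plane (@pt R @^-1` cdisc c r) < +oo)%E.
Proof.
apply: le_lt_trans (@plane_box R (Re c - r) (Re c + r) (Im c - r) (Im c + r)).
apply: le_measure; rewrite ?inE; [exact: cdisc_plane| |].
  by apply: measurableX; exact: measurable_itv.
move=> [a b]; rewrite /cdisc /pt/= => h; rewrite /= !in_itv/= -!ler_distlC.
have h1 := le_trans (Re_le_nrm _) h; have h2 := le_trans (Im_le_nrm _) h.
by move: c h1 h2 {h} => [c1 c2] /=; split; rewrite distrC.
Qed.

(** The horizontal slice at height b is empty or an interval centred at Re c, whose ends lie on the
    circle. *)
Lemma cdisc_sec (c : C) (r a b : R) : 0 < r ->
  cdisc c r (a +i* b) <-> (b - Im c) ^+ 2 <= r ^+ 2 /\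
    `|a - Re c| <= Num.sqrt (r ^+ 2 - (b - Im c) ^+ 2).
Proof.
move=> r0; have -> : cdisc c r (a +i* b) = is_true (nrm (a +i* b - c) ^+ 2 <= r ^+ 2).
  by rewrite ler_sqr ?nnegrE ?nrm_ge0 ?(ltW r0).
rewrite nrm_sqr; case: c => x y /=.
split=> [h|[h1 h2]].
  have h1 : (b - y) ^+ 2 <= r ^+ 2 by apply: le_trans h; rewrite lerDr sqr_ge0.
  split => //; rewrite -[`|_|]ger0_norm// -sqrtr_sqr ler_sqrt ?subr_ge0//.
  by rewrite real_normK ?num_real// lerBrDr.
rewrite -lerBrDr -real_normK ?num_real//.
have s0 : 0 <= r ^+ 2 - (b - y) ^+ 2 by rewrite subr_ge0.
by rewrite -[leRHS](sqr_sqrtr s0) ler_sqr ?nnegrE ?sqrtr_ge0.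
Qed.

Section line.
Variables (c : C) (r : R) (r0 : 0 < r).
Variables (F P : C -> R) (U : set C).
Hypotheses (oU : open U) (dU : cdisc c r `<=` U).
Hypothesis Fc : forall z, U z -> {for z, continuous F}.
Hypothesis P0 : forall z, nrm (z - c) = r -> P z = 0.

Lemma cdisc_bounded : exists2 M : R, 0 < M & forall z, cdisc c r z -> `|F z| <= M.
Proof.
apply: (@cont_boundedC R (cdisc c r) F (r + nrm c)) => [z zr||z /dU/Fc//].
  have := nrm_tri z 0 c; rewrite !subr0 => /le_trans; apply; by rewrite lerD2r.
exact: closed_cdisc.
Qed.

Let A := @pt R @^-1` cdisc c r.

Lemma cdisc_meas : measurable_fun A (F \o @pt R).
Proof.
apply: (@measurable_funS _ _ _ _ (@pt R @^-1` U)); last exact: measurable_contC.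
  exact: measurable_openC.
by move=> p /dU.
Qed.

Lemma cdisc_integrable : plane.-integrable A (EFin \o (F \o @pt R)).
Proof.
have [M M0 MP] := cdisc_bounded.
apply: measurable_bounded_integrable; [exact: cdisc_plane|exact: cdisc_fin|exact: cdisc_meas|].
exists M; split; first exact: num_real.
by move=> N MN p /MP pM; exact: le_trans (ltW MN).
Qed.

Let f := (EFin \o (F \o @pt R)) \_ A.

Let fint : (mu \x mu)%E.-integrable setT f.
Proof.
apply/(integrable_mkcond (EFin \o (F \o @pt R)) (cdisc_plane c r)).
exact: cdisc_integrable.
Qed.

Lemma seg_zero (G : R -> R) (Q : R -> R) (x s : R) : 0 <= s ->
  (forall t, `|t - x| <= s -> {for t, continuous G}) ->
  (forall t, `|t - x| <= s -> is_derive t 1 Q (G t)) ->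
  Q (x + s) = 0 -> Q (x - s) = 0 ->
  (\int[mu]_(t in [set t | (`|t - x| <= s)%R]) (G t)%:E = 0)%E.
Proof.
move=> s0 Gc Gd Q1 Q2.
have -> : [set t | `|t - x| <= s] = `[(x - s), (x + s)]%classic.
  by apply/seteqP; split => t; rewrite /= in_itv/= ler_distl.
have [s00|s00] := eqVneq s 0.
  by rewrite s00 subr0 addr0 set_itv1 integral_set1.
have sp : 0 < s by rewrite lt_neqAle eq_sym s00.
have inI t : x - s <= t <= x + s -> `|t - x| <= s by rewrite ler_distl.
have Gc' : cont_on `[(x - s), (x + s)] G.
  by move=> t; rewrite /= in_itv/= => /inI /Gc.
have := @Rint_FTC R (x - s) (x + s) G Q _ Gc' (fun t h => Gd t (inI t h)).
rewrite Q1 Q2 subr0 => H.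
have fin : (\int[mu]_(t in `[(x - s)%R, (x + s)%R]) (G t)%:E)%E \is a fin_num.
  by apply: integrable_fin_num => //; exact: cont_integrable.
by rewrite -(fineK fin); congr EFin; apply: H; rewrite ltrBlDr -addrA ltrDl addr_gt0.
Qed.

(** By Fubini it suffices to integrate over slices, where the integral is a difference of two values
    of [P] on the circle. *)
Lemma disc_dx0 : (forall z, U z -> is_derive (Re z) 1 (fun a => P (a +i* Im z)) (F z)) ->
  \int[plane]_(p in A) F (pt p) = 0.
Proof.
move=> Fd; rewrite /Rintegral integral_mkcond -[RHS]/(fine 0%E); congr fine.
rewrite -[LHS](integral21_prod_meas1 fint); apply: integral0_eq => b _.
rewrite /fubini_G.
pose s := Num.sqrt (r ^+ 2 - (b - Im c) ^+ 2).
have [h|h] := leP ((b - Im c) ^+ 2) (r ^+ 2); last first.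
  apply: integral0_eq => a _; rewrite /f patchE ifF//.
  by apply/negbTE/negP => /set_mem /(cdisc_sec _ _ _ r0)[]; rewrite leNgt h.
have sE : s ^+ 2 = r ^+ 2 - (b - Im c) ^+ 2 by rewrite sqr_sqrtr// subr_ge0.
have inU t : `|t - Re c| <= s -> U (t +i* b).
  by move=> ts; apply/dU/cdisc_sec.
have edge t : (t - Re c) ^+ 2 = s ^+ 2 -> P (t +i* b) = 0.
  move=> ts; apply: P0; apply/eqP; rewrite -(@eqrXn2 _ 2) ?nrm_ge0 ?ltW//.
  by rewrite nrm_sqr; move: ts sE; case: (c) => x y /= -> ->; rewrite subrK.
transitivity (\int[mu]_(a in [set a | (`|a - Re c| <= s)%R]) (F (a +i* b))%:E)%E.
  rewrite [RHS]integral_mkcond; apply: eq_integral => a _; rewrite /f !patchE.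
  by congr (if _ then _ else _); apply/idP/idP => /set_mem H; apply/mem_set;
    [have [] := (cdisc_sec c a b r0).1 H|apply/(cdisc_sec c a b r0)].
apply: (@seg_zero (fun a => F (a +i* b)) (fun a => P (a +i* b))).
- exact: sqrtr_ge0.
- move=> t /inU Ut.
  have Ht : {for t, continuous (fun a : R => a +i* b)}.
    apply/cont_nrmP => e e0; apply/nbhs_realP; exists e => // y yt.
    by apply: le_lt_trans (nrm_le_ReIm _) _ => /=; rewrite subrr normr0 addr0.
  exact: (@continuous_comp _ _ _ (fun a : R => a +i* b) F t Ht (Fc Ut)).
- by move=> t /inU /Fd.
- by apply: edge; rewrite addrAC subrr add0r.
- by apply: edge; rewrite addrAC subrr add0r sqrrN.
Qed.

Lemma disc_dy0 : (forall z, U z -> is_derive (Im z) 1 (fun b => P (Re z +i* b)) (F z)) ->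
  \int[plane]_(p in A) F (pt p) = 0.
Proof.
move=> Fd; rewrite /Rintegral integral_mkcond -[RHS]/(fine 0%E); congr fine.
rewrite -[LHS](integral12_prod_meas1 fint); apply: integral0_eq => a _.
rewrite /fubini_F.
have swap b : cdisc c r (a +i* b) <-> cdisc (Im c +i* Re c) r (b +i* a).
  rewrite /cdisc/= !nrm_def; case: c => x y /=.
  by rewrite [X in Num.sqrt X <= _]addrC.
pose s := Num.sqrt (r ^+ 2 - (a - Re c) ^+ 2).
have [h|h] := leP ((a - Re c) ^+ 2) (r ^+ 2); last first.
  apply: integral0_eq => b _; rewrite /f patchE ifF//.
  by apply/negbTE/negP => /set_mem /swap /(cdisc_sec _ _ _ r0)[]; rewrite leNgt h.
have sE : s ^+ 2 = r ^+ 2 - (a - Re c) ^+ 2 by rewrite sqr_sqrtr// subr_ge0.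
have inU t : `|t - Im c| <= s -> U (a +i* t).
  by move=> ts; apply/dU/swap/cdisc_sec.
have edge t : (t - Im c) ^+ 2 = s ^+ 2 -> P (a +i* t) = 0.
  move=> ts; apply: P0; apply/eqP; rewrite -(@eqrXn2 _ 2) ?nrm_ge0 ?ltW//.
  by rewrite nrm_sqr; move: ts sE; case: (c) => x y /= -> ->; rewrite addrC subrK.
transitivity (\int[mu]_(b in [set b | (`|b - Im c| <= s)%R]) (F (a +i* b))%:E)%E.
  rewrite [RHS]integral_mkcond; apply: eq_integral => b _; rewrite /f !patchE.
  by congr (if _ then _ else _); apply/idP/idP => /set_mem H; apply/mem_set;
    [have [] := (cdisc_sec (Im c +i* Re c) b a r0).1 ((swap b).1 H)
    |apply/(swap b)/(cdisc_sec _ b a r0)].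
apply: (@seg_zero (fun b => F (a +i* b)) (fun b => P (a +i* b))).
- exact: sqrtr_ge0.
- move=> t /inU Ut.
  have Ht : {for t, continuous (fun b : R => a +i* b)}.
    apply/cont_nrmP => e e0; apply/nbhs_realP; exists e => // y yt.
    by apply: le_lt_trans (nrm_le_ReIm _) _ => /=; rewrite subrr normr0 add0r.
  exact: (@continuous_comp _ _ _ (fun b : R => a +i* b) F t Ht (Fc Ut)).
- by move=> t /inU /Fd.
- by apply: edge; rewrite addrAC subrr add0r.
- by apply: edge; rewrite addrAC subrr add0r sqrrN.
Qed.

End line.

Lemma pder_x (k : C -> C) (z : C) : differentiable k z ->
  pder (fun a : R => k (a +i* Im z)) (Re z) ('d k z 1).
Proof.
move=> kd; have := @pder_diff R _ _ k (fun a : R => a +i* Im z) (Re z) 1.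
rewrite (_ : Re z +i* Im z = z); last by case: (z).
by apply => //; apply: (pder_ReIm (is_derive_id _ _) (is_derive_cst _ _ _)).
Qed.

Lemma pder_y (k : C -> C) (z : C) : differentiable k z ->
  pder (fun b : R => k (Re z +i* b)) (Im z) ('i * 'd k z 1).
Proof.
move=> kd; have := @pder_diff R _ _ k (fun b : R => Re z +i* b) (Im z) 'i.
rewrite (_ : Re z +i* Im z = z); last by case: (z).
rewrite [X in _ -> _ -> pder _ _ X](diff1E k z 'i).
by apply => //; apply: (pder_ReIm (is_derive_cst _ _ _) (is_derive_id _ _)).
Qed.

Lemma pderM (F G : R -> C) t a b : pder F t a -> pder G t b ->
  pder (fun s => F s * G s) t (a * G t + F t * b).
Proof.
move=> Fa Gb.
have F1 := pder_Re Fa; have F2 := pder_Im Fa; have G1 := pder_Re Gb; have G2 := pder_Im Gb.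
have D1 := is_deriveB (is_deriveM F1 G1) (is_deriveM F2 G2).
have D2 := is_deriveD (is_deriveM F1 G2) (is_deriveM F2 G1).
have := pder_ReIm D1 D2.
rewrite (_ : (fun s => _ +i* _) = (fun s => F s * G s)); last first.
  by apply/funext => s; apply: eqReIm; rewrite /= ?cReM ?cImM.
congr (pder _ _ _); apply: eqReIm; rewrite /= /GRing.scale/= ?cReD ?cImD ?cReM ?cImM; ring.
Qed.

Lemma pder_conj (F : R -> C) t a : pder F t a -> pder (fun s => conjc (F s)) t (conjc a).
Proof.
move=> Fa; have := pder_ReIm (pder_Re Fa) (is_deriveN (pder_Im Fa)).
rewrite (_ : (fun s => _ +i* _) = (fun s => conjc (F s))); last first.
  by apply/funext => s; rewrite -[(- _) s]/(- Im (F s)) /=; case: (F s).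
by case: a {Fa}.
Qed.

Lemma cont_conj (V : topologicalType) (F : V -> C) x : {for x, continuous F} ->
  {for x, continuous (fun y => conjc (F y))}.
Proof.
move=> Fc; have : {for x, continuous (fun y => Re (F y) +i* (- Im (F y)))}.
  apply: cont_ReIm; first exact: cont_Re.
  by apply: cvgN; exact: cont_Im.
by rewrite (_ : (fun y => Re _ +i* _) = (fun y => conjc (F y)))//; apply/funext => y; case: (F y).
Qed.

Section green.
Variables (c : C) (r : R) (r0 : 0 < r) (U : set C).
Hypotheses (oU : open U) (dU : cdisc c r `<=` U).

Let A := @pt R @^-1` cdisc c r.

Lemma disc_integrC (F : C -> C) : (forall z, U z -> {for z, continuous F}) ->
  integrC plane A (F \o @pt R).
Proof.
move=> Fc; split.
  by apply: (@cdisc_integrable c r (Re \o F) U) => // z /Fc; exact: cont_Re.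
by apply: (@cdisc_integrable c r (Im \o F) U) => // z /Fc; exact: cont_Im.
Qed.

Lemma disc_x0 (F P : C -> C) : (forall z, U z -> {for z, continuous F}) ->
  (forall z, nrm (z - c) = r -> P z = 0) ->
  (forall z, U z -> pder (fun a => P (a +i* Im z)) (Re z) (F z)) ->
  intC plane A (F \o @pt R) = 0.
Proof.
move=> Fc P0 Fd; apply: eqReIm => /=.
  apply: (@disc_dx0 c r r0 (Re \o F) (Re \o P) U) => [//|//|z /Fc|z /P0 /= ->//|z /Fd/pder_Re//].
  exact: cont_Re.
apply: (@disc_dx0 c r r0 (Im \o F) (Im \o P) U) => [//|//|z /Fc|z /P0 /= ->//|z /Fd/pder_Im//].
exact: cont_Im.
Qed.

Lemma disc_y0 (F P : C -> C) : (forall z, U z -> {for z, continuous F}) ->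
  (forall z, nrm (z - c) = r -> P z = 0) ->
  (forall z, U z -> pder (fun b => P (Re z +i* b)) (Im z) (F z)) ->
  intC plane A (F \o @pt R) = 0.
Proof.
move=> Fc P0 Fd; apply: eqReIm => /=.
  apply: (@disc_dy0 c r r0 (Re \o F) (Re \o P) U) => [//|//|z /Fc|z /P0 /= ->//|z /Fd/pder_Re//].
  exact: cont_Re.
apply: (@disc_dy0 c r r0 (Im \o F) (Im \o P) U) => [//|//|z /Fc|z /P0 /= ->//|z /Fd/pder_Im//].
exact: cont_Im.
Qed.

(* The integrand is the d/d\bar z of a function vanishing on the circle, so both
   iterated integrals vanish by the fundamental theorem of calculus. *)
Lemma disc_dbar0 (k1 k2 l1 l2 : C -> C) :
  (forall z, U z -> differentiable k1 z) -> (forall z, U z -> differentiable k2 z) ->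
  (forall z, U z -> differentiable l1 z) -> (forall z, U z -> differentiable l2 z) ->
  (forall z, nrm (z - c) = r -> k1 z * conjc (l1 z) + k2 z * conjc (l2 z) = 0) ->
  intC plane A (fun p => k1 (pt p) * conjc ('d l1 (pt p) 1) + k2 (pt p) * conjc ('d l2 (pt p) 1)) = 0.
Proof.
move=> kd1 kd2 ld1 ld2 P0.
pose P z := k1 z * conjc (l1 z) + k2 z * conjc (l2 z).
pose D (h : C -> C) z : C := 'd h z 1.
have Dd (h : C -> C) : (forall z, U z -> differentiable h z) ->
    forall z, U z -> differentiable (D h) z.
  by move=> hd z Uz; exact: (@holo_dir_open R C U h 1 oU hd z Uz).
have CC (h : C -> C) : (forall z, U z -> differentiable h z) ->
    forall z, U z -> {for z, continuous h}.
  by move=> hd z /hd/differentiable_continuous.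
pose E (k l : C -> C) z := k z * conjc (D l z).
have CE (k l : C -> C) : (forall z, U z -> differentiable k z) -> (forall z, U z -> differentiable l z) ->
    forall z, U z -> {for z, continuous (E k l)}.
  move=> kd ld z Uz; apply: contM; first exact: CC kd z Uz.
  by apply: cont_conj; exact: (CC _ (Dd _ ld) z Uz).
pose E' (k l : C -> C) z := D k z * conjc (l z).
have CE' (k l : C -> C) : (forall z, U z -> differentiable k z) -> (forall z, U z -> differentiable l z) ->
    forall z, U z -> {for z, continuous (E' k l)}.
  move=> kd ld z Uz; apply: contM; first exact: (CC _ (Dd _ kd) z Uz).
  by apply: cont_conj; exact: CC ld z Uz.
(* [Fx] and [Fy] are the partial derivatives of [P]. In (Fx + i Fy) / 2 the terms [E'], which
   differentiate the holomorphic factors, cancel. *)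
pose Fx z := (E' k1 l1 z + E k1 l1 z) + (E' k2 l2 z + E k2 l2 z).
pose Fy z := ('i * E' k1 l1 z + - 'i * E k1 l1 z) + ('i * E' k2 l2 z + - 'i * E k2 l2 z).
have cC (a : C) (h : C -> C) z : {for z, continuous h} -> {for z, continuous (fun z => a * h z)}.
  by move=> hc; exact: (contM (@cont_cst _ _ a z) hc).
have Fxc z : U z -> {for z, continuous Fx}.
  by move=> Uz; exact: (contD (contD (CE' _ _ kd1 ld1 z Uz) (CE _ _ kd1 ld1 z Uz)) (contD (CE' _ _ kd2 ld2 z Uz) (CE _ _ kd2 ld2 z Uz))).
have Fyc z : U z -> {for z, continuous Fy}.
  move=> Uz; exact: (contD (contD (cC 'i _ _ (CE' _ _ kd1 ld1 z Uz)) (cC (- 'i) _ _ (CE _ _ kd1 ld1 z Uz))) (contD (cC 'i _ _ (CE' _ _ kd2 ld2 z Uz)) (cC (- 'i) _ _ (CE _ _ kd2 ld2 z Uz)))).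
have X0 : intC plane A (Fx \o @pt R) = 0.
  apply: (@disc_x0 Fx P Fxc P0) => z Uz.
  have Q (k l : C -> C) : (forall z, U z -> differentiable k z) -> (forall z, U z -> differentiable l z) ->
      pder (fun a => k (a +i* Im z) * conjc (l (a +i* Im z))) (Re z) (E' k l z + E k l z).
    move=> kd ld; have := pderM (pder_x (kd z Uz)) (pder_conj (pder_x (ld z Uz))).
    by rewrite (_ : Re z +i* Im z = z); last by case: (z).
  exact: pderD (Q _ _ kd1 ld1) (Q _ _ kd2 ld2).
have Y0 : intC plane A (Fy \o @pt R) = 0.
  apply: (@disc_y0 Fy P Fyc P0) => z Uz.
  have Q (k l : C -> C) : (forall z, U z -> differentiable k z) -> (forall z, U z -> differentiable l z) ->
      pder (fun b => k (Re z +i* b) * conjc (l (Re z +i* b))) (Im z) ('i * E' k l z + - 'i * E k l z).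
    move=> kd ld; have := pderM (pder_y (kd z Uz)) (pder_conj (pder_y (ld z Uz))).
    rewrite (_ : Re z +i* Im z = z); last by case: (z).
    congr (pder _ _ _); rewrite /E /E' /D conjC_M conj_i; ring.
  exact: pderD (Q _ _ kd1 ld1) (Q _ _ kd2 ld2).
have i2 : 'i * 'i = -1 :> C by rewrite -expr2 sqr_i.
transitivity (2^-1 * (intC plane A (Fx \o @pt R) + 'i * intC plane A (Fy \o @pt R))); last first.
  by rewrite X0 Y0 mulr0 addr0 mulr0.
have mA : measurable A by exact: cdisc_plane.
have Ix := disc_integrC Fxc; have Iy := disc_integrC Fyc.
rewrite -(intC_Z mA 'i Iy) -(intC_D mA Ix (integrC_Z mA 'i Iy)).
rewrite -(intC_Z mA 2^-1 (integrC_D mA Ix (integrC_Z mA 'i Iy))).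
have alg (a b a' b' : C) : b + b' =
    2^-1 * ((a + b + (a' + b')) + 'i * ('i * a + - 'i * b + ('i * a' + - 'i * b'))).
  have -> : 'i * ('i * a + - 'i * b + ('i * a' + - 'i * b')) = 'i * 'i * (a - b + (a' - b')) :> C by ring.
  by rewrite i2; field.
by apply: eq_intC => p _; exact: (alg (E' k1 l1 (pt p)) (E k1 l1 (pt p)) (E' k2 l2 (pt p)) (E k2 l2 (pt p))).
Qed.

End green.

End plane.

(** * Mean value property and reproducing formula on discs *)

Section meanvalue.
Context (R : realType).
Local Notation C := R[i].
Local Notation Re := (@complex.Re R).
Local Notation Im := (@complex.Im R).
Local Notation T2 := (measurableTypeR R * measurableTypeR R)%type.
Local Notation mu := (@lebesgue_measure R).
Local Notation plane := (@lebesgue_plane R).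

Lemma dquot_open (U : set C) (h : C -> C) (p : C) : open U -> U p ->
  (forall z, U z -> differentiable h z) -> forall z, U z -> differentiable (dquot h p) z.
Proof.
move=> oU Up hd z Uz; have [zp|zp] := eqVneq z p.
  have [r r0 rP] := open_nrm oU Up; rewrite zp.
  by apply: (@dquot_holo R h p r r0) => [y /rP/hd//|]; rewrite subrr nrm0.
have [r r0 rP] := open_nrm oU Uz.
by apply: (@dquot_diff R h z p r) => // [y /rP/hd//|]; rewrite subrr nrm0.
Qed.

Lemma dquotE (h : C -> C) (p z : C) : (z - p) * dquot h p z = h z - h p.
Proof.
rewrite /dquot; case: eqVneq => [->|zp]; first by rewrite !subrr mul0r.
by rewrite mulrC divfK// subr_eq0.
Qed.

Lemma diff_sub (p z : C) : differentiable (fun z : C => z - p) z /\ 'd (fun z : C => z - p) z 1 = 1.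
Proof.
have E : (fun z : C => z - p) = (fun s : C => - p + s *: (1 : C)).
  by apply/funext => s; rewrite addrC -[s *: 1]/(s * 1) mulr1.
have [d1 d2] := @diff_affine R C (- p) 1 z; rewrite E; split => //.
apply: (etrans (congr1 (fun g : C -> C => g 1) d2)).
by rewrite -[_ *: _]/(1 * 1 : C) mulr1.
Qed.

Lemma diff_Mul (f g : C -> C) z : differentiable f z -> differentiable g z ->
  differentiable (fun z => f z * g z) z.
Proof. by move=> fd gd; exact: (differentiableM fd gd). Qed.

Section disc.
Variables (c : C) (r : R) (r0 : 0 < r).
Let A := @pt R @^-1` cdisc c r.

(** Its value is never computed; positivity and the lower bound [area_ge] suffice. *)
Definition area : R := fine (plane A).

Lemma intC_cst a : intC plane A (cst a) = a * area%:C.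
Proof.
rewrite /intC !Rintegral_cst; try exact: cdisc_plane.
by rewrite -/area; case: a => x y; apply: eqReIm; rewrite ?cReM ?cImM/= ?mulr0 ?subr0 ?add0r.
Qed.

Lemma integrC_cst a : integrC plane A (cst a).
Proof.
apply: (@integrC_bounded _ _ _ _ _ _ _ (nrm a)); [exact: cdisc_plane|exact: measC_cst|exact: cdisc_fin|].
by [].
Qed.

(** The concentric square of side r is contained in the disc. *)
Lemma area_ge : r ^+ 2 <= area.
Proof.
have fin : plane A \is a fin_num by rewrite ge0_fin_numE ?cdisc_fin//; exact: measure_ge0.
rewrite -lee_fin fineK//.
pose S : set T2 := `[(Re c - r / 2), (Re c + r / 2)]%classic `*` `[(Im c - r / 2), (Im c + r / 2)]%classic.
have mS : measurable S by apply: measurableX; exact: measurable_itv.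
have L (x : R) : mu `[(x - r / 2), (x + r / 2)]%classic = r%:E.
  rewrite lebesgue_measure_itv/= lte_fin ifT; last first.
    by rewrite ltrD2l (@lt_trans _ _ 0)// ?oppr_lt0 divr_gt0.
  by congr EFin; rewrite opprD opprK addrACA subrr add0r -splitr.
have <- : plane S = (r ^+ 2)%:E.
  by rewrite /lebesgue_plane product_measure1E// expr2 EFinM; congr (_ * _)%E; exact: L.
apply: le_measure; rewrite ?inE//; first exact: cdisc_plane.
move=> [a b] [/=]; rewrite !in_itv/= -!ler_distlC => h1 h2.
rewrite /A/= /cdisc /pt/=; apply: (le_trans (nrm_le_ReIm _)).
rewrite [leRHS](splitr r); apply: lerD.
  by move: h1; case: (c) => x y /=; rewrite distrC.
by move: h2; case: (c) => x y /=; rewrite distrC.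
Qed.

Lemma area_gt0 : 0 < area.
Proof. by apply: lt_le_trans area_ge; rewrite exprn_gt0. Qed.

(* With [k] the difference quotient of [h] at [c], the function
   [(r^2 - |z - c|^2) k] vanishes on the circle, and its d/d\bar z is
   [- (z - c) k = h c - h]. *)
Lemma disc_mean (U : set C) (h : C -> C) : open U -> cdisc c r `<=` U ->
  (forall z, U z -> differentiable h z) ->
  intC plane A (h \o @pt R) = h c * area%:C.
Proof.
move=> oU dU hd.
have Uc : U c by apply: dU; rewrite /cdisc/= subrr nrm0 ltW.
have kd := dquot_open oU Uc hd.
pose k := dquot h c.
(* To fit [disc_dbar0], (r^2 - |z - c|^2) k is written as r^2 k times the conjugate of 1, plus -(z -
   c) k times the conjugate of z - c. *)
have k1d z : U z -> differentiable (fun z => (r ^+ 2)%:C * k z) z.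
  by move=> Uz; apply: diff_Mul; [exact: differentiable_cst|exact: kd].
have k2d z : U z -> differentiable (fun z => (-1) * ((z - c) * k z)) z.
  move=> Uz; apply: diff_Mul; first exact: differentiable_cst.
  by apply: diff_Mul; [exact: (diff_sub c z).1|exact: kd].
have l1d z : U z -> differentiable (cst 1 : C -> C) z by move=> _; exact: differentiable_cst.
have l2d z : U z -> differentiable (fun z : C => z - c) z by move=> _; exact: (diff_sub c z).1.
have P0 z : nrm (z - c) = r ->
    (r ^+ 2)%:C * k z * conjc ((cst 1 : C -> C) z) + (-1) * ((z - c) * k z) * conjc (z - c) = 0.
  move=> zr; have E : (z - c) * conjc (z - c) = (r ^+ 2)%:C.
    rewrite -zr nrm_sqr; case: (z - c) => x y; apply: eqReIm; rewrite ?cReM ?cImM/=; ring.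
  by rewrite -E [cst _ _]/1 conjc1; ring.
have D1 z : 'd (cst 1 : C -> C) z 1 = 0.
  exact: (congr1 (fun g : C -> C => g 1) (@diff_cst _ C C 1 z)).
have mA : measurable A by exact: cdisc_plane.
have hI : integrC plane A (h \o @pt R).
  by apply: (disc_integrC oU dU) => z /hd/differentiable_continuous.
have Z : intC plane A (fun p => (-1) * (h (pt p) + cst (- h c) p)) = 0.
  rewrite -(disc_dbar0 r0 oU dU k1d k2d l1d l2d P0); apply: eq_intC => p _; apply: esym.
  apply: (etrans (congr2 (fun a b : C => (r ^+ 2)%:C * k (pt p) * conjc a +
    (-1) * ((pt p - c) * k (pt p)) * conjc b) (D1 (pt p)) (diff_sub c (pt p)).2)).
  by rewrite conjc0 conjc1 mulr0 add0r mulr1 dquotE.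
move: Z.
rewrite (intC_Z mA _ (integrC_D mA hI (integrC_cst _))) (intC_D mA hI (integrC_cst _)) intC_cst.
by move/eqP; rewrite mulN1r oppr_eq0 mulNr subr_eq0 => /eqP.
Qed.

(** The 2 is the one of [intC_nrm], and the area is replaced by its lower bound r^2. *)
Lemma disc_sub (U : set C) (h : C -> C) : open U -> cdisc c r `<=` U ->
  (forall z, U z -> differentiable h z) ->
  ((nrm (h c) * (r ^+ 2 / 2))%:E <= \int[plane]_(p in A) (nrm (h (pt p)))%:E)%E.
Proof.
move=> oU dU hd.
have mA : measurable A by exact: cdisc_plane.
have hc z : U z -> {for z, continuous h} by move=> /hd/differentiable_continuous.
have hI : integrC plane A (h \o @pt R) by exact: (disc_integrC oU dU).
have mn : measurable_fun A (fun p => nrm (h (pt p))).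
  apply: (@cdisc_meas R c r (fun z => nrm (h z)) U oU dU) => z /hc.
  exact: cont_nrm.
have H := intC_nrm mA hI mn (fun t _ => lexx _).
rewrite (disc_mean oU dU hd) nrmM nrm_real ger0_norm ?(ltW area_gt0)// in H.
rewrite -(@lee_pmul2l _ 2%:E)//; apply: le_trans H.
rewrite -EFinM lee_fin mulrCA [2 * _]mulrC divfK ?pnatr_eq0//.
by rewrite ler_wpM2l ?nrm_ge0 ?area_ge.
Qed.

End disc.

Section kernel.
Variables (r : R) (w : C).
Hypotheses (r0 : 0 < r) (r1 : r < 1) (w1 : nrm w < 1).

Let U : set C := [set z | nrm z < 1].
Let oU : open U.
Proof.
by have := @open_ball_nrm R C 0 1; congr open; apply/seteqP; split => z /=; rewrite subr0.
Qed.
Let dU : cdisc 0 r `<=` U.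
Proof. by move=> z /=; rewrite /cdisc/= subr0 => h; exact: le_lt_trans r1. Qed.
Let A := @pt R @^-1` cdisc 0 r.

(** The Szegő kernel of the unit disc up to a constant; its square is the Bergman kernel up to a
    constant. *)
Definition gk (z : C) : C := (1 - conjc w * z)^-1.

Lemma den_neq0 z : U z -> 1 - conjc w * z != 0.
Proof.
rewrite /U/= => zU; rewrite subr_eq0; apply/eqP => E.
have : nrm (conjc w * z) = 1 by rewrite -E nrm1.
rewrite nrmM nrm_conj => H.
have : nrm w * nrm z < 1 by rewrite mulr_ilt1 ?nrm_ge0.
by rewrite H ltxx.
Qed.

Lemma gk_diff z : U z -> differentiable gk z /\ 'd gk z 1 = conjc w * gk z ^+ 2.
Proof.
move=> Uz; have n0 := den_neq0 Uz.
have E : (fun z => 1 - conjc w * z) = (fun s : C => 1 + s *: (- conjc w)).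
  by apply/funext => s; rewrite -[_ *: _]/(_ * _) mulrN mulrC.
have [d1 d2] := @diff_affine R C 1 (- conjc w) z; rewrite -E in d1 d2.
split; first exact: (@differentiableV _ _ (fun z => 1 - conjc w * z) z d1 n0).
have D1 : derivable (fun z => 1 - conjc w * z) z 1 by exact: diff_derivable.
have gd : differentiable gk z by exact: (@differentiableV _ _ (fun z => 1 - conjc w * z) z d1 n0).
have I1 : is_derive z (1 : C) (fun z => 1 - conjc w * z) (- conjc w).
  have <- : 'd (fun z => 1 - conjc w * z) z 1 = - conjc w.
    by apply: (etrans (congr1 (fun g : C -> C => g 1) d2)); rewrite -[_ *: _]/(1 * _ : C) mul1r.
  by rewrite -deriveE//; exact/derivableP.
rewrite -deriveE// /gk deriveV//; have [_ ->] := I1.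
by rewrite -[_ *: _]/(_ * _) mulrNN mulrC exprVn.
Qed.

(* As in [disc_mean], now with [(r^2 - |z|^2) k / (1 - w \bar z)] and [k] the
   difference quotient of [h] at [r^2 w]. *)
Lemma disc_kernel (h : C -> C) : (forall z, U z -> differentiable h z) ->
  intC plane A (fun p => h (pt p) * conjc (gk (pt p) ^+ 2)) = h ((r ^+ 2)%:C * w) * (area 0 r)%:C.
Proof.
(* The derivative of (r^2 - z \bar z) / (1 - w \bar z) in \bar z is -(z - r^2 w) / (1 - w \bar z)^2;
   the factor z - r^2 w is absorbed by a difference quotient at [q]. *)
move=> hd; pose q := (r ^+ 2)%:C * w.
have Uq : U q.
  rewrite /U/= nrmM nrm_real ger0_norm ?exprn_ge0 ?ltW//.
  by rewrite mulr_ilt1 ?nrm_ge0 ?exprn_ge0 ?exprn_ilt1// ltW.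
have kd := dquot_open oU Uq hd.
pose k := dquot h q.
have gd z : U z -> differentiable gk z by move=> /gk_diff[].
have idd z : differentiable (fun z : C => z) z 
  by rewrite (_ : (fun z : C => z) = (fun z => z - 0)); [exact: (diff_sub 0 z).1|apply/funext => y; rewrite subr0].
have k1d z : U z -> differentiable (fun z => (r ^+ 2)%:C * k z) z.
  by move=> Uz; apply: diff_Mul; [exact: differentiable_cst|exact: kd].
have k2d z : U z -> differentiable (fun z : C => (-1) * (z * k z)) z.
  move=> Uz; apply: diff_Mul; first exact: differentiable_cst.
  by apply: diff_Mul; [exact: idd|exact: kd].
have l2d z : U z -> differentiable (fun z : C => z * gk z) z.
  by move=> Uz; apply: diff_Mul; [exact: idd|exact: gd].
have l2D z : U z -> 'd (fun z : C => z * gk z) z 1 = gk z ^+ 2.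
  move=> Uz; have [g1 g2] := gk_diff Uz.
  have I1 : is_derive z 1 (fun z : C => z) 1 by exact: is_derive_id.
  have I2 : is_derive z 1 gk (conjc w * gk z ^+ 2).
    by rewrite -g2 -deriveE//; exact/derivableP/diff_derivable.
  have [J1 J2] := is_deriveM I1 I2.
  rewrite -deriveE; last exact: l2d.
  apply: (etrans J2).
  rewrite -[z *: _]/(z * _) -[gk z *: _]/(gk z * 1) mulr1 /gk.
  by have := den_neq0 Uz; move: (conjc w) => v n0; field.
have P0 z : nrm (z - 0) = r ->
    (r ^+ 2)%:C * k z * conjc (gk z) + (-1) * (z * k z) * conjc (z * gk z) = 0.
  move=> zr; have E : z * conjc z = (r ^+ 2)%:C.
    rewrite -zr subr0 nrm_sqr; case: (z) => x y; apply: eqReIm; rewrite ?cReM ?cImM/=; ring.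
  rewrite -E conjC_M; ring.
have mA : measurable A by exact: cdisc_plane.
have g2d z : U z -> differentiable (fun z => gk z * gk z) z.
  by move=> Uz; apply: diff_Mul; exact: gd.
have gc z : U z -> {for z, continuous (fun z => conjc (gk z * gk z))}.
  by move=> /g2d/differentiable_continuous/cont_conj.
have gI : integrC plane A (fun p => conjc (gk (pt p) * gk (pt p))).
  exact: (disc_integrC oU dU gc).
have hI : integrC plane A (fun p => h (pt p) * conjc (gk (pt p) * gk (pt p))).
  apply: (@disc_integrC R 0 r U oU dU (fun z => h z * conjc (gk z * gk z))) => z Uz.
  exact: (contM (differentiable_continuous (hd z Uz)) (gc z Uz)).
have gv : intC plane A (fun p => conjc (gk (pt p) * gk (pt p))) = (area 0 r)%:C.
  have gI' : integrC plane A (fun p => gk (pt p) * gk (pt p)).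
    by apply: (@disc_integrC R 0 r U oU dU (fun z => gk z * gk z)) => z /g2d/differentiable_continuous.
  rewrite (intC_conj mA gI') (disc_mean r0 oU dU g2d) /gk mulr0 subr0 invr1 !mul1r.
  exact: conjc_real.
have Z : intC plane A (fun p => (-1) * (h (pt p) * conjc (gk (pt p) * gk (pt p)) +
    (- h q) * conjc (gk (pt p) * gk (pt p)))) = 0.
  rewrite -(disc_dbar0 r0 oU dU k1d k2d gd l2d P0); apply: eq_intC => p Ap; apply: esym.
  have Up : U (pt p) by exact: dU.
  apply: (etrans (congr2 (fun a b : C => (r ^+ 2)%:C * k (pt p) * conjc a +
    (-1) * (pt p * k (pt p)) * conjc b) (gk_diff Up).2 (l2D _ Up))).
  rewrite -mulrDl -dquotE -/k /q expr2 !conjC_M conjcK.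
  by ring.
move: Z.
rewrite (intC_Z mA _ (integrC_D mA hI (integrC_Z mA _ gI))) (intC_D mA hI (integrC_Z mA _ gI)).
rewrite (intC_Z mA _ gI) gv => /eqP.
by rewrite mulN1r oppr_eq0 mulNr subr_eq0 => /eqP <-.
Qed.

End kernel.

End meanvalue.

(** * Bounded point evaluations *)

Section eval.
Context (R : realType).
Local Notation C := R[i].
Local Notation Re := (@complex.Re R).
Local Notation Im := (@complex.Im R).
Local Notation T2 := (measurableTypeR R * measurableTypeR R)%type.
Local Notation plane := (@lebesgue_plane R).

Definition consC n (z : C) (v : 'rV[C]_n) : 'rV[C]_n.+1 :=
  \row_j (if unlift ord0 j is Some i then v 0 i else z).

Lemma consC0 n z (v : 'rV[C]_n) : consC z v 0 ord0 = z.
Proof. by rewrite mxE unlift_none. Qed.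

Lemma consCS n z (v : 'rV[C]_n) j : consC z v 0 (lift ord0 j) = v 0 j.
Proof. by rewrite mxE liftK. Qed.

Lemma toC_cons n (p : T2) (t : n.-tuple T2) : toC (cons_tuple (p, t)) = consC (pt p) (toC t).
Proof.
apply/rowP => j; case: (unliftP ord0 j) => [i ->|->].
  by rewrite consCS !mxE tnthS.
by rewrite consC0 mxE tnth0.
Qed.

Lemma nrm_consC n z (v : 'rV[C]_n) (e : R) : nrm z <= e -> nrm v <= e -> nrm (consC z v) <= e.
Proof.
move=> ze ve; have e0 : 0 <= e by apply: le_trans ze; exact: nrm_ge0.
apply/ler_addgt0Pr => d d0; apply/ltW/nrm_lt_coord => [|j]; first by rewrite ltr_wpDl.
apply: (@le_lt_trans _ _ e); last by rewrite ltrDl.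
case: (unliftP ord0 j) => [i ->|->]; first by rewrite consCS (le_trans (nrm_coord v i)).
by rewrite consC0.
Qed.

Lemma consCB n z z' (v v' : 'rV[C]_n) : consC z v - consC z' v' = consC (z - z') (v - v').
Proof. by apply/rowP => j; rewrite !mxE; case: unliftP => [i _|_]; rewrite ?mxE. Qed.

Lemma consC_diffr n z (v : 'rV[C]_n) : differentiable (fun v => consC z v) v.
Proof.
apply: (@diff_quad R _ _ (fun v => consC z v) v (fun u => consC 0 u) 0 1 ltr01 _ _ _).1.
- by move=> a x y; apply/rowP => j; rewrite !mxE; case: unliftP => [i _|_]; rewrite ?mxE ?mulr0 ?addr0.
- by exists 1 => // u; rewrite mul1r; apply: nrm_consC; rewrite ?nrm0 ?nrm_ge0.
- move=> u _; rewrite consCB subrr [v + u]addrC addrK.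
  by rewrite consCB !subrr (_ : consC 0 0 = 0) ?nrm0 ?mul0r//; apply/rowP => j; rewrite !mxE; case: unliftP => [i _|_]; rewrite ?mxE.
Qed.

Lemma consC_diffl n z (v : 'rV[C]_n) : differentiable (fun z => consC z v) z.
Proof.
have E : (fun z => consC z v) = (fun s => consC 0 v + s *: delta_mx 0 ord0).
  apply/funext => s; apply/rowP => j; rewrite !mxE; case: unliftP => [i ->|->].
    by rewrite eqxx/= mulr0 addr0.
  by rewrite !eqxx mulr1 add0r.
by rewrite E; exact: (diff_affine _ _ _).1.
Qed.

Definition cpoly n (c : 'rV[C]_n) (r : R) : set (n.-tuple T2) :=
  poly (fun j => @pt R @^-1` cdisc (c 0 j) r).

Lemma measurable_cpoly n (c : 'rV[C]_n) r : measurable (cpoly c r).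
Proof. by apply: measurable_poly => j; exact: cdisc_plane. Qed.

Lemma cpolyP n (c : 'rV[C]_n) r (t : n.-tuple T2) :
  cpoly c r t <-> forall j, nrm (toC t 0 j - c 0 j) <= r.
Proof.
by split=> [H j|H j _]; [have := H j I|have := H j]; rewrite /cdisc/= mxE.
Qed.

Lemma measurable_nrm n (U : set 'rV[C]_n) (h : 'rV[C]_n -> C) : open U ->
  (forall z, U z -> differentiable h z) ->
  measurable_fun (@toC R n @^-1` U) (fun t => nrm (h (toC t))).
Proof.
move=> oU hd; apply: (@measurable_cont R n U (fun z => nrm (h z)) oU) => z /hd hz.
exact: (cont_nrm (differentiable_continuous hz)).
Qed.

(* Applied to [h^2], this sub-mean-value inequality bounds point evaluations by
   the weighted L^2 norm. *)
Lemma poly_sub n (U : set 'rV[C]_n) (h : 'rV[C]_n -> C) (c : 'rV[C]_n) (r : R) :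
  0 < r -> open U -> (forall x : 'rV[C]_n, (forall j, nrm (x 0 j - c 0 j) <= r) -> U x) ->
  (forall z, U z -> differentiable h z) ->
  ((nrm (h c) * (r ^+ 2 / 2) ^+ n)%:E <=
    \int[dV R n]_(t in cpoly c r) (nrm (h (toC t)))%:E)%E.
Proof.
move=> r0; elim: n U h c => [|n IH] U h c oU dU hd.
  rewrite /dV/= integral_dirac; [|exact: measurable_cpoly|].
    rewrite diracE mem_set ?mul1e; last by move=> -[].
    by rewrite expr0 mulr1 (_ : toC _ = c)//; apply/rowP => -[].
  move=> _ Y _; have [] := pselect ((cpoly c r `&` (fun t => (nrm (h (toC t)))%:E) @^-1` Y) [tuple]) => H.
    rewrite (_ : _ `&` _ = setT); first exact: measurableT.
    by apply/seteqP; split => // t _; rewrite (tuple0 t).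
  rewrite (_ : _ `&` _ = set0); first exact: measurable0.
  by apply/seteqP; split => // t; rewrite (tuple0 t) => /H.
have mP := measurable_cpoly c r.
have PU : cpoly c r `<=` @toC R n.+1 @^-1` U by move=> t /cpolyP /dU.
have mh : measurable_fun (cpoly c r) (fun t => (nrm (h (toC t)))%:E).
  apply/measurable_EFinP; apply: (measurable_funS _ PU (measurable_nrm oU hd)).
  exact: measurable_open.
rewrite /dV/= ge0_integral_pushforward//; [|exact: measurable_cons_tuple|].
  2: by move=> t _; rewrite lee_fin nrm_ge0.
pose c0 := c 0 ord0; pose c' : 'rV[C]_n := \row_j c 0 (lift ord0 j).
have cE : c = consC c0 c'.
  apply/rowP => j; case: (unliftP ord0 j) => [i ->|->]; first by rewrite consCS mxE.
  by rewrite consC0.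
pose A := @pt R @^-1` cdisc c0 r; pose B := cpoly c' r.
have pre : @cons_tuple _ T2 n @^-1` cpoly c r = A `*` B.
  rewrite /cpoly poly_cons; congr (_ `*` _).
  by rewrite /B /cpoly; congr poly; apply/funext => j; rewrite mxE.
rewrite pre.
have mA : measurable A by exact: cdisc_plane.
have mB : measurable B by exact: measurable_cpoly.
pose f := (fun x : T2 * n.-tuple T2 => (nrm (h (toC (cons_tuple x))))%:E) \_ (A `*` B).
have f0 x : (0 <= f x)%E.
  by rewrite /f patchE; case: ifP => // _; rewrite lee_fin nrm_ge0.
have mf : measurable_fun setT f.
  apply/(measurable_restrictT _ (measurableX mA mB)).
  rewrite -pre => _ Y mY.
  have -> : @cons_tuple _ T2 n @^-1` cpoly c r `&`
      (fun x => (nrm (h (toC (cons_tuple x))))%:E) @^-1` Y =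
      setT `&` @cons_tuple _ T2 n @^-1` (cpoly c r `&` (fun t => (nrm (h (toC t)))%:E) @^-1` Y).
    by rewrite setTI.
  by apply: measurable_cons_tuple => //; exact: mh.
rewrite [leRHS]integral_mkcond -/f.
rewrite [leRHS](fubini_tonelli1 f mf f0).
have inU z (v : 'rV[C]_n) : cdisc c0 r z -> (forall j, nrm (v 0 j - c' 0 j) <= r) -> U (consC z v).
  move=> zc vc; apply: dU => j; case: (unliftP ord0 j) => [i ->|->].
    by rewrite consCS; have := vc i; rewrite mxE.
  by rewrite consC0.
pose k := (r ^+ 2 / 2) ^+ n.
have k0 : 0 <= k by rewrite exprn_ge0// divr_ge0// exprn_ge0// ltW.
have oU1 z : open [set v : 'rV[C]_n | U (consC z v)].
  by apply: open_comp => // v _; exact/differentiable_continuous/consC_diffr.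
have oU2 v : open [set z : C | U (consC z v)].
  by apply: open_comp => // z _; exact/differentiable_continuous/consC_diffl.
have hd1 z v : U (consC z v) -> differentiable (fun v => h (consC z v)) v.
  by move=> Uz; exact: (@differentiable_comp _ _ _ _ (fun v => consC z v) h v (consC_diffr z v) (hd _ Uz)).
have hd2 v z : U (consC z v) -> differentiable (fun z => h (consC z v)) z.
  by move=> Uz; exact: (@differentiable_comp _ _ _ _ (fun z => consC z v) h z (consC_diffl z v) (hd _ Uz)).
have cc' j : nrm (c' 0 j - c' 0 j) <= r by rewrite subrr nrm0 ltW.
have dA : cdisc c0 r `<=` [set z : C | U (consC z c')] by move=> z zc; exact: inU.
have S := disc_sub r0 (oU2 c') dA (@hd2 c').
have mg : measurable_fun A (fun p => nrm (h (consC (pt p) c'))).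
  apply: (@cdisc_meas R c0 r (fun z => nrm (h (consC z c'))) _ (oU2 c') dA) => z /hd2 hz.
  exact: (cont_nrm (differentiable_continuous hz)).
(* The one-variable inequality is applied to the first coordinate, with the others at the centre c';
   then, for each value of the first coordinate, the induction hypothesis treats the others. *)
apply: (@le_trans _ _ (\int[plane]_p ((fun p => (k%:E * (nrm (h (consC (pt p) c')))%:E)%E) \_ A) p)%E).
  rewrite -integral_mkcond ge0_integralZl//; [|exact/measurable_EFinP|by move=> p _; rewrite lee_fin nrm_ge0].
  have -> : nrm (h c) * (r ^+ 2 / 2) ^+ n.+1 = k * (nrm (h (consC c0 c')) * (r ^+ 2 / 2)).
    by rewrite -cE exprSr -/k mulrCA.
  by rewrite EFinM lee_wpmul2l.
apply: ge0_le_integral => //.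
- move=> p _; rewrite patchE; case: ifP => // _.
  by rewrite mule_ge0// lee_fin ?nrm_ge0.
- apply/(measurable_restrictT _ mA); apply: measurable_funeM.
  exact/measurable_EFinP.
- exact: measurable_fun_fubini_tonelli_F.
move=> p _; rewrite patchE; case: ifPn => [/set_mem Ap|_]; last exact: integral_ge0.
rewrite /fubini_F.
have -> : (\int[dV R n]_y f (p, y) = \int[dV R n]_(t in B) (nrm (h (consC (pt p) (toC t))))%:E)%E.
  rewrite [RHS]integral_mkcond; apply: eq_integral => t _; rewrite /f !patchE toC_cons.
  by congr (if _ then _ else _); rewrite in_setX/= mem_set.
rewrite muleC -EFinM.
apply: (IH _ (fun v => h (consC (pt p) v)) c' (oU1 (pt p)) _ (hd1 (pt p))).
by move=> x xc; exact: inU.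
Qed.

Section bound.
Variables (n : nat) (D : set 'rV[C]_n) (mu : 'rV[C]_n -> R).
Hypotheses (oD : open D) (wmu : weight D mu).

Definition energy (h : 'rV[C]_n -> C) : \bar R :=
  (\int[dV R n]_(t in @toC R n @^-1` D)
     (((Re (h (toC t))) ^+ 2 + (Im (h (toC t))) ^+ 2) * mu (toC t))%:E)%E.

Lemma weight_gt0 z : D z -> 0 < mu z.
Proof. by move=> Dz; apply: wmu.2; exact: subset_closure. Qed.

Lemma measurable_mu : measurable_fun (@toC R n @^-1` D) (mu \o @toC R n).
Proof. by apply: measurable_cont => // z; exact: weight_cont. Qed.

Lemma measurable_energy (h : 'rV[C]_n -> C) :
  measurable_fun (@toC R n @^-1` D) (fun t => Re (h (toC t))) ->
  measurable_fun (@toC R n @^-1` D) (fun t => Im (h (toC t))) ->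
  measurable_fun (@toC R n @^-1` D)
   (fun t => (((Re (h (toC t))) ^+ 2 + (Im (h (toC t))) ^+ 2) * mu (toC t))%:E).
Proof.
move=> h1 h2; apply/measurable_EFinP; apply: measurable_funM; last exact: measurable_mu.
by apply: measurable_funD; exact: measurable_funX.
Qed.

(** One constant serves all [x] near [w]: on the ball of radius 2 d the weight is at least mu w / 2,
    and it contains the polydisc of radius d / 2 about each such [x]. *)
Lemma energy_bound (w : 'rV[C]_n) : D w -> exists d K : R, [/\ 0 < d, 0 < K,
   forall x, nrm (x - w) < d -> D x &
   forall x h, nrm (x - w) < d -> bergman_space D mu h ->
     ((nrm (h x) ^+ 2)%:E <= K%:E * energy h)%E].
Proof.
move=> Dw; have [e e0 eP] := open_nrm oD Dw.
have m0 : 0 < mu w / 2 by rewrite divr_gt0// weight_gt0.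
have [e' e'0 e'P] := (nbhs_nrm _ _).1 ((cont_rnrmP _ _).1 (weight_cont oD wmu Dw) _ m0).
pose d := Num.min e e' / 2.
have E0 : 0 < Num.min e e' by rewrite lt_min e0.
have d0 : 0 < d by rewrite divr_gt0.
have dE : d + d = Num.min e e' by rewrite -splitr.
pose r := d / 2; have r0 : 0 < r by rewrite divr_gt0.
have rd : r < d by rewrite /r ltr_pdivrMr// ltr_pMr// ltr1n.
pose k := (r ^+ 2 / 2) ^+ n; have k0 : 0 < k by rewrite exprn_gt0// divr_gt0// exprn_gt0.
have near y : nrm (y - w) < d + d -> D y /\ mu w / 2 <= mu y.
  rewrite dE lt_min => /andP[/eP Dy b]; split => //.
  move: (e'P _ b) => /=; rewrite ltr_distl => /andP[h _].
  by apply/ltW/(le_lt_trans _ h); rewrite {2}(splitr (mu w)) addrK.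
exists d, ((mu w / 2) * k)^-1; split => //.
- by rewrite invr_gt0 mulr_gt0.
- move=> x xd; apply: (near x _).1; apply: lt_trans xd _; by rewrite ltrDl.
move=> x h xd [[h1 h2 _] hh].
have sub (y : 'rV[C]_n) : (forall j, nrm (y 0 j - x 0 j) <= r) -> nrm (y - w) < d + d.
  move=> yx; apply: le_lt_trans (nrm_tri y w x) _; apply: ltrD => //.
  by apply: nrm_lt_coord => // j; rewrite !mxE; exact: le_lt_trans rd.
have h2d z : D z -> differentiable (fun z => h z * h z) z.
  by move=> Dz; exact: (differentiableM (hh z Dz) (hh z Dz)).
have H := poly_sub r0 oD (fun y yx => (near y (sub y yx)).1) h2d.
have mP := measurable_cpoly x r.
have PD : cpoly x r `<=` @toC R n @^-1` D.
  by move=> t /cpolyP tx; exact: (near _ (sub _ tx)).1.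
have nE z : nrm (h z * h z) = Re (h z) ^+ 2 + Im (h z) ^+ 2.
  by rewrite nrmM -expr2 nrm_sqr.
have mD : measurable (@toC R n @^-1` D) by exact: measurable_open.
have me := measurable_energy h1 h2.
have e_ge0 t : (@toC R n @^-1` D) t ->
    (0 <= (((Re (h (toC t))) ^+ 2 + (Im (h (toC t))) ^+ 2) * mu (toC t))%:E)%E.
  by move=> Dt; rewrite lee_fin mulr_ge0 ?addr_ge0 ?sqr_ge0// ltW// weight_gt0.
rewrite -(@lee_pmul2l _ ((mu w / 2) * k)%:E) ?lte_fin ?mulr_gt0//.
rewrite [leRHS]muleA -[X in (_ <= X * _)%E]EFinM divff ?mul1e; last by rewrite gt_eqF// mulr_gt0.
apply: (@le_trans _ _ ((mu w / 2)%:E * \int[dV R n]_(t in cpoly x r) (nrm (h (toC t) * h (toC t)))%:E)%E).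
  have -> : ((mu w / 2 * k)%:E * (nrm (h x) ^+ 2)%:E = (mu w / 2)%:E * (nrm (h x * h x) * k)%:E)%E.
    by rewrite -!EFinM nrmM; congr EFin; ring.
  by apply: lee_wpmul2l; [rewrite lee_fin ltW|exact: H].
rewrite -ge0_integralZl//; last 3 first.
- apply/measurable_EFinP; apply: (measurable_funS mD PD (measurable_nrm oD h2d)).
- by move=> t _; rewrite lee_fin nrm_ge0.
- by rewrite lee_fin ltW.
apply: (@le_trans _ _ (\int[dV R n]_(t in cpoly x r)
   (((Re (h (toC t))) ^+ 2 + (Im (h (toC t))) ^+ 2) * mu (toC t))%:E)%E); last first.
  exact: ge0_subset_integral.
apply: ge0_le_integral => //.
- by move=> t _; rewrite -EFinM lee_fin mulr_ge0 ?nrm_ge0 ?ltW.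
- apply: measurable_funeM; apply/measurable_EFinP; apply: (measurable_funS mD PD (measurable_nrm oD h2d)).
- exact: (measurable_funS mD PD).
move=> t /cpolyP tx; rewrite -EFinM lee_fin nE mulrC ler_wpM2l ?addr_ge0 ?sqr_ge0//.
  exact: (near _ (sub _ tx)).2.
exact: weight_gt0.
Qed.

End bound.

End eval.

(** * Existence of the Bergman kernel *)

Section kernel.
Context (R : realType).
Local Notation C := R[i].
Local Notation Re := (@complex.Re R).
Local Notation Im := (@complex.Im R).
Variables (n : nat) (D : set 'rV[C]_n) (mu : 'rV[C]_n -> R).
Hypotheses (bD : bounded_domain D) (wmu : weight D mu).
Local Notation V := 'rV[C]_n.
Local Notation A := (@toC R n @^-1` D).
Local Notation H := (bergman_space D mu).

Let oD : open D. Proof. by case: bD. Qed.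
Let mA : measurable A. Proof. exact: measurable_open. Qed.

Definition ip (h g : V -> C) : C :=
  intC (dV R n) A (fun t => h (toC t) * conjc (g (toC t)) * (mu (toC t))%:C).

Definition sq (h : V -> C) (z : V) : R := (Re (h z) ^+ 2 + Im (h z) ^+ 2) * mu z.

Lemma sq_ge0 h z : D z -> 0 <= sq h z.
Proof. by move=> Dz; rewrite mulr_ge0 ?addr_ge0 ?sqr_ge0// ltW// (weight_gt0 wmu). Qed.

Lemma sqE h z : sq h z = nrm (h z) ^+ 2 * mu z.
Proof. by rewrite nrm_sqr. Qed.

Lemma measC_holo h : (forall z, D z -> differentiable h z) ->
  measC A (fun t => h (toC t)).
Proof. by move=> hd; have [h1 h2] := measurable_holo oD hd; split. Qed.

Lemma measurable_sq h : (forall z, D z -> differentiable h z) ->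
  measurable_fun A (fun t => sq h (toC t)).
Proof.
move=> hd; have [h1 h2] := measurable_holo oD hd.
by apply/measurable_EFinP; exact: (measurable_energy oD wmu h1 h2).
Qed.

Lemma sq_integrable h : H h -> (dV R n).-integrable A (EFin \o (fun t => sq h (toC t))).
Proof.
move=> [[h1 h2 h3] hd]; apply/integrableP; split; first by apply/measurable_EFinP; exact: measurable_sq.
rewrite (eq_integral (fun t => (sq h (toC t))%:E)) // => t /set_mem At.
by rewrite /= ger0_norm// sq_ge0.
Qed.

Lemma H_intro h : (forall z, D z -> differentiable h z) ->
  (dV R n).-integrable A (EFin \o (fun t => sq h (toC t))) -> H h.
Proof.
move=> hd hi; have [h1 h2] := measurable_holo oD hd; split => //; split => //.
move: hi => /integrableP[_].
rewrite (eq_integral (fun t => (sq h (toC t))%:E)) // => t /set_mem At.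
by rewrite /= ger0_norm// sq_ge0.
Qed.

Lemma H_dom h (g : V -> R) : (forall z, D z -> differentiable h z) ->
  (dV R n).-integrable A (EFin \o (fun t => g (toC t))) ->
  (forall z, D z -> sq h z <= g z) -> H h.
Proof.
move=> hd gi hg; apply: H_intro => //.
apply: (le_integrable mA _ _ gi); first by apply/measurable_EFinP; exact: measurable_sq.
move=> t At; rewrite /= lee_fin ger0_norm ?sq_ge0//.
by apply: le_trans (ler_norm _); exact: hg.
Qed.

Lemma H_add h g : H h -> H g -> H (fun z => h z + g z).
Proof.
move=> Hh Hg; have [_ hd] := Hh; have [_ gd] := Hg.
have I1 := intrZ mA 2 (sq_integrable Hh); have I2 := intrZ mA 2 (sq_integrable Hg).
apply: (@H_dom _ (fun z => 2 * sq h z + 2 * sq g z)); last 1 first.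
- move=> z Dz; have m0 := ltW (weight_gt0 wmu Dz).
  rewrite /sq !mulrA -mulrDl ler_wpM2r// cReD cImD.
  move: (Re _) (Re _) (Im _) (Im _) => a b c d.
  rewrite -subr_ge0 (_ : _ - _ = (a - b) ^+ 2 + (c - d) ^+ 2); last by ring.
  by rewrite addr_ge0 ?sqr_ge0.
- by move=> z Dz; exact: (differentiableD (hd z Dz) (gd z Dz)).
- exact: (intrD mA I1 I2).
Qed.

Lemma H_scale a h : H h -> H (fun z => a * h z).
Proof.
move=> Hh; have [_ hd] := Hh.
apply: (@H_dom _ (fun z => nrm a ^+ 2 * sq h z)).
- by move=> z Dz; exact: (diff_scaleC a (hd z Dz)).1.
- exact: (intrZ mA _ (sq_integrable Hh)).
- by move=> z Dz; rewrite !sqE nrmM exprMn mulrA.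
Qed.

(** The volume of [D] is finite and the weight bounded. Constants provide a competitor in the
    extremal problem at each point. *)
Lemma H_cst a : H (cst a).
Proof.
have [M M0 MP] : exists2 M : R, 0 < M & forall x, closure D x -> mu x <= M.
  by case: bD => _ _ _ bd; exact: weight_bounded bd wmu.
have Aoo : (dV R n A < +oo)%E by case: bD => _ _ _ bd; exact: dV_bounded.
apply: H_intro; first by move=> z _; exact: differentiable_cst.
apply: measurable_bounded_integrable => //.
  by apply: measurable_sq => z _; exact: differentiable_cst.
exists (nrm a ^+ 2 * M); split; first exact: num_real.
move=> N MN t At /=; rewrite ger0_norm ?sq_ge0// sqE; apply: le_trans (ltW MN).
by rewrite ler_wpM2l ?sqr_ge0//; apply: MP; exact: subset_closure.
Qed.

Lemma ip_int h g : H h -> H g ->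
  integrC (dV R n) A (fun t => h (toC t) * conjc (g (toC t)) * (mu (toC t))%:C).
Proof.
move=> Hh Hg; have [_ hd] := Hh; have [_ gd] := Hg.
apply: (@integrC_dom _ _ _ _ _ mA _ (fun t => sq h (toC t) + sq g (toC t))).
- apply: measC_M; last by apply: measC_real; exact: measurable_mu.
  by apply: measC_M; [exact: measC_holo|apply: measC_conj; exact: measC_holo].
- exact: (intrD mA (sq_integrable Hh) (sq_integrable Hg)).
move=> t At; have m0 := weight_gt0 wmu At.
rewrite !sqE -mulrDl !nrmM nrm_conj nrm_real (gtr0_norm m0) ler_wpM2r ?(ltW m0)//.
have := nrm_ge0 (h (toC t)); have := nrm_ge0 (g (toC t)).
move: (nrm _) (nrm _) => a b a0 b0.
rewrite -subr_ge0 (_ : _ - _ = (a - b) ^+ 2 + a * b); last by ring.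
by rewrite addr_ge0 ?sqr_ge0 ?mulr_ge0.
Qed.

Lemma ip_D h g k : H h -> H g -> H k -> ip (fun z => h z + g z) k = ip h k + ip g k.
Proof.
move=> Hh Hg Hk; rewrite /ip -(intC_D mA (ip_int Hh Hk) (ip_int Hg Hk)).
by apply: eq_intC => t _; rewrite !mulrDl.
Qed.

Lemma ip_Z a h k : H h -> H k -> ip (fun z => a * h z) k = a * ip h k.
Proof.
move=> Hh Hk; rewrite /ip -(intC_Z mA a (ip_int Hh Hk)).
by apply: eq_intC => t _; rewrite !mulrA.
Qed.

Lemma ip_conj h g : H h -> H g -> ip g h = conjc (ip h g).
Proof.
move=> Hh Hg; rewrite /ip -(intC_conj mA (ip_int Hh Hg)).
by apply: eq_intC => t _; rewrite !conjC_M conjcK conjc_real; congr (_ * _); exact: mulrC.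
Qed.

Lemma eq_ip h g h' g' : (forall z, D z -> h z = h' z) -> (forall z, D z -> g z = g' z) ->
  ip h g = ip h' g'.
Proof. by move=> hh gg; apply: eq_intC => t At; rewrite hh// gg. Qed.

Definition en (h : V -> C) : R := Re (ip h h).

Lemma en_def h : H h -> (en h)%:E = energy D mu h.
Proof.
move=> Hh; have Ih := sq_integrable Hh.
rewrite /energy -[RHS]fineK; last exact: (integrable_fin_num mA Ih).
congr EFin; apply: eq_Rintegral => t _.
by rewrite cReM; case: (h (toC t)) => a b /=; ring.
Qed.

Lemma en_ge0 h : H h -> 0 <= en h.
Proof.
move=> Hh; rewrite -lee_fin en_def//; apply: integral_ge0 => t At.
by rewrite lee_fin; exact: sq_ge0.
Qed.

Lemma ip_en h : H h -> ip h h = (en h)%:C.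
Proof.
move=> Hh; rewrite /en; have := ip_conj Hh Hh; case: (ip h h) => a b /= [] bb.
by congr (_ +i* _); apply/eqP; rewrite -[_ == _](mulrn_eq0 b 2) mulr2n {1}bb addNr.
Qed.

Lemma en_add h g a : H h -> H g ->
  en (fun z => h z + a * g z) = en h + 2 * Re (conjc a * ip h g) + nrm a ^+ 2 * en g.
Proof.
move=> Hh Hg; have Hag := H_scale a Hg; have HS := H_add Hh Hag.
rewrite {1}/en (ip_D Hh Hag HS) (ip_Z _ Hg HS) (ip_conj HS Hh) (ip_conj HS Hg).
rewrite !(ip_D Hh Hag)// !(ip_Z _ Hg)// (ip_conj Hh Hg) !ip_en//.
rewrite nrm_sqr; move: (ip h g) (en h) (en g) => [x y] p q; clear; case: a => u v /=; ring.
Qed.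

Lemma en_eval w : D w -> exists d K : R, [/\ 0 < d, 0 < K,
   forall x, nrm (x - w) < d -> D x &
   forall x h, nrm (x - w) < d -> H h -> nrm (h x) ^+ 2 <= K * en h].
Proof.
move=> Dw; have [d [K [d0 K0 dD P]]] := energy_bound oD wmu Dw.
exists d, K; split => // x h xd Hh.
by rewrite -lee_fin [in leRHS]EFinM en_def//; exact: P.
Qed.

Lemma seqto_sq (x : nat -> C) (l : C) (m : R) : seqto x l ->
  (fun k => ((Re (x k) ^+ 2 + Im (x k) ^+ 2) * m)%:E) @ \oo --> ((Re l ^+ 2 + Im l ^+ 2) * m)%:E.
Proof.
move=> xl; have xn : (fun k => nrm (x k)) @ \oo --> nrm l.
  apply/cvgrPdist_lt => e e0; have [N NP] := xl e e0.
  exists N => // k /NP /=; apply: le_lt_trans; rewrite distrC.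
  by rewrite ler_norml nrm_sub_ge andbT lerNl opprB nrmBC nrm_sub_ge.
have -> : (fun k => ((Re (x k) ^+ 2 + Im (x k) ^+ 2) * m)%:E) =
    EFin \o (fun k => nrm (x k) * nrm (x k) * m).
  by apply/funext => k /=; rewrite -nrm_sqr expr2.
rewrite -nrm_sqr expr2; apply: cvg_EFin; first exact: nearW.
by apply: cvgM; [exact: cvgM|exact: cvg_cst].
Qed.

Section point.
Variables (w : V).
Hypothesis Dw : D w.

Let S (h : V -> C) := H h /\ h w = 1.
Let d := inf [set en h | h in S].

Let hasinf : has_inf [set en h | h in S].
Proof.
split; first by exists (en (cst 1)), (cst 1); [split; [exact: H_cst|]|].
by exists 0 => _ [h [Hh _] <-]; exact: en_ge0.
Qed.

Let d_le h : S h -> d <= en h.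
Proof. by move=> Sh; apply: ge_inf; [case: hasinf|exists h]. Qed.

Let minseq : exists f : nat -> V -> C, forall k, S (f k) /\ en (f k) < d + k.+1%:R^-1.
Proof.
have /choice[f fP] : forall k, exists h, S h /\ en h < d + k.+1%:R^-1.
  move=> k; have k0 : 0 < k.+1%:R^-1 :> R by rewrite invr_gt0.
  by have [_ [h Sh <-] hd] := inf_adherent k0 hasinf; exists h.
by exists f.
Qed.

(** The midpoint of [h] and [g] also takes the value 1 at [w], so its energy is at least [d]; the
    bound is then the parallelogram law. *)
Let parallel h g : S h -> S g ->
  en (fun z => h z + (-1) * g z) <= 2 * en h + 2 * en g - 4 * d.
Proof.
move=> [Hh hw] [Hg gw].
have Sm : S (fun z => 2^-1 * (h z + 1 * g z)).
  split; first by exact: (H_scale 2^-1 (H_add Hh (H_scale 1 Hg))).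
  by rewrite hw gw mul1r mulVf// pnatr_eq0.
have Em : en (fun z => 2^-1 * (h z + 1 * g z)) = 4^-1 * en (fun z => h z + 1 * g z).
  have Hs : H (fun z => h z + 1 * g z) := H_add Hh (H_scale 1 Hg).
  rewrite {1}/en (ip_Z _ Hs (H_scale _ Hs)) (ip_conj (H_scale _ Hs) Hs) (ip_Z _ Hs Hs) ip_en//.
  have -> : (2^-1 : C) = (2^-1 : R)%:C by rewrite rmorphV/= ?rmorph_nat// unitfE pnatr_eq0.
  by rewrite conjC_M !conjc_real -!rmorphM/= mulrA -invfM -natrM.
have := d_le Sm; rewrite Em !en_add// nrmN nrm1 !expr1n !mul1r.
have cN1 : conjc (-1) = -1 :> C by rewrite rmorphN rmorph1.
rewrite conjc1 cN1 mul1r.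
have ReN (x : C) : Re (- x) = - Re x by case: x.
rewrite mulN1r ReN; move: (Re _) (en h) (en g) => x y z; lra.
Qed.

(** By [parallel] a minimizing sequence is Cauchy in energy, hence pointwise Cauchy by bounded point
    evaluations. The limit is holomorphic by [holo_lim], and Fatou's lemma bounds its energy by the
    infimum. *)
Lemma min_exists : exists h0, S h0 /\ forall h, S h -> en h0 <= en h.
Proof.
have [f fP] := minseq.
have invN (e : R) : 0 < e -> exists N, forall k, (N <= k)%N -> k.+1%:R^-1 < e.
  move=> e0; have [N _ NP] := near_infty_natSinv_lt (PosNum e0).
  by exists N.
have diffb k l : en (fun z => f k z + (-1) * f l z) <= 2 * (k.+1%:R^-1 + l.+1%:R^-1).
  have [Sk ek] := fP k; have [Sl el] := fP l.
  apply: le_trans (parallel Sk Sl) _.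
  move: ek el; move: (en _) (en _) (k.+1%:R^-1) (l.+1%:R^-1) => a b x y; lra.
have Hdiff k l : H (fun z => f k z + (-1) * f l z).
  have [[Hk _] _] := fP k; have [[Hl _] _] := fP l.
  exact: (H_add Hk (H_scale (-1) Hl)).
have lim z : D z -> exists l, seqto (fun k => f k z) l.
  move=> Dz; have [r [K [r0 K0 _ KP]]] := en_eval Dz.
  apply: cauchyC => e e0.
  have e1 : 0 < e ^+ 2 / (4 * K) by rewrite divr_gt0 ?exprn_gt0 ?mulr_gt0.
  have [N NP] := invN _ e1; exists N => k l /NP kN /NP lN.
  have zz : nrm (z - z) < r by rewrite subrr nrm0.
  have := KP z _ zz (Hdiff k l); rewrite mulN1r => h.
  rewrite -(@ltr_pXn2r _ 2) ?nnegrE ?nrm_ge0 ?(ltW e0)//.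
  apply: le_lt_trans h _; rewrite -ltr_pdivlMl//.
  apply: le_lt_trans (diffb k l) _.
  have -> : K^-1 * e ^+ 2 = 2 * (e ^+ 2 / (4 * K) + e ^+ 2 / (4 * K)).
    by field; rewrite gt_eqF.
  by rewrite ltr_pM2l// ltrD.
have /choice[h0 h0P] : forall z, exists l, D z -> seqto (fun k => f k z) l.
  move=> z; have [Dz|nDz] := pselect (D z); first by have [l] := lim z Dz; exists l.
  by exists 0.
have fd k z : D z -> differentiable (f k) z by have [[[_ +] _] _] := fP k; exact.
have hd z : D z -> differentiable h0 z.
  move=> Dz; have [r [K [r0 K0 rD KP]]] := en_eval Dz.
  (* The energies are at most d + 1, and |f|^2 <= c implies |f| <= c + 1, which spares a square
     root. *)
  apply: (@holo_lim R V f h0 z r (K * (d + 1) + 1) r0) => [k y yr|y /rD]; last exact: h0P.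
  split; first exact/fd/rD.
  have [[Hk _] ek] := fP k; have := KP y _ yr Hk.
  have k1 : k.+1%:R^-1 <= 1 :> R by rewrite invf_le1// ler1n.
  have h1 : en (f k) <= d + 1 by apply: le_trans (ltW ek) _; rewrite lerD2l.
  have {h1} : K * en (f k) <= K * (d + 1) by rewrite ler_pM2l.
  have := nrm_ge0 (f k y); move: (nrm _) (K * _) (K * _) => a b c a0 bc ab.
  have := sqr_ge0 (a - 1); nra.
have Ed : (fun k => (en (f k))%:E) @ \oo --> d%:E.
  apply: cvg_EFin; first exact: nearW.
  apply/cvgrPdist_lt => e e0; have [N NP] := invN e e0; exists N => // k /NP kN /=.
  have [Sk ek] := fP k; have dk := d_le Sk.
  rewrite distrC ger0_norm ?subr_ge0// ltrBlDl; apply: lt_trans ek _.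
  by rewrite ltrD2l.
have [h1 h2] := measurable_holo oD hd.
have F : (energy D mu h0 <= d%:E)%E.
  have mf k : measurable_fun A (fun t => (sq (f k) (toC t))%:E).
    by apply/measurable_EFinP; exact: (measurable_sq (fd k)).
  have := @fatou _ _ R (dV R n) A mA (fun k t => (sq (f k) (toC t))%:E) mf.
  have -> : limn_einf (fun k => \int[dV R n]_(t in A) (sq (f k) (toC t))%:E)%E = d%:E.
    have -> : (fun k => \int[dV R n]_(t in A) (sq (f k) (toC t))%:E)%E = (fun k => (en (f k))%:E).
      by apply/funext => k; rewrite en_def//; case: (fP k) => -[].
    exact: (cvg_limn_einf_sup Ed).1.
  rewrite (eq_integral (fun t => (sq h0 (toC t))%:E)); last first.
    move=> t /set_mem At; 
    have Q := @seqto_sq _ _ (mu (toC t)) (h0P (toC t) At).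
    have E := (cvg_limn_einf_sup Q).1; exact: E.
  by apply => k t At; rewrite lee_fin sq_ge0.
have Hh0 : H h0.
  split => //; split => //; apply: le_lt_trans F _; exact: ltry.
exists h0; split.
  split => //; apply: (seqto_unique (h0P w Dw)).
  have -> : (fun k => f k w) = (fun=> 1) by apply/funext => k; have [[]] := fP k.
  exact: seqto_cst.
move=> h Sh; apply: le_trans (d_le Sh).
by rewrite -lee_fin en_def.
Qed.

(* The element of least energy with value 1 at [w] is orthogonal to all elements
   vanishing at [w], hence a multiple of the kernel function. *)
Lemma repr_exists : exists k, H k /\ forall h, H h -> h w = ip h k.
Proof.
have [h0 [[Hh0 h0w] h0min]] := min_exists.
have orth g : H g -> g w = 0 -> ip h0 g = 0.
  move=> Hg gw; apply/eqP; rewrite -nrm_eq0 -sqrf_eq0.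
  (* With q = |ip h0 g|^2, moving [h0] by -s (ip h0 g) g changes the energy by s q (s en g - 2),
     which is at most -s q for this s; minimality forces q = 0. *)
  pose s := (en g + 1)^-1.
  have g0 := en_ge0 Hg.
  have s0 : 0 < s by rewrite invr_gt0 ltr_wpDl.
  have sE : s * en g < 1 by rewrite mulrC ltr_pdivrMr ?ltr_wpDl// mul1r ltrDl.
  have Ss : S (fun z => h0 z + (- (s%:C * ip h0 g)) * g z).
    split; first exact: (H_add Hh0 (H_scale _ Hg)).
    by rewrite h0w gw mulr0 addr0.
  have := h0min _ Ss; rewrite en_add// nrmN nrmM nrm_real (gtr0_norm s0).
  have -> : Re (conjc (- (s%:C * ip h0 g)) * ip h0 g) = - s * nrm (ip h0 g) ^+ 2.
    by rewrite nrm_sqr; case: (ip h0 g) => x y /=; ring.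
  rewrite -addrA lerDl => hh.
  have q0 := sqr_ge0 (nrm (ip h0 g)); rewrite eq_le q0 andbT.
  move: hh q0 sE; set q := nrm (ip h0 g) ^+ 2; rewrite exprMn -/q => hh q0 sE.
  have E : 2 * (- s * q) + s ^+ 2 * q * en g = s * (q * (s * en g - 2)) by ring.
  move: hh; rewrite E pmulr_rge0// => hh.
  have : q * (s * en g - 2) <= q * (-1) by rewrite ler_wpM2l//; lra.
  by move=> /(le_trans hh); rewrite mulrN1 oppr_ge0.
have e0 : 0 < en h0.
  rewrite lt_neqAle en_ge0// andbT eq_sym; apply/eqP => E.
  have [r [K [r0 K0 _ KP]]] := en_eval Dw.
  have ww : nrm (w - w) < r by rewrite subrr nrm0.
  by have := KP w _ ww Hh0; rewrite E mulr0 h0w nrm1 expr1n ler10.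
pose k z := (en h0)^-1%:C * h0 z.
have Hk : H k := H_scale _ Hh0.
exists k; split => // h Hh.
pose g z := h z + (- h w) * h0 z.
have Hg : H g := H_add Hh (H_scale (- h w) Hh0).
have gw : g w = 0 by rewrite /g h0w mulr1 subrr.
have gk : ip h0 g = 0 := orth g Hg gw.
rewrite (ip_conj Hk Hh) (ip_Z _ Hh0 Hh) conjC_M conjc_real -(ip_conj Hh0 Hh).
have := ip_conj Hh0 Hg; rewrite gk conjc0 (ip_D Hh (H_scale _ Hh0) Hh0) (ip_Z _ Hh0 Hh0) ip_en//.
move/eqP; rewrite mulNr subr_eq0 => /eqP ->.
have E : (en h0)%:C != 0 :> C by rewrite eq_complex/= gt_eqF.
by rewrite mulrCA rmorphV/= ?unitfE ?gt_eqF// mulVf// mulr1.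
Qed.

End point.

(** [bergman_kernel] is a choice made by [xget], so the existence of some reproducing kernel gives
    it the reproducing property. *)
Lemma bergman_reproducing : is_reproducing_kernel D mu (bergman_kernel D mu).
Proof.
apply: xgetPex.
have /choice[K KP] : forall w, exists k, D w -> H k /\ forall h, H h -> h w = ip h k.
  move=> w; have [Dw|nDw] := pselect (D w); last by exists (cst 0).
  by have [k] := repr_exists Dw; exists k.
exists (fun z w => K w z) => w Dw; have [K1 K2] := KP w Dw.
by split => // h Hh; rewrite (K2 h Hh).
Qed.

Local Notation K := (bergman_kernel D mu).

Lemma bergman_kernel_in w : D w -> H (K ^~ w).
Proof. by move=> /bergman_reproducing[]. Qed.

Lemma bergman_rep w h : D w -> H h -> h w = ip h (K ^~ w).
Proof. by move=> /bergman_reproducing[_]; exact. Qed.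

Lemma bergman_sym z w : D z -> D w -> K z w = conjc (K w z).
Proof.
move=> Dz Dw; rewrite (bergman_rep Dz (bergman_kernel_in Dw)) (bergman_rep Dw (bergman_kernel_in Dz)).
by apply: ip_conj; exact: bergman_kernel_in.
Qed.

Lemma bergman_diag w : D w -> en (K ^~ w) = Re (K w w).
Proof. by move=> Dw; rewrite (bergman_rep Dw (bergman_kernel_in Dw)). Qed.

(** Otherwise K(., w) would vanish on [D], and the reproducing property would give the constant 1
    the value 0 at [w]. *)
Lemma bergman_diag_gt0 w : D w -> 0 < Re (K w w).
Proof.
move=> Dw; have Hk := bergman_kernel_in Dw.
rewrite -bergman_diag// lt_neqAle en_ge0// andbT eq_sym; apply/eqP => E.
have K0 z : D z -> K z w = 0.
  move=> Dz; have [r [M [r0 M0 _ MP]]] := en_eval Dz.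
  have zz : nrm (z - z) < r by rewrite subrr nrm0.
  have := MP z _ zz Hk; rewrite E mulr0 => h; apply/eqP; rewrite -nrm_eq0 -sqrf_eq0.
  by rewrite eq_le h sqr_ge0.
have := bergman_rep Dw (H_cst 1); rewrite (@eq_ip _ _ (cst 1) (fun z => 0 * cst 1 z)) //; last first.
  by move=> z /K0 ->; rewrite mul0r.
rewrite (ip_conj (H_scale 0 (H_cst 1)) (H_cst 1)) (ip_Z 0 (H_cst 1) (H_cst 1)) mul0r conjc0.
by move/eqP; rewrite oner_eq0.
Qed.

Lemma bergman_kernel_on : kernel_on D K.
Proof.
split.
- by move=> z w Dz Dw; have [_] := bergman_kernel_in Dw; exact.
- exact: bergman_sym.
- exact: bergman_diag_gt0.
move=> a b Da Db.
have [r1 [A1 [r10 A10 _ P1]]] := en_eval Da; have [r2 [A2 [r20 A20 D2 P2]]] := en_eval Db.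
(* Evaluation at x gives |K(x, y)|^2 <= A1 K(y, y), and evaluation at y gives K(y, y) <= A2; the 1
   serves to pass from |K|^2 to |K|. *)
exists (Num.min r1 r2), (A1 * A2 + 1); split; first by rewrite lt_min r10.
move=> x y; rewrite !lt_min => /andP[x1 _] /andP[_ y2].
have Dy := D2 y y2; have Hy := bergman_kernel_in Dy.
have h1 := P1 x _ x1 Hy; have h2 := P2 y _ y2 Hy.
rewrite bergman_diag// in h1 h2.
have y0 := bergman_diag_gt0 Dy.
have h3 := le_trans (ler_norm _) (Re_le_nrm (K y y)).
have h4 : Re (K y y) <= A2.
  have : Re (K y y) * Re (K y y) <= A2 * Re (K y y).
    by apply: le_trans h2; rewrite -expr2 ler_sqr ?nnegrE ?nrm_ge0 ?(ltW y0).
  by rewrite ler_pM2r.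
have h5 : A1 * Re (K y y) <= A1 * A2 by rewrite ler_pM2l.
have := le_trans h1 h5; have := nrm_ge0 (K x y).
move: (nrm _) (A1 * A2) => u c u0 uc; have := sqr_ge0 (u - 1); nra.
Qed.

Lemma bergman_unique K' : is_reproducing_kernel D mu K' ->
  forall z w, D z -> D w -> K z w = K' z w.
Proof.
move=> KP z w Dz Dw; have [Hz rz] := KP z Dz; have [Hw rw] := KP w Dw.
have Hk := bergman_kernel_in Dz.
rewrite (bergman_sym Dz Dw) (rw _ Hk) -[integralC _ _]/(ip (K ^~ z) (K' ^~ w)).
by rewrite -(ip_conj Hk Hw) -(bergman_rep Dz Hw).
Qed.

End kernel.

(** * Isometries *)

Section isometry_identity.
Context (R : realType).
Local Notation C := R[i].
Local Notation Re := (@complex.Re R).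
Local Notation Im := (@complex.Im R).
Variables (n m : nat) (D1 : set 'rV[C]_n) (D2 : set 'rV[C]_m).
Variables (mu1 : 'rV[C]_n -> R) (mu2 : 'rV[C]_m -> R) (f : 'rV[C]_n -> 'rV[C]_m).
Hypotheses (bD1 : bounded_domain D1) (bD2 : bounded_domain D2).
Hypotheses (w1 : weight D1 mu1) (w2 : weight D2 mu2).
Hypothesis iso : holomorphic_isometry D1 mu1 D2 mu2 f.

Local Notation K1 := (bergman_kernel D1 mu1).
Local Notation K2 := (bergman_kernel D2 mu2).

Lemma isometry_identity a z w : D1 a -> D1 z -> D1 w ->
  K2 (f z) (f w) * K1 a w * K1 z a * K2 (f a) (f a) =
  K1 z w * K2 (f a) (f w) * K2 (f z) (f a) * K1 a a.
Proof.
have [_ oD1 cD1 _] := bD1; have [_ oD2 _ _] := bD2; have [fh fD fm] := iso.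
have k1 := bergman_kernel_on bD1 w1; have k2 := bergman_kernel_on bD2 w2.
apply: (kernel_identity oD1 cD1 (pull_kernel k2 fh fD) k1) => {a z w} z u v Dz.
have P := pull_lam oD1 oD2 k2 fh fD u v Dz.
have E1 := metricE oD1 k1 u v (erefl _) Dz.
have E2 := metricE oD2 k2 ('d f z u) ('d f z v) (erefl _) (fD z Dz).
exact: (etrans P (etrans (esym E2) (etrans (fm z Dz u v) E1))).
Qed.

(** [isometry_identity] at a fixed point [a], its diagonal factors distributed over both arguments
    by square roots. Positivity on the diagonal makes the two functions nonzero at [a] and [f a],
    which excludes the solution s0 = r0 = 0. *)
Lemma isometry_functions : exists (s0 : 'rV[C]_n -> C) (r0 : 'rV[C]_m -> C),
  [/\ bergman_space D1 mu1 s0, bergman_space D2 mu2 r0,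
      exists2 z, D1 z & s0 z != 0, exists2 z, D2 z & r0 z != 0 &
      forall z w, D1 z -> D1 w ->
        s0 z * conjc (s0 w) * K2 (f z) (f w) = r0 (f z) * conjc (r0 (f w)) * K1 z w].
Proof.
have [fh fD _] := iso; have [[a Da] _ _ _] := bD1.
have k1 := bergman_kernel_on bD1 w1; have k2 := bergman_kernel_on bD2 w2.
have Dfa := fD a Da.
have p1 := bergman_diag_gt0 bD1 w1 Da; have p2 := bergman_diag_gt0 bD2 w2 Dfa.
have e1 : K1 a a = (Re (K1 a a))%:C by have := kap_diag k1 Da; rewrite /kap cjK.
have e2 : K2 (f a) (f a) = (Re (K2 (f a) (f a)))%:C.
  by have := kap_diag k2 Dfa; rewrite /kap cjK.
have sq (x : R) : 0 < x -> (Num.sqrt x)%:C * (Num.sqrt x)%:C = x%:C :> C.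
  by move=> x0; rewrite -rmorphM/= -expr2 sqr_sqrtr// ltW.
have nz (x : R) : 0 < x -> x%:C != 0 :> C by move=> x0; rewrite eq_complex/= gt_eqF.
exists (fun z => (Num.sqrt (Re (K2 (f a) (f a))))%:C * K1 z a),
  (fun z => (Num.sqrt (Re (K1 a a)))%:C * K2 z (f a)); split.
- by apply: (H_scale bD1 w1); exact: bergman_kernel_in.
- by apply: (H_scale bD2 w2); exact: bergman_kernel_in.
- by exists a => //; rewrite e1 mulf_neq0// nz// sqrtr_gt0.
- by exists (f a) => //; rewrite e2 mulf_neq0// nz// sqrtr_gt0.
move=> z w Dz Dw; rewrite !conjC_M !conjc_real -(bergman_sym bD1 w1 Da Dw).
rewrite -(bergman_sym bD2 w2 Dfa (fD w Dw)).
have := isometry_identity Da Dz Dw; have := sq _ p1; have := sq _ p2.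
rewrite -e1 -e2; set x := (Num.sqrt (Re (K1 a a)))%:C; set y := (Num.sqrt _)%:C => <- <- H.
transitivity (K2 (f z) (f w) * K1 a w * K1 z a * (y * y)); first by ring.
by rewrite H; ring.
Qed.

End isometry_identity.

(** * The Bergman kernel of the unit disc *)

Section disc.
Context (R : realType).
Local Notation C := R[i].
Local Notation Re := (@complex.Re R).
Local Notation Im := (@complex.Im R).
Local Notation T2 := (measurableTypeR R * measurableTypeR R)%type.
Local Notation plane := (@lebesgue_plane R).
Local Notation D := (@unit_disc R).

Definition udisc : set C := [set z | nrm z < 1].

Lemma unit_discE (v : 'rV[C]_1) : D v = udisc (v 0 0).
Proof. by rewrite /unit_disc /udisc/= nrmE ltcR. Qed.

Lemma open_udisc : open udisc.
Proof.
by have := @open_ball_nrm R C 0 1; congr open; apply/seteqP; split => z /=; rewrite subr0.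
Qed.

Definition row1 (z : C) : 'rV[C]_1 := \row__ z.

Lemma row1E z : row1 z 0 0 = z. Proof. by rewrite mxE. Qed.

Lemma row1K (v : 'rV[C]_1) : row1 (v 0 0) = v.
Proof. by apply/rowP => j; rewrite mxE ord1. Qed.

Lemma nrm_row1 z : nrm (row1 z) = nrm z.
Proof.
apply/eqP; rewrite eq_le -{3}(row1E z) nrm_coord andbT.
apply/ler_addgt0Pr => e e0; apply/ltW/nrm_lt_coord => [|i]; first by rewrite ltr_wpDl ?nrm_ge0.
by rewrite mxE ltrDl.
Qed.

Lemma nrm_coord1 (v : 'rV[C]_1) : nrm (v 0 0) = nrm v.
Proof. by rewrite -nrm_row1 row1K. Qed.

Lemma row1B z w : row1 z - row1 w = row1 (z - w).
Proof. by apply/rowP => j; rewrite !mxE. Qed.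

Lemma diff_row1 z : differentiable row1 z /\ 'd row1 z = row1 :> (C -> _).
Proof.
apply: (@diff_quad R C _ row1 z row1 0 1 ltr01).
- by move=> a x y; apply/rowP => j; rewrite !mxE.
- by exists 1 => // u; rewrite mul1r nrm_row1.
- move=> u _; rewrite row1B [z + u]addrC addrK.
  by rewrite subrr nrm0 mul0r.
Qed.

Lemma diff_coord (v : 'rV[C]_1) : differentiable (fun v : 'rV[C]_1 => v 0 0) v /\
  'd (fun v : 'rV[C]_1 => v 0 0) v = (fun u : 'rV[C]_1 => u 0 0) :> (_ -> C).
Proof.
apply: (@diff_quad R _ C (fun v : 'rV[C]_1 => v 0 0) v (fun u : 'rV[C]_1 => u 0 0) 0 1 ltr01).
- by move=> a x y; rewrite !mxE.
- by exists 1 => // u; rewrite mul1r nrm_coord1.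
- by move=> u _; rewrite !mxE [v 0 0 + _]addrC addrK subrr nrm0 mul0r.
Qed.

Lemma unit_disc_domain : bounded_domain D.
Proof.
have D0 : D 0 by rewrite unit_discE /udisc/= mxE nrm0.
have DE : D = [set v : 'rV[C]_1 | udisc (v 0 0)] by apply/funext => v; rewrite unit_discE.
split; first by exists 0.
- by rewrite DE; apply: open_comp; [move=> v _; exact: cont_coord|exact: open_udisc].
- have -> : D = \bigcup_(v in D) [set t%:C *: v | t in `[(0:R), 1]].
    apply/seteqP; split => [v Dv|v [u Du [t] /= t01 <-]].
      by exists v => //; exists 1; rewrite /= ?in_itv/= ?ler01 ?lexx ?scale1r.
    move: t01; rewrite in_itv/= => /andP[t0 t1]; rewrite unit_discE /udisc/= nrm_coord1.
    move: Du; rewrite unit_discE /udisc/= nrm_coord1; apply: le_lt_trans.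
    by rewrite nrmZ nrm_real ger0_norm// ler_piMl ?nrm_ge0.
  apply: bigcup_connected.
    by exists 0 => v Dv; exists 0; rewrite /= ?in_itv/= ?ler01 ?lexx ?scale0r.
  move=> v Dv; apply: connected_continuous_connected.
    exact: segment_connected.
  apply: cont_on_within => t _; have := pder_cont (pder_affine 0 v t).
  by rewrite (_ : (fun s : R => 0 + _) = (fun s : R => s%:C *: v))//; apply/funext => s; rewrite add0r.
exists 1; split; first exact: real1.
move=> x x1 v; rewrite unit_discE /udisc/= nrm_coord1 => v1.
by apply: le_trans (ltW x1); rewrite nrmE -[1]/(1%:C) lecR ltW.
Qed.

Lemma weight_one (mu : 'rV[C]_1 -> R) : (forall z, closure D z -> mu z = 1) -> weight D mu.
Proof.
move=> mu1; split; last by move=> z /mu1 ->.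
apply/subspace_continuousP => z cz A /= A1; have {}A1 : nbhs (1 : R) A by rewrite -(mu1 z cz).
change (nbhs z [set y | closure D y -> A (mu y)]).
by apply: filterE => y /= cy; rewrite mu1//; exact: (nbhs_singleton A1).
Qed.

(** The measure [dV R 1] is the plane measure times a point mass at the empty tuple. The
    push-forward formula handles nonnegative functions; [G] is split into its two parts. *)
Lemma dV1E (B : set T2) (G : T2 -> \bar R) : measurable B -> measurable_fun B G ->
  (\int[dV R 1]_(t in (fun t : 1.-tuple T2 => thead t) @^-1` B) G (thead t) =
   \int[plane]_(p in B) G p)%E.
Proof.
move=> mB mG.
have mth : measurable_fun [set: 1.-tuple T2] (fun t : 1.-tuple T2 => thead t).
  exact: measurable_tnth.
have H (g : T2 -> \bar R) : measurable_fun B g -> (forall p, (0 <= g p)%E) ->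
    (\int[dV R 1]_(t in (fun t : 1.-tuple T2 => thead t) @^-1` B) g (thead t) =
     \int[plane]_(p in B) g p)%E.
  move=> mg g0.
  rewrite -(ge0_integral_pushforward mth (dV R 1) mB mg)//.
  apply: eq_measure_integral => Y mY _.
  rewrite /pushforward /dV/= /cons_measure /pushforward.
  rewrite (_ : _ @^-1` _ = Y `*` setT); last first.
    by apply/seteqP; split => -[p t] /=; rewrite theadE => //= -[].
  by rewrite product_measure1E//= diracT mule1.
rewrite integralE [RHS]integralE; congr (_ - _)%E.
  apply: etrans (H _ (measurable_funepos mG) (funepos_ge0 G)).
  by apply: eq_integral => t _; rewrite !funeposE.
apply: etrans (H _ (measurable_funeneg mG) (funeneg_ge0 G)).
by apply: eq_integral => t _; rewrite !funenegE.
Qed.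

Lemma dV1C (B : set C) (F : C -> C) : measurable (@pt R @^-1` B) ->
  measC (@pt R @^-1` B) (F \o @pt R) ->
  intC (dV R 1) (@toC R 1 @^-1` [set v | B (v 0 0)]) (fun t => F (toC t 0 0)) =
  intC plane (@pt R @^-1` B) (F \o @pt R).
Proof.
move=> mB [F1 F2]; apply: eqReIm; rewrite /= /Rintegral; congr fine.
  rewrite -(dV1E mB (_ : measurable_fun _ (EFin \o (Re \o (F \o @pt R))))); last exact/measurable_EFinP.
  by congr (integral _ _ _); [apply/seteqP; split => t /=; rewrite mxE|apply/funext => t; rewrite mxE].
rewrite -(dV1E mB (_ : measurable_fun _ (EFin \o (Im \o (F \o @pt R))))); last exact/measurable_EFinP.
by congr (integral _ _ _); [apply/seteqP; split => t /=; rewrite mxE|apply/funext => t; rewrite mxE].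
Qed.

Lemma seqtoM (x y : nat -> C) l m : seqto x l -> seqto y m -> seqto (fun k => x k * y k) (l * m).
Proof.
move=> xl ym e e0.
have m0 : 0 < nrm m + 1 by rewrite ltr_wpDl ?nrm_ge0.
have l0 : 0 < nrm l + 1 by rewrite ltr_wpDl ?nrm_ge0.
have e1 : 0 < Num.min 1 (e / 2 / (nrm m + 1)) by rewrite lt_min ltr01 !divr_gt0.
have e2 : 0 < e / 2 / (nrm l + 1) by rewrite !divr_gt0.
have [N1 P1] := xl _ e1; have [N2 P2] := ym _ e2.
exists (maxn N1 N2) => k; rewrite geq_max => /andP[/P1 + /P2].
rewrite lt_min => /andP[a1 a2] b.
have -> : x k * y k - l * m = x k * (y k - m) + (x k - l) * m by ring.
apply: (le_lt_trans (nrmD _ _)); rewrite !nrmM [ltRHS](splitr e).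
have xk : nrm (x k) <= nrm l + 1.
  by have := nrm_sub_ge (x k) l; move: a1; move: (nrm _) (nrm _) (nrm _) => u v w; lra.
apply: ltr_leD.
  have [->|xk0] := eqVneq (nrm (x k)) 0; first by rewrite mul0r divr_gt0.
  apply: (@lt_le_trans _ _ (nrm (x k) * (e / 2 / (nrm l + 1)))).
    by rewrite ltr_pM2l// lt_neqAle eq_sym xk0 nrm_ge0.
  rewrite mulrCA ler_piMr ?divr_ge0 ?(ltW e0)//.
  by rewrite ler_pdivrMr// mul1r.
apply: le_trans (ler_wpM2r (nrm_ge0 m) (ltW a2)) _.
rewrite mulrAC ler_pdivrMr// ler_wpM2l ?divr_ge0 ?(ltW e0)//.
by rewrite lerDl.
Qed.

Lemma seqto_ReIm (x y : nat -> R) (a b : R) : x @ \oo --> a -> y @ \oo --> b ->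
  seqto (fun k => x k +i* y k) (a +i* b).
Proof.
move=> /cvgrPdist_lt xa /cvgrPdist_lt yb e e0.
have e2 : 0 < e / 2 by rewrite divr_gt0.
have [N1 _ P1] := xa _ e2; have [N2 _ P2] := yb _ e2.
exists (maxn N1 N2) => k; rewrite geq_max => /andP[/P1 h1 /P2 h2].
apply: (le_lt_trans (nrm_le_ReIm _)); rewrite [ltRHS](splitr e) /=.
by apply: ltrD; rewrite distrC.
Qed.

(** Radii increasing to 1; the shift [k.+2] makes [rad 0] positive. *)
Definition rad (k : nat) : R := 1 - k.+2%:R^-1.

Lemma rad_gt0 k : 0 < rad k.
Proof. by rewrite subr_gt0 invf_lt1// ltr1n. Qed.

Lemma rad_lt1 k : rad k < 1.
Proof. by rewrite /rad gtrBl invr_gt0. Qed.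

Lemma rad_cvg (e : R) : 0 < e -> exists N, forall k, (N <= k)%N -> 1 - e < rad k.
Proof.
move=> e0; have [N _ NP] := near_infty_natSinv_lt (PosNum e0).
exists N => k kN; rewrite /rad ltrD2l ltrN2; apply: (NP k.+1).
exact: leq_trans kN (leqnSn k).
Qed.

Let B := @pt R @^-1` udisc.
Let Bk k := @pt R @^-1` cdisc 0 (rad k).
Let mB : measurable B. Proof. by apply: measurable_openC; exact: open_udisc. Qed.
Let mBk k : measurable (Bk k). Proof. exact: cdisc_plane. Qed.
Let BkB k : Bk k `<=` B.
Proof.
by move=> p; rewrite /Bk /cdisc /B /udisc/= subr0 => h; apply: le_lt_trans h (rad_lt1 k).
Qed.

Lemma disc_limR (F : T2 -> R) : plane.-integrable B (EFin \o F) ->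
  (fun k => \int[plane]_(p in Bk k) F p) @ \oo --> \int[plane]_(p in B) F p.
Proof.
move=> FI; have mF : measurable_fun B (EFin \o F) by move: FI => /integrableP[].
have [|||||_ _ H] := @dominated_convergence _ _ R plane B mB
  (fun k => (EFin \o F) \_ (Bk k)) (EFin \o F) (abse \o (EFin \o F)).
- move=> k; apply/(measurable_restrict _ (mBk k) mB).
  by apply: (measurable_funS mB _ mF); exact: subIsetl.
- exact: mF.
- apply: aeW => p Bp; apply: cvg_near_cst.
  have e0 : 0 < 1 - nrm (pt p) by rewrite subr_gt0.
  have [N NP] := rad_cvg e0; exists N => // k /NP /=; rewrite subKr => h.
  by rewrite patchE mem_set// /Bk /cdisc/= subr0 ltW.
- exact: integrable_abse.
- apply: aeW => p k Bp; rewrite patchE; case: ifP => //= _.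
  by rewrite normr0 lee_fin.
have E : (fun k => \int[plane]_(p in Bk k) F p) =
    fine \o (fun k => \int[plane]_(p in B) (((EFin \o F) \_ (Bk k)) p))%E.
  by apply/funext => k /=; rewrite -integral_mkcondr setIidr.
rewrite E; apply: fine_cvg; rewrite fineK//; exact: integrable_fin_num.
Qed.

Lemma disc_limC (F : T2 -> C) : integrC plane B F ->
  seqto (fun k => intC plane (Bk k) F) (intC plane B F).
Proof. by move=> [F1 F2]; apply: seqto_ReIm; exact: disc_limR. Qed.

Lemma plane_udisc_fin : (plane B < +oo)%E.
Proof.
apply: le_lt_trans (@cdisc_fin R 0 1); apply: le_measure; rewrite ?inE//; first exact: cdisc_plane.
by move=> p; rewrite /B /udisc /cdisc/= subr0 => /ltW.
Qed.

Definition udarea : R := fine (plane B).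

Lemma udarea_gt0 : 0 < udarea.
Proof.
apply: lt_le_trans (area_gt0 0 (rad_gt0 0)) _; rewrite /udarea /area fine_le//.
- rewrite ge0_fin_numE ?cdisc_fin//; exact: measure_ge0.
- rewrite ge0_fin_numE ?plane_udisc_fin//; exact: measure_ge0.
- by apply: le_measure; rewrite ?inE; [exact: mBk|exact: mB|exact: (@BkB 0)].
Qed.

(** [disc_kernel] applies on the smaller discs, where [g] is holomorphic up to the boundary, and
    gives values at rad k ^+ 2 times w; both sides converge as the radii tend to 1. *)
Lemma udisc_kernel (g : C -> C) (w : C) : udisc w ->
  (forall z, udisc z -> differentiable g z) ->
  integrC plane B (fun p => g (pt p) * conjc (gk w (pt p) ^+ 2)) ->
  intC plane B (fun p => g (pt p) * conjc (gk w (pt p) ^+ 2)) = g w * udarea%:C.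
Proof.
move=> Dw gd gI; apply: (seqto_unique (disc_limC gI)).
have -> : (fun k => intC plane (Bk k) (fun p => g (pt p) * conjc (gk w (pt p) ^+ 2))) =
    (fun k => g ((rad k ^+ 2)%:C * w) * (area 0 (rad k))%:C).
  by apply/funext => k; rewrite (disc_kernel (rad_gt0 k) (rad_lt1 k) Dw gd).
apply: seqtoM.
  move=> e e0; have := (cont_nrmP _ _).1 (differentiable_continuous (gd w Dw)) e e0.
  move=> /nbhs_nrm[d d0 dP].
  have d2 : 0 < d / 2 by rewrite divr_gt0.
  have [N NP] := rad_cvg d2.
  exists N => k /NP kN; apply: dP.
  have -> : (rad k ^+ 2)%:C * w - w = - ((1 - rad k ^+ 2)%:C * w).
    by rewrite rmorphB/= rmorph1 mulrBl mul1r opprB.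
  rewrite nrmN nrmM nrm_real.
  have r0 := rad_gt0 k; have r1 := rad_lt1 k.
  have h0 : 0 <= 1 - rad k ^+ 2 by rewrite subr_ge0 exprn_ile1 ?ltW.
  rewrite ger0_norm//; apply: (@le_lt_trans _ _ (1 - rad k ^+ 2)).
    by rewrite ler_piMr// ltW.
  have -> : 1 - rad k ^+ 2 = (1 - rad k) * (1 + rad k) by ring.
  apply: (@lt_le_trans _ _ (d / 2 * 2)); last by rewrite divfK ?pnatr_eq0.
  have a1 : 0 <= 1 - rad k by rewrite subr_ge0 ltW.
  have a2 : 0 <= 1 + rad k by rewrite addr_ge0 ?ler01 ?(ltW r0).
  have b1 : 1 - rad k < d / 2 by rewrite ltrBlDr addrC -ltrBlDr.
  have b2 : 1 + rad k < 2 by rewrite -[ltRHS]/(1 + 1) ltrD2l.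
  exact: (ltr_pM a1 a2 b1 b2).
have := disc_limC (_ : integrC plane B (cst 1)).
have E (A : set T2) : measurable A -> intC plane A (cst 1) = (fine (plane A))%:C.
  move=> mA; rewrite /intC !Rintegral_cst//.
  by apply: eqReIm; rewrite /= ?mul1r ?mul0r.
rewrite E//; have -> : (fun k => intC plane (Bk k) (cst 1)) = (fun k => (area 0 (rad k))%:C).
  by apply/funext => k; rewrite E.
apply; apply: (@integrC_bounded _ _ _ _ _ mB _ (nrm (1 : C))); [exact: measC_cst|exact: plane_udisc_fin|].
by [].
Qed.

End disc.

(** * A quantitative Gram determinant estimate *)

Section gram.
Context (R : realType).
Local Notation C := R[i].
Local Notation Re := (@complex.Re R).
Local Notation Im := (@complex.Im R).
Variables (n : nat) (D : set 'rV[C]_n) (mu : 'rV[C]_n -> R).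
Hypotheses (bD : bounded_domain D) (wmu : weight D mu).
Local Notation K := (bergman_kernel D mu).

Lemma bergman_diag_real x : D x -> K x x = (Re (K x x))%:C.
Proof. by move=> Dx; have := kap_diag (bergman_kernel_on bD wmu) Dx; rewrite /kap cjK. Qed.

(* The Gram determinant of k_x and k_b is at most K(x,x) |k_x - k_b|^2, and
   |k_x - k_b|^2 is the increment of k_x - k_b between b and x. *)
Lemma bergman_gram b : D b -> exists d L : R, [/\ 0 < d, 0 < L &
  forall x, nrm (x - b) < d -> D x /\
    Re (K x x) * Re (K b b) - nrm (K x b) ^+ 2 <= Re (K x x) * (L * nrm (x - b)) ^+ 2].
Proof.
move=> Db; have [d0 [M [d00 M0 dD KM]]] := en_eval bD wmu Db.
have s0 : 0 < Num.sqrt M by rewrite sqrtr_gt0.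
pose L := 12 * Num.sqrt M / d0.
have L0 : 0 < L by rewrite divr_gt0// mulr_gt0.
exists (d0 / 2), L; split => //; first by rewrite divr_gt0.
move=> x xb; have xd : nrm (x - b) < d0.
  by apply: lt_trans xb _; rewrite ltr_pdivrMr// ltr_pMr// ltr1n.
have Dx := dD x xd; split => //.
have Hx := bergman_kernel_in bD wmu Dx; have Hb := bergman_kernel_in bD wmu Db.
pose h z := K z x + (-1) * K z b.
have Hh : bergman_space D mu h := H_add bD wmu Hx (H_scale bD wmu (-1) Hb).
have E : h x - h b = (en D mu h)%:C.
  have hx := bergman_rep bD wmu Dx Hh; have hb := bergman_rep bD wmu Db Hh.
  have e1 : ip D mu (K ^~ x) h = conjc (h x) by rewrite (ip_conj bD wmu Hh Hx) -hx.
  have e2 : ip D mu (K ^~ b) h = conjc (h b) by rewrite (ip_conj bD wmu Hh Hb) -hb.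
  have e3 : ip D mu h h = conjc (h x) + (-1) * conjc (h b).
    rewrite -e1 -e2 -(ip_Z bD wmu (-1) Hb Hh).
    exact: (ip_D bD wmu Hx (H_scale bD wmu (-1) Hb) Hh).
  have := ip_en bD wmu Hh; rewrite e3 => /(congr1 conjc).
  by rewrite conjc_real mulN1r -conjC_B conjcK.
have e0 := en_ge0 bD wmu Hh.
pose p := Re (K x x); pose q := Re (K b b); pose r := K x b.
have eE : en D mu h = p + q - 2 * Re r.
  have := congr1 Re E; rewrite /= => <-.
  rewrite /h (bergman_sym bD wmu Db Dx) -/r /p /q.
  by move: (K x x) (K b b) r => [x1 x2] [y1 y2] [z1 z2] /=; ring.
(* Point evaluation bounds [h] by sqrt (M en h), so the Lipschitz estimate reads en h <= L |x - b|
   sqrt (en h), and one square root cancels. *)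
have hM y : nrm (y - b) < d0 -> nrm (h y) <= Num.sqrt M * Num.sqrt (en D mu h).
  move=> yb; rewrite -(@ler_pXn2r _ 2) ?nnegrE ?nrm_ge0 ?mulr_ge0 ?sqrtr_ge0//.
  by rewrite exprMn !sqr_sqrtr ?(ltW M0)//; exact: KM.
have hd y : nrm (y - b) < d0 -> differentiable h y.
  by move=> yb; exact: (Hh.2 y (dD y yb)).
have Lip := @lipschitzV R _ h b d0 _ d00 hd hM (x - b) xb.
rewrite [b + _]addrC subrK E nrm_real ger0_norm// in Lip.
have sL : Num.sqrt (en D mu h) <= L * nrm (x - b).
  have [->|ep] := eqVneq (en D mu h) 0; first by rewrite sqrtr0 mulr_ge0 ?nrm_ge0 ?(ltW L0).
  have se0 : 0 < Num.sqrt (en D mu h) by rewrite sqrtr_gt0 lt_neqAle eq_sym ep.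
  rewrite -(ler_pM2r se0) -expr2 sqr_sqrtr//; apply: le_trans Lip _.
  by rewrite /L le_eqVlt; apply/orP; left; apply/eqP; field; rewrite gt_eqF.
have eL : en D mu h <= (L * nrm (x - b)) ^+ 2.
  rewrite -(sqr_sqrtr e0) ler_sqr// ?nnegrE ?sqrtr_ge0// mulr_ge0 ?nrm_ge0//.
  exact: ltW.
have p0 : 0 < p := bergman_diag_gt0 bD wmu Dx.
apply: (@le_trans _ _ (p * en D mu h)); last by rewrite ler_pM2l.
rewrite eE -/p -/q -/r nrm_sqr -subr_ge0.
have -> : p * (p + q - 2 * Re r) - (p * q - (Re r ^+ 2 + Im r ^+ 2)) =
    (p - Re r) ^+ 2 + Im r ^+ 2 by ring.
by rewrite addr_ge0 ?sqr_ge0.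
Qed.

End gram.

(** * Isometries of the unit disc *)

Section disc_isometry.
Context (R : realType).
Local Notation C := R[i].
Local Notation Re := (@complex.Re R).
Local Notation Im := (@complex.Im R).
Local Notation T2 := (measurableTypeR R * measurableTypeR R)%type.
Local Notation plane := (@lebesgue_plane R).
Local Notation D := (@unit_disc R).
Local Notation B := (@pt R @^-1` @udisc R).
Variable mu1 : 'rV[C]_1 -> R.
Hypothesis mu1_1 : forall z, closure D z -> mu1 z = 1.

Let bD := unit_disc_domain R.
Let w1 := weight_one mu1_1.
Let mB : measurable B. Proof. by apply: measurable_openC; exact: open_udisc. Qed.

Definition dker (z w : 'rV[C]_1) : C := (udarea R)^-1%:C * gk (w 0 0) (z 0 0) ^+ 2.

Lemma gk_bound (w z : C) : udisc w -> udisc z -> nrm (gk w z) <= (1 - nrm w)^-1.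
Proof.
move=> Dw Dz; have d0 : 0 < 1 - nrm w by rewrite subr_gt0.
rewrite /gk nrmV lef_pV2 ?posrE// ?nrm_gt0 ?(den_neq0 Dw Dz)//.
apply: le_trans (nrm_sub_ge _ _); rewrite nrm1 lerD2l lerN2 nrmM nrm_conj.
by rewrite ler_piMr ?nrm_ge0// ltW.
Qed.

Lemma dker_in w : D w -> bergman_space D mu1 (dker ^~ w).
Proof.
rewrite unit_discE => Dw.
pose a := (udarea R)^-1 * (1 - nrm (w 0 0))^-1 ^+ 2.
have A0 := udarea_gt0 R.
apply: (@H_dom R 1 D mu1 bD w1 _ (sq mu1 (cst a%:C))).
- move=> z; rewrite unit_discE => Dz.
  have gd := (gk_diff Dw Dz).1.
  have gd' : differentiable (fun z : 'rV[C]_1 => gk (w 0 0) (z 0 0)) z.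
    exact: (@differentiable_comp _ _ _ _ (fun z : 'rV[C]_1 => z 0 0) (gk (w 0 0)) z (diff_coord z).1 gd).
  apply: (diff_scaleC _ _).1.
  exact: (differentiableM gd' gd').
- exact: (sq_integrable bD w1 (H_cst bD w1 _)).
- move=> z Dz; rewrite !sqE ler_wpM2r ?(ltW (weight_gt0 w1 Dz))//.
  move: Dz; rewrite unit_discE => Dz.
  have B0 : 0 <= (1 - nrm (w 0 0))^-1 by rewrite invr_ge0 subr_ge0 ltW.
  have a0 : 0 <= a by rewrite mulr_ge0 ?sqr_ge0// invr_ge0 ltW.
  rewrite ler_sqr ?nnegrE ?nrm_ge0// -[cst _ _]/(a%:C) nrm_real ger0_norm//.
  rewrite /dker nrmM nrm_real ger0_norm ?invr_ge0 ?(ltW A0)// ler_wpM2l ?invr_ge0 ?(ltW A0)//.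
  rewrite nrmX ler_sqr ?nnegrE ?nrm_ge0//.
  exact: gk_bound.
Qed.

Lemma dV1_integrable (G : T2 -> \bar R) : measurable_fun B G ->
  (dV R 1).-integrable ((fun t : 1.-tuple T2 => thead t) @^-1` B) (fun t => G (thead t)) ->
  plane.-integrable B G.
Proof.
move=> mG /integrableP[_ H]; apply/integrableP; split => //.
by rewrite -(dV1E mB (_ : measurable_fun B (abse \o G)))//; exact: measurableT_comp.
Qed.

(** The integral over 1-tuples becomes one over the plane, where [udisc_kernel] applies;
    integrability follows from the finite energy of both factors. *)
Lemma dker_rep : is_reproducing_kernel D mu1 dker.
Proof.
move=> w Dw; split; first exact: dker_in.
move=> h Hh; have Hk := dker_in Dw.
have Dw0 : udisc (w 0 0) by rewrite -unit_discE.
pose g (z : C) : C := h (row1 z).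
have gd z : udisc z -> differentiable g z.
  move=> Dz; have [_ hd] := Hh.
  apply: (@differentiable_comp _ _ _ _ (@row1 R) h z (diff_row1 z).1); apply: hd.
  by rewrite unit_discE row1E.
pose F (z : C) : C := g z * conjc (gk (w 0 0) z ^+ 2).
have A0 := udarea_gt0 R.
have AE : @toC R 1 @^-1` D = @toC R 1 @^-1` [set v | udisc (v 0 0)].
  by apply/seteqP; split => t /=; rewrite unit_discE.
have FE t : (@toC R 1 @^-1` D) t ->
    h (toC t) * conjc (dker (toC t) w) * (mu1 (toC t))%:C = (udarea R)^-1%:C * F (toC t 0 0).
  move=> Dt; rewrite mu1_1; last exact: subset_closure.
  by rewrite mulr1 /dker conjC_M conjc_real mulrCA /F /g row1K.
have mF : measC B (F \o @pt R).
  have Fc z : udisc z -> {for z, continuous F}.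
    move=> Dz; apply: contM; first exact/differentiable_continuous/gd.
    apply: cont_conj; have [g1 _] := gk_diff Dw0 Dz.
    by apply: contM; exact: differentiable_continuous.
  split.
    by apply: (@measurable_contC R _ (Re \o F) (@open_udisc R)) => z /Fc; exact: cont_Re.
  by apply: (@measurable_contC R _ (Im \o F) (@open_udisc R)) => z /Fc; exact: cont_Im.
have FI : integrC plane B (F \o @pt R).
  have mA : measurable (@toC R 1 @^-1` D) by apply: measurable_open; case: bD.
  have := integrC_Z mA (udarea R)%:C (ip_int bD w1 Hh Hk).
  have E t : (@toC R 1 @^-1` D) t -> (udarea R)%:C * (h (toC t) * conjc (dker (toC t) w) * (mu1 (toC t))%:C) = F (pt (thead t)).
    move=> Dt; rewrite FE// mulrA -rmorphM/= divff ?gt_eqF// mul1r.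
    by rewrite mxE.
  have TE : @toC R 1 @^-1` D = (fun t : 1.-tuple T2 => thead t) @^-1` B.
    by rewrite AE; apply/seteqP; split => t /=; rewrite mxE.
  move=> [I1 I2]; have [m1 m2] := mF; split.
    apply: dV1_integrable; first exact/measurable_EFinP.
    rewrite -TE; apply: eq_integrable I1 => // t /set_mem Dt /=.
    by rewrite -(E t Dt).
  apply: dV1_integrable; first exact/measurable_EFinP.
  rewrite -TE; apply: eq_integrable I2 => // t /set_mem Dt /=.
  by rewrite -(E t Dt).
rewrite -[integralC _ _]/(intC (dV R 1) (@toC R 1 @^-1` D)
  (fun t => h (toC t) * conjc (dker (toC t) w) * (mu1 (toC t))%:C)).
rewrite (eq_intC _ FE) AE.
rewrite (@dV1C R (@udisc R) (fun z => (udarea R)^-1%:C * F z) mB); last first.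
  by apply: measC_M => //; exact: measC_cst.
rewrite (intC_Z mB _ FI) (udisc_kernel Dw0 gd FI) mulrCA -rmorphM/= mulVf ?gt_eqF// mulr1.
by rewrite /g row1K.
Qed.

Lemma disc_kernelE z w : D z -> D w -> bergman_kernel D mu1 z w = dker z w.
Proof. exact: (bergman_unique bD w1 dker_rep). Qed.

Section map.
Variables (mu2 : 'rV[C]_1 -> R) (f : 'rV[C]_1 -> 'rV[C]_1).
Hypotheses (w2 : weight D mu2) (iso : holomorphic_isometry D mu1 D mu2 f).
Local Notation K2 := (bergman_kernel D mu2).

Definition nsq (z : 'rV[C]_1) : R := nrm (z 0 0) ^+ 2.

Lemma nsq_lt1 z : D z -> 0 <= nsq z < 1.
Proof.
rewrite unit_discE /udisc/= /nsq => h; rewrite exprn_ge0 ?nrm_ge0//=.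
by rewrite exprn_ilt1 ?nrm_ge0.
Qed.

(** The identity behind the pseudo-hyperbolic distance of the disc. *)
Lemma den_sqr (z a : 'rV[C]_1) : nrm (1 - conjc (a 0 0) * z 0 0) ^+ 2 =
  (1 - nsq z) * (1 - nsq a) + nrm (z - a) ^+ 2.
Proof.
rewrite -(nrm_coord1 (z - a)) !mxE /nsq !nrm_sqr.
by case: (z 0 0) => x1 x2; case: (a 0 0) => y1 y2 /=; ring.
Qed.

(* The polarized identity at [w = z], with the explicit kernel
   [udarea^-1 (1 - z \bar w)^-2] of the disc. *)
Lemma modulus_identity z a : D z -> D a ->
  nrm (K2 (f z) (f a)) ^+ 2 * (nrm (1 - conjc (a 0 0) * z 0 0) ^+ 2) ^+ 2 =
  Re (K2 (f z) (f z)) * Re (K2 (f a) (f a)) * ((1 - nsq z) * (1 - nsq a)) ^+ 2.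
Proof.
move=> Dz Da; have [fh fD _] := iso; have Dfz := fD z Dz; have Dfa := fD a Da.
have sqE (x : C) : x * conjc x = (nrm x ^+ 2)%:C.
  by rewrite nrm_sqr; case: x => u v; apply: eqReIm; rewrite ?cReM ?cImM/=; ring.
have A0 := udarea_gt0 R.
have diagE x : D x -> dker x x = ((udarea R)^-1 * ((1 - nsq x) ^+ 2)^-1)%:C.
  move=> Dx; rewrite /dker rmorphM/=; congr (_ * _).
  rewrite /gk exprVn rmorphV/=; last first.
    by rewrite unitfE expf_neq0// gt_eqF// subr_gt0; case/andP: (nsq_lt1 Dx).
  by rewrite rmorphXn/= rmorphB/= rmorph1 /nsq -sqE [conjc _ * _]mulrC.
have offE : nrm (dker z a) ^+ 2 = ((udarea R)^-1) ^+ 2 * ((nrm (1 - conjc (a 0 0) * z 0 0) ^+ 2) ^+ 2)^-1.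
  rewrite /dker nrmM nrm_real ger0_norm ?invr_ge0 ?(ltW A0)// exprMn; congr (_ * _).
  by rewrite /gk nrmX nrmV -!exprM exprVn.
have := isometry_identity bD bD w1 w2 iso Da Dz Dz.
rewrite !disc_kernelE//.
have -> : dker a z = conjc (dker z a).
  by have := bergman_sym bD w1 Da Dz; rewrite !disc_kernelE.
rewrite (bergman_sym bD w2 Dfa Dfz) (bergman_diag_real bD w2 Dfz) (bergman_diag_real bD w2 Dfa).
rewrite !diagE// -[_ * conjc (dker z a) * dker z a]mulrA [conjc (dker z a) * _]mulrC sqE.
rewrite -[_ * conjc (K2 (f z) (f a)) * K2 (f z) (f a)]mulrA [conjc (K2 _ _) * _]mulrC sqE.
rewrite -!rmorphM/= => /(congr1 Re) /=; rewrite offE.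
have z1 : 0 < 1 - nsq z by rewrite subr_gt0; case/andP: (nsq_lt1 Dz).
have a1 : 0 < 1 - nsq a by rewrite subr_gt0; case/andP: (nsq_lt1 Da).
have N0 : 0 < nrm (1 - conjc (a 0 0) * z 0 0).
  by rewrite nrm_gt0 den_neq0//; rewrite -?[_ = true]unit_discE; move: Da Dz; rewrite !unit_discE.
set p := Re (K2 (f z) (f z)); set q := Re (K2 (f a) (f a)); set r := nrm (K2 _ _).
have [N NE] : exists N, N = nrm (1 - conjc (a 0 0) * z 0 0) by eexists.
move: N0; rewrite -!NE; clear NE offE.
move: N r p q (1 - nsq z) (1 - nsq a) (udarea R) A0 z1 a1.
move=> N r p q s t A A0 s0 t0 N0 H.
have N0' : N != 0 by rewrite gt_eqF.
have A0' : A != 0 by rewrite gt_eqF.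
have s0' : s != 0 by rewrite gt_eqF.
have t0' : t != 0 by rewrite gt_eqF.
apply/esym; transitivity (p * (A^-1 ^+ 2 * ((N ^+ 2) ^+ 2)^-1) * q * ((N ^+ 2) ^+ 2 * A ^+ 2 * (s * t) ^+ 2)).
  by field; rewrite N0' A0'.
rewrite H; field; by rewrite s0' t0' A0'.
Qed.

(** Let S = (1 - |z|^2)(1 - |a|^2) and x2 = |z - a|^2. By [modulus_identity], the Gram determinant
    of K2 over the product of its diagonal values is 1 - (S / (S + x2))^2, and this is at least x2 /
    4 because S + x2 <= 4. [bergman_gram] bounds the determinant from above. *)
Lemma inverse_lipschitz a : D a -> exists d c : R, [/\ 0 < d, 0 < c &
  forall z, D z -> nrm (f z - f a) < d -> nrm (z - a) <= c * nrm (f z - f a)].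
Proof.
move=> Da; have [fh fD _] := iso; have Dfa := fD a Da.
have [d [L [d0 L0 G]]] := bergman_gram bD w2 Dfa.
have q0 := bergman_diag_gt0 bD w2 Dfa.
(* Adding 1 makes c > 1, so that the bound c on the ratio of squares may be weakened to c^2 before
   taking roots. *)
pose c := 4 * L ^+ 2 / Re (K2 (f a) (f a)) + 1.
have c1 : 1 < c by rewrite ltrDr divr_gt0// mulr_gt0// exprn_gt0.
have c0 : 0 < c by apply: lt_trans c1.
exists d, c; split => // z Dz zd; have Dfz := fD z Dz.
have [_ G1] := G _ zd.
have p0 := bergman_diag_gt0 bD w2 Dfz.
have M := modulus_identity Dz Da; rewrite den_sqr in M.
have /andP[z1 z2] := nsq_lt1 Dz; have /andP[a1 a2] := nsq_lt1 Da.
have N4 : nrm (1 - conjc (a 0 0) * z 0 0) ^+ 2 <= 4.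
  have : nrm (1 - conjc (a 0 0) * z 0 0) <= 2.
    apply: le_trans (nrmB _ _) _; rewrite nrm1 nrmM nrm_conj -[leRHS]/(1 + 1) lerD2l.
    move: Dz Da; rewrite !unit_discE /udisc/= => h1 h2.
    by apply/ltW; rewrite mulr_ilt1 ?nrm_ge0.
  move=> h; have -> : 4 = 2 ^+ 2 :> R by rewrite -natrX.
  by rewrite ler_sqr ?nnegrE ?nrm_ge0.
rewrite den_sqr in N4.
pose x2 := nrm (z - a) ^+ 2; pose y2 := nrm (f z - f a) ^+ 2.
have X0 : 0 <= x2 by rewrite exprn_ge0 ?nrm_ge0.
pose S := (1 - nsq z) * (1 - nsq a).
have S0 : 0 < S by rewrite mulr_gt0 ?subr_gt0.
have key : Re (K2 (f a) (f a)) * x2 <= 4 * (L ^+ 2 * y2).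
  move: G1 M N4; rewrite exprMn -/x2 -/y2 -/S.
  move: (Re (K2 (f z) (f z))) (Re (K2 (f a) (f a))) (nrm (K2 (f z) (f a)) ^+ 2) p0 q0.
  move=> p q r p0 q0 G1 M N4.
  have N0 : 0 < S + x2 by rewrite ltr_wpDr.
  have rE : r = p * q * (S / (S + x2)) ^+ 2.
    have N0' : S + x2 != 0 by rewrite gt_eqF.
    by apply: (@mulIf _ ((S + x2) ^+ 2)); [rewrite expf_neq0|rewrite M; field].
  have u : x2 / 4 <= 1 - (S / (S + x2)) ^+ 2.
    have -> : 1 - (S / (S + x2)) ^+ 2 = x2 / (S + x2) * (1 + S / (S + x2)).
      by field; rewrite gt_eqF.
    apply: (@le_trans _ _ (x2 / (S + x2) * 1)).
      by rewrite mulr1 ler_wpM2l// lef_pV2 ?posrE.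
    rewrite ler_wpM2l ?divr_ge0 ?(ltW N0)// lerDl divr_ge0//; exact: ltW.
  have h : p * q * (x2 / 4) <= p * (L ^+ 2 * y2).
    apply: le_trans G1; rewrite rE.
    have -> : p * q - p * q * (S / (S + x2)) ^+ 2 = p * q * (1 - (S / (S + x2)) ^+ 2) by ring.
    by rewrite ler_wpM2l// mulr_ge0 ?ltW.
  rewrite -mulrA ler_pM2l// in h.
  have := ler_wpM2l (_ : 0 <= 4) h; rewrite ler0n => /(_ isT); apply: le_trans.
  by rewrite le_eqVlt; apply/orP; left; apply/eqP; field.
have h2 : x2 <= c * y2.
  have y0 : 0 <= y2 by rewrite exprn_ge0 ?nrm_ge0.
  rewrite -(ler_pM2l q0); apply: le_trans key _.
  have -> : Re (K2 (f a) (f a)) * (c * y2) = 4 * (L ^+ 2 * y2) + Re (K2 (f a) (f a)) * y2.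
    by rewrite /c; field; rewrite gt_eqF.
  by rewrite lerDl mulr_ge0// ltW.
rewrite -(@ler_pXn2r _ 2) ?nnegrE ?nrm_ge0 ?mulr_ge0 ?nrm_ge0 ?(ltW c0)// exprMn.
apply: le_trans h2 _; rewrite ler_wpM2r ?exprn_ge0 ?nrm_ge0//.
by rewrite expr2 ler_peMl ?(ltW c0) ?(ltW c1).
Qed.

End map.

End disc_isometry.

(** * Surjectivity and the holomorphic inverse *)

Section automorphism.
Context (R : realType).
Local Notation C := R[i].
Local Notation Re := (@complex.Re R).
Local Notation Im := (@complex.Im R).
Local Notation D := (@unit_disc R).
Variables (mu1 mu2 : 'rV[C]_1 -> R) (f : 'rV[C]_1 -> 'rV[C]_1).
Hypothesis mu1_1 : forall z, closure D z -> mu1 z = 1.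
Hypotheses (w2 : weight D mu2) (iso : holomorphic_isometry D mu1 D mu2 f).
Local Notation K2 := (bergman_kernel D mu2).

Let bD := unit_disc_domain R.
Let oD : open D. Proof. by case: bD. Qed.

Let F (x : C) : C := f (row1 x) 0 0.

Let udD x : udisc x -> D (row1 x). Proof. by rewrite unit_discE row1E. Qed.

Let F_disc x : udisc x -> udisc (F x).
Proof. by have [_ fD _] := iso; move=> /udD /fD; rewrite unit_discE. Qed.

Let F_diff x : udisc x -> differentiable F x.
Proof.
have [fh _ _] := iso; move=> /udD /fh fd.
have d1 : differentiable (fun x => f (row1 x)) x.
  exact: (@differentiable_comp _ _ _ _ (@row1 R) f x (diff_row1 x).1 fd).
exact: (@differentiable_comp _ _ _ _ (fun x => f (row1 x)) (fun v : 'rV[C]_1 => v 0 0) x d1 (diff_coord _).1).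
Qed.

Let F_nrm x y : nrm (F x - F y) = nrm (f (row1 x) - f (row1 y)).
Proof. by rewrite -nrm_coord1 !mxE. Qed.

Let F_lip a : udisc a -> exists d c : R, [/\ 0 < d, 0 < c &
  forall x, udisc x -> nrm (F x - F a) < d -> nrm (x - a) <= c * nrm (F x - F a)].
Proof.
move=> /udD Da; have [d [c [d0 c0 P]]] := inverse_lipschitz mu1_1 w2 iso Da.
exists d, c; split => // x /udD Dx; rewrite F_nrm => /(P _ Dx).
by rewrite row1B nrm_row1.
Qed.

(* If F omits a value y near F a, then 1 / (F - y) contradicts the Cauchy
   estimate on a circle around a, where F stays away from F a. *)
Lemma map_open a : udisc a -> exists2 d : R, 0 < d &
  forall y, nrm (y - F a) < d -> exists2 x, udisc x & F x = y.
Proof.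
move=> Da; have [R0 R00 RP] := open_nrm (@open_udisc R) Da.
have [d [c [d0 c0 lip]]] := F_lip Da.
pose r := R0 / 2; have r0 : 0 < r by rewrite divr_gt0.
have rR : r < R0 by rewrite /r ltr_pdivrMr// ltr_pMr// ltr1n.
(* On the circle |x - a| = r, either |F x - F a| >= d, or [F_lip] applies and gives r <= c |F x - F
   a|. *)
pose m := Num.min d (r / c); have m0 : 0 < m by rewrite lt_min d0 divr_gt0.
have far x : nrm (x - a) = r -> m <= nrm (F x - F a).
  move=> xr; have Dx : udisc x by apply: RP; rewrite xr.
  have [xd|] := ltP (nrm (F x - F a)) d; last by apply: le_trans; rewrite ge_min lexx.
  have := lip x Dx xd; rewrite xr => h.
  by apply: (@le_trans _ _ (r / c)); [rewrite ge_min lexx orbT|rewrite ler_pdivrMr// mulrC].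
have m8 : 0 < m / 8 by rewrite divr_gt0.
(* On the circle |F - y| >= m / 2, so the Cauchy bound at [a] would give |F a - y| >= m / 4. *)
exists (m / 8) => // y yd; apply: contrapT => no.
have nz x : udisc x -> F x - y != 0.
  by move=> Dx; rewrite subr_eq0; apply/eqP => E; apply: no; exists x.
pose g (x : C) : C := (F x - y)^-1.
have gd x : nrm (x - a) < R0 -> differentiable g x.
  move=> /RP Dx; have d1 : differentiable (fun x => F x - y) x.
    exact: (differentiableB (F_diff Dx) (differentiable_cst _ _)).
  exact: (@differentiableV _ _ (fun x => F x - y) x d1 (nz x Dx)).
have aa : nrm (a - a) < r by rewrite subrr nrm0.
have bnd t : 0 <= t <= 2 * pi -> nrm (g (circ a r t)) <= 2 / m.
  move=> _; have xr := nrm_circ a t (ltW r0); have h1 := far _ xr.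
  have h2 := nrm_tri (F (circ a r t)) (F a) y.
  have h3 : m / 2 <= nrm (F (circ a r t) - y).
    have aux (u v : R) : 0 < u -> u <= v + u / 8 -> u / 2 <= v by move=> ? ?; lra.
    apply: aux => //; apply: le_trans h1 (le_trans h2 _); by rewrite lerD2l ltW.
  rewrite /g nrmV -invf_div lef_pV2 ?posrE ?divr_gt0//.
  by apply: lt_le_trans h3; rewrite divr_gt0.
have := cauchy_bound gd r0 rR aa bnd.
rewrite subrr nrm0 subr0 divff ?gt_eqF// mulr1 /g nrmV => h.
have ay : 0 < nrm (F a - y) by rewrite nrm_gt0 nz.
have : 1 <= 4 / m * nrm (F a - y).
  rewrite -ler_pdivrMr// mul1r; apply: le_trans h _.
  by rewrite mulrA -natrM.
have : nrm (F a - y) < m / 8 by rewrite nrmBC.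
move=> h1 h2; have : 4 / m * nrm (F a - y) < 4 / m * (m / 8) by rewrite ltr_pM2l ?divr_gt0.
have -> : 4 / m * (m / 8) = 2^-1 by field; rewrite gt_eqF.
by move=> h3; have := le_lt_trans h2 h3; lra.
Qed.

(** On a smaller closed disc the continuous function 1 / |F - zeta| is bounded by compactness.
    Points whose images approach zeta must therefore approach the unit circle. *)
Lemma map_far (r : R) (zeta : C) : 0 < r -> r < 1 -> (forall x, udisc x -> F x != zeta) ->
  exists2 e : R, 0 < e & forall x, nrm x <= r -> e <= nrm (F x - zeta).
Proof.
move=> r0 r1 no.
have rD x : nrm x <= r -> udisc x by move=> h; exact: le_lt_trans r1.
have pos x : nrm x <= r -> 0 < nrm (F x - zeta) by move=> /rD /no; rewrite nrm_gt0 subr_eq0.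
have [|||M M0 MP] := @cont_boundedC R [set x | nrm x <= r] (fun x => (nrm (F x - zeta))^-1) r.
- by [].
- have := @closed_cdisc R 0 r; congr closed; apply/seteqP.
  by split => x; rewrite /cdisc/= subr0.
- move=> x xr; have c1 : {for x, continuous (fun x => nrm (F x - zeta))}.
    exact: (cont_nrm (contB (differentiable_continuous (F_diff (rD x xr))) (@cont_cst _ _ zeta x))).
  exact: (@cvgV _ _ _ _ (fun x => nrm (F x - zeta)) _ (lt0r_neq0 (pos x xr)) c1).
exists M^-1; first by rewrite invr_gt0.
move=> x xr; have := MP x xr; rewrite ger0_norm ?invr_ge0 ?nrm_ge0//.
by move=> h; rewrite -[leRHS]invrK lef_pV2 ?posrE ?invr_gt0 ?pos.
Qed.

(* As f(z) approaches a boundary point of the image, |z| -> 1 and hence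
   K1(z,z) -> oo, while K1(z,a) stays bounded. *)
Lemma boundary_kernel (zeta : C) a : udisc zeta -> D a ->
  (forall x, udisc x -> F x != zeta) ->
  (forall e : R, 0 < e -> exists2 x, udisc x & nrm (F x - zeta) < e) ->
  K2 (row1 zeta) (f a) = 0.
Proof.
move=> Dz Da no near; have [fh fD _] := iso; have Dfa := fD a Da.
have k2 := bergman_kernel_on bD w2; have [k2d _ _ k2b] := k2.
apply/eqP; rewrite -nrm_eq0; apply/negPn/negP => nz.
have c0 : 0 < nrm (K2 (row1 zeta) (f a)) by rewrite lt_neqAle eq_sym nz nrm_ge0.
set c := nrm (K2 (row1 zeta) (f a)) in c0.
have c2 : 0 < c / 2 by rewrite divr_gt0.
have [d1 d10 d1P] := Dif_continuous (diff_Dif (k2d _ _ (udD Dz) Dfa)) c2.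
have [d2 [M [d20 MP]]] := k2b _ _ (udD Dz) (udD Dz).
have q0 := bergman_diag_gt0 bD w2 Dfa.
have M0 : 0 < M.
  have zz : nrm (row1 zeta - row1 zeta) < d2 by rewrite subrr nrm0.
  apply: lt_le_trans (bergman_diag_gt0 bD w2 (udD Dz)) _.
  by apply: le_trans (MP _ _ zz zz); apply: le_trans (ler_norm _) (Re_le_nrm _).
have Da0 : nrm (a 0 0) < 1 by move: (Da); rewrite unit_discE.
pose b := 1 - nrm (a 0 0); have b0 : 0 < b by rewrite subr_gt0.
(* [T] bounds the left side of [modulus_identity] from below near zeta; [eta] is chosen so that the
   right side is at most 2 M q eta <= T / 2 once |x| > 1 - eta. *)
pose T := (c / 2) ^+ 2 * (b ^+ 2) ^+ 2.
have T0 : 0 < T by rewrite mulr_gt0// !exprn_gt0.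
pose q := Re (K2 (f a) (f a)).
pose eta := Num.min (2^-1) (T / (4 * (M * q))).
have Mq : 0 < M * q by rewrite mulr_gt0.
have eta0 : 0 < eta by rewrite lt_min invr_gt0 ltr0n divr_gt0// mulr_gt0.
have eta1 : eta <= 2^-1 by rewrite ge_min lexx.
have r0 : 0 < 1 - eta by rewrite subr_gt0; apply: le_lt_trans eta1 _; rewrite invf_lt1// ltr1n.
have r1 : 1 - eta < 1 by rewrite ltrBlDr ltrDl.
have [e e0 eP] := map_far r0 r1 no.
have [|x Dx] := near (Num.min e (Num.min d1 d2)); first by rewrite !lt_min e0 d10.
rewrite !lt_min => /and3P[xe x1 x2].
have Dz' := udD Dx; have Dfz := fD _ Dz'.
have fz : nrm (f (row1 x) - row1 zeta) = nrm (F x - zeta) by rewrite -nrm_coord1 !mxE.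
have xr : 1 - eta < nrm x.
  by rewrite ltNge; apply/negP => h; have := eP _ h; rewrite leNgt xe.
have K2c : c / 2 <= nrm (K2 (f (row1 x)) (f a)).
  have := d1P (f (row1 x)); rewrite fz => /(_ x1) h.
  have := nrm_sub_ge (K2 (row1 zeta) (f a)) (K2 (f (row1 x)) (f a)).
  rewrite -/c nrmBC; move: h; move: (nrm _) (nrm _) => u v; lra.
have KM : Re (K2 (f (row1 x)) (f (row1 x))) <= M.
  apply: le_trans (le_trans (ler_norm _) (Re_le_nrm _)) _.
  by apply: MP; rewrite fz.
have := modulus_identity mu1_1 w2 iso Dz' Da.
have /andP[z1 z2] := nsq_lt1 Dz'; have /andP[a1 a2] := nsq_lt1 Da.
have Nb : b <= nrm (1 - conjc (a 0 0) * row1 x 0 0).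
  apply: le_trans (nrm_sub_ge _ _); rewrite nrm1 /b lerD2l lerN2 nrmM nrm_conj row1E.
  by rewrite ler_piMr ?nrm_ge0// ltW.
have L : T <= nrm (K2 (f (row1 x)) (f a)) ^+ 2 * (nrm (1 - conjc (a 0 0) * row1 x 0 0) ^+ 2) ^+ 2.
  rewrite /T ler_pM ?exprn_ge0 ?(ltW c2) ?(ltW b0)//.
    by rewrite ler_sqr ?nnegrE ?nrm_ge0 ?(ltW c2).
  rewrite ler_sqr ?nnegrE ?exprn_ge0 ?nrm_ge0 ?(ltW b0)//.
  by rewrite ler_sqr ?nnegrE ?nrm_ge0 ?(ltW b0).
move=> E; rewrite E in L.
have u1 : 1 - nsq (row1 x) <= 2 * eta.
  have -> : 1 - nsq (row1 x) = (1 - nrm x) * (1 + nrm x) by rewrite /nsq row1E; ring.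
  have h1 : 1 - nrm x <= eta by rewrite lerBlDr -lerBlDl ltW.
  have h2 : 1 + nrm x <= 2 by rewrite -[leRHS]/(1 + 1) lerD2l ltW.
  by rewrite mulrC ler_pM// ?subr_ge0 ?addr_ge0 ?nrm_ge0 ?ltW.
have S0 : 0 <= (1 - nsq (row1 x)) * (1 - nsq a) by rewrite mulr_ge0 ?subr_ge0 ?ltW.
have S1 : (1 - nsq (row1 x)) * (1 - nsq a) <= 2 * eta.
  by apply: le_trans u1; rewrite ler_piMr ?subr_ge0 ?(ltW z2)// lerBlDr lerDl.
have S2 : ((1 - nsq (row1 x)) * (1 - nsq a)) ^+ 2 <= 2 * eta.
  rewrite expr2; apply: le_trans (S1); rewrite ler_piMl//; apply: le_trans S1 _.
  by rewrite mulrC -ler_pdivlMr// mul1r.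
have U : Re (K2 (f (row1 x)) (f (row1 x))) * Re (K2 (f a) (f a)) *
    ((1 - nsq (row1 x)) * (1 - nsq a)) ^+ 2 <= M * q * (2 * eta).
  rewrite ler_pM ?sqr_ge0//; first by rewrite mulr_ge0 ?ltW// (bergman_diag_gt0 bD w2).
  by rewrite ler_pM2r.
have := le_trans L U.
have : M * q * (2 * eta) <= M * q * (2 * (T / (4 * (M * q)))).
  by rewrite ler_pM2l// ler_pM2l// ge_min lexx orbT.
have aux (u v : R) : 0 < u -> u * (2 * (v / (4 * u))) = v / 2 by move=> u0; field; rewrite gt_eqF.
rewrite (aux _ T Mq).
by move=> h1 h2; have := le_trans h2 h1; rewrite ler_pdivlMr// ger_pMr// leNgt ltr1n.
Qed.

(** If zeta were omitted, K2(., zeta) would vanish on the image, which contains a ball by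
    [map_open]; the identity theorem spreads this over the disc and contradicts K2(zeta, zeta) >
    0. *)
Lemma map_closed (zeta : C) : udisc zeta ->
  (forall e : R, 0 < e -> exists2 x, udisc x & nrm (F x - zeta) < e) ->
  exists2 x, udisc x & F x = zeta.
Proof.
move=> Dz near; apply: contrapT => no.
have no' x : udisc x -> F x != zeta by move=> Dx; apply/eqP => E; apply: no; exists x.
have [_ fD _] := iso; have [_ _ cD _] := bD.
have [k2d _ _ _] := bergman_kernel_on bD w2.
have D0 : udisc (0 : C) by rewrite /udisc/= nrm0.
have [d d0 dP] := map_open D0.
have Df0 := fD _ (udD D0).
have := bergman_diag_gt0 bD w2 (udD Dz).
have -> : K2 (row1 zeta) (row1 zeta) = 0; last by rewrite ltxx.
apply: (@identity_open R _ D (K2 ^~ (row1 zeta)) (f (row1 0)) d oD cD) => //.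
- by move=> x Dx; apply: k2d => //; exact: udD.
- move=> y yd; have [|x Dx Fx] := dP (y 0 0).
    by apply: le_lt_trans yd; have := nrm_coord (y - f (row1 0)) 0; rewrite !mxE.
  have yE : f (row1 x) = y by rewrite -[LHS]row1K -[RHS]row1K -/(F x) Fx.
  rewrite (bergman_sym bD w2 _ (udD Dz)); last by rewrite -yE; exact: fD (udD Dx).
  by rewrite -yE (boundary_kernel Dz (udD Dx) no' near) conjc0.
- exact: udD.
Qed.

Lemma map_surj (y : C) : udisc y -> exists2 x, udisc x & F x = y.
Proof.
have [[a Da] _ cD _] := bD; have [_ fD _] := iso.
pose O := [set v : 'rV[C]_1 | exists2 x, udisc x & F x = v 0 0].
have oO : open O.
  rewrite openE => v [x Dx Fx]; have [d d0 dP] := map_open Dx.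
  apply/nbhs_nrm; exists d => // u uv; apply: dP; rewrite Fx.
  by apply: le_lt_trans uv; have := nrm_coord (u - v) 0; rewrite !mxE.
have DO : D `&` O = D.
  apply: cD.
  - exists (f a); split; first exact: fD.
    by exists (a 0 0); rewrite -?unit_discE// /F row1K.
  - by exists O.
  exists (closure O); first exact: closed_closure.
  apply/seteqP; split => v [Dv Ov]; split => //; first exact: subset_closure.
  have := @map_closed (v 0 0); rewrite -unit_discE => /(_ Dv); apply => e e0.
  have [u [[x Dx Fx] /= uv]] : (O `&` [set u | nrm (u - v) < e]) !=set0.
    by apply: Ov; apply/nbhs_nrm; exists e.
  exists x => //; rewrite Fx; apply: le_lt_trans uv.
  by have := nrm_coord (u - v) 0; rewrite !mxE.
move=> /udD Dy; have : (D `&` O) (row1 y) by rewrite DO.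
by move=> [_ [x Dx]]; rewrite row1E; exists x.
Qed.

Lemma disc_automorphism : automorphism D f.
Proof.
have [fh fD _] := iso; split => //.
have /choice[G GP] : forall y, exists x, udisc y -> udisc x /\ F x = y.
  move=> y; have [Dy|nDy] := pselect (udisc y); last by exists 0.
  by have [x Dx Fx] := map_surj Dy; exists x.
(* At equal values of [F], the estimate of [F_lip] bounds the distance of the two preimages by 0. *)
have GF x : udisc x -> G (F x) = x.
  move=> Dx; have [d [c [d0 c0 lip]]] := F_lip Dx.
  have [Dg Fg] := GP _ (F_disc Dx).
  have := lip _ Dg; rewrite Fg subrr nrm0 mulr0 => /(_ d0).
  by rewrite nrm_le0 subr_eq0 => /eqP.
have Gd y : udisc y -> differentiable G y.
  move=> Dy; have [Da Fa] := GP y Dy; set a := G y in Da Fa *.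
  have [d [c [d0 c0 lip]]] := F_lip Da.
  pose p : C := 'd F a 1.
  have Fp (e : R) : 0 < e -> exists2 r : R, 0 < r &
      forall k, nrm k < r -> nrm (F (a + k) - F a - k * p) <= e * nrm k.
    move=> e0; have [_ _ H] := diff_Dif (F_diff Da); have [r r0 rP] := H e e0.
    by exists r => // k /rP; rewrite (diff1E F a k).
  have p0 : p != 0.
    apply/eqP => p0; have e0 : 0 < (2 * c)^-1 by rewrite invr_gt0 mulr_gt0.
    have [r r0 rP] := Fp _ e0; have [r' r'0 r'P] := open_nrm (@open_udisc R) Da.
    (* A real increment within reach of all the estimates: if p = 0 they give k0 <= c |F (a + k0) -
       F a| <= k0 / 2. *)
    pose k0 := Num.min (Num.min r r') (d * (2 * c)) / 2.
    have m0 : 0 < Num.min (Num.min r r') (d * (2 * c)) by rewrite !lt_min r0 r'0/= !mulr_gt0.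
    have k00 : 0 < k0 by rewrite divr_gt0.
    have : k0 < Num.min (Num.min r r') (d * (2 * c)) by rewrite /k0 ltr_pdivrMr// ltr_pMr// ltr1n.
    rewrite !lt_min => /andP[/andP[k1 k2] k3].
    have kn : nrm (k0%:C : C) = k0 by rewrite nrm_real gtr0_norm.
    have := rP k0%:C; rewrite p0 mulr0 subr0 kn => /(_ k1) h.
    have Dk : udisc (a + k0%:C) by apply: r'P; rewrite addrAC subrr add0r kn.
    have := lip _ Dk; rewrite [a + _ - a]addrAC subrr add0r kn.
    have hd : nrm (F (a + k0%:C) - F a) < d.
      by apply: le_lt_trans h _; rewrite mulrC ltr_pdivrMr// mulr_gt0.
    move=> /(_ hd) h2; have : c * nrm (F (a + k0%:C) - F a) <= c * ((2 * c)^-1 * k0).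
      by rewrite ler_pM2l.
    have -> : c * ((2 * c)^-1 * k0) = k0 / 2 by field; rewrite gt_eqF.
    by move=> /(le_trans h2); rewrite ler_pdivlMr// ger_pMr// leNgt ltr1n.
  have np : 0 < nrm p by rewrite nrm_gt0.
  suff : Dif G y (fun u => u * p^-1) by move=> /Dif_diff[].
  split.
  - exact: linear_mulr.
  - by exists (nrm p^-1); [exact: nrm_ge0|move=> u; rewrite nrmM mulrC].
  (* Dividing the remainder by [p] costs a factor 1 / |p|, and replacing |x - a| by |u| a factor
     c. *)
  move=> e e0; have e'0 : 0 < e * nrm p / c by rewrite divr_gt0// mulr_gt0.
  have [r r0 rP] := Fp _ e'0; have [r' r'0 r'P] := open_nrm (@open_udisc R) Dy.
  exists (Num.min (Num.min r' d) (r / c)); first by rewrite !lt_min r'0 d0 divr_gt0.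
  move=> u; rewrite !lt_min => /andP[/andP[u1 u2] u3].
  have Dyu : udisc (y + u) by apply: r'P; rewrite addrAC subrr add0r.
  have [Dx Fx] := GP _ Dyu; set x := G (y + u) in Dx Fx *.
  have E : F x - F a = u by rewrite Fx Fa addrAC subrr add0r.
  have xa : nrm (x - a) <= c * nrm u by have := lip x Dx; rewrite E; exact.
  have xr : nrm (x - a) < r by apply: le_lt_trans xa _; rewrite mulrC -ltr_pdivlMr.
  have := rP _ xr; rewrite [a + _]addrC subrK E => h.
  have -> : x - a - u * p^-1 = - (p^-1 * (u - (x - a) * p)) by field.
  rewrite nrmN nrmM nrmV mulrC ler_pdivrMr//; apply: le_trans h _.
  apply: le_trans (ler_wpM2l (ltW e'0) xa) _.
  by rewrite le_eqVlt; apply/orP; left; apply/eqP; field; rewrite gt_eqF.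
exists (fun v => row1 (G (v 0 0))); split.
- move=> v; rewrite unit_discE => Dv.
  have d1 : differentiable (fun v : 'rV[C]_1 => G (v 0 0)) v.
    exact: (@differentiable_comp _ _ _ _ (fun v : 'rV[C]_1 => v 0 0) G v (diff_coord v).1 (Gd _ Dv)).
  exact: (@differentiable_comp _ _ _ _ (fun v : 'rV[C]_1 => G (v 0 0)) (@row1 R) v d1 (diff_row1 _).1).
- by move=> v; rewrite unit_discE => /GP[Dg _]; exact: udD.
- move=> v; rewrite unit_discE => /GF; rewrite /F row1K => ->; exact: row1K.
- move=> v; rewrite unit_discE => /GP[_]; rewrite /F => E.
  by rewrite -[LHS]row1K E row1K.
Qed.

End automorphism.

Theorem theorem1p1 (R : realType) :
  (forall (n m : nat) (D1 : set 'rV[R[i]]_n) (D2 : set 'rV[R[i]]_m)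
     (mu1 : 'rV[R[i]]_n -> R) (mu2 : 'rV[R[i]]_m -> R)
     (f : 'rV[R[i]]_n -> 'rV[R[i]]_m),
     (0 < n)%N -> (0 < m)%N ->
     bounded_domain D1 -> bounded_domain D2 ->
     weight D1 mu1 -> weight D2 mu2 ->
     holomorphic_isometry D1 mu1 D2 mu2 f ->
     exists (s0 : 'rV[R[i]]_n -> R[i]) (r0 : 'rV[R[i]]_m -> R[i]),
       [/\ bergman_space D1 mu1 s0,
           bergman_space D2 mu2 r0,
           exists2 z, D1 z & s0 z != 0,
           exists2 z, D2 z & r0 z != 0 &
           forall z w, D1 z -> D1 w ->
             s0 z * (s0 w)^* * bergman_kernel D2 mu2 (f z) (f w) =
             r0 (f z) * (r0 (f w))^* * bergman_kernel D1 mu1 z w]) /\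
  (forall (mu1 mu2 : 'rV[R[i]]_1 -> R) (f : 'rV[R[i]]_1 -> 'rV[R[i]]_1),
     (forall z, closure unit_disc z -> mu1 z = 1) ->
     weight unit_disc mu2 ->
     holomorphic_isometry unit_disc mu1 unit_disc mu2 f ->
     automorphism unit_disc f).
Proof.
split.
  move=> n m D1 D2 mu1 mu2 f _ _ bD1 bD2 w1 w2 iso.
  have [s0 [r0 [H1 H2 H3 H4 H5]]] := isometry_functions bD1 bD2 w1 w2 iso.
  by exists s0, r0.
by move=> mu1 mu2 f mu1_1 w2 iso; exact: (disc_automorphism mu1_1 w2 iso).
Qed.
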